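(* Let $1<\alpha<(\sqrt{21}+4)/5$ and $\beta=1/(\alpha-1)$. For an integer $d\ge1$ let \[ \mathcal{N}_\alpha(d)=\#\{(m,n)\in\mathbb{N}^2 : d=\lfloor n^\alpha\rfloor-\lfloor m^\alpha\rfloor\}. \] Then \[ \lim_{d\to\infty}\frac{\mathcal{N}_\alpha(d)}{d^{\beta-1}}=\beta\alpha^{-\beta}\zeta(\beta), \] where $\zeta$ denotes the Riemann zeta function.
   Context: $\mathbb{N}$ denotes the set of positive integers and $\lfloor x\rfloor$ the greatest integer $\le x$. *)

(* Defs.v *)
From mathcomp Require Import all_boot all_order all_algebra finmap.
From mathcomp Require Import all_classical all_reals all_analysis.

Set Implicit Arguments.
Unset Strict Implicit.
Unset Printing Implicit Defensive.

Import Order.TTheory GRing.Theory Num.Theory.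
Import numFieldNormedType.Exports.

Local Open Scope classical_set_scope.
Local Open Scope ring_scope.

Definition rep_set (R : realType) (alpha : R) (d : nat) : set (nat * nat) :=
  [set mn | [/\ (0 < mn.1)%N, (0 < mn.2)%N &
     d%:Z = Num.floor (mn.2%:R `^ alpha) - Num.floor (mn.1%:R `^ alpha)]].

(* [fset_set], used in [rep_count], sends an infinite set to the empty one;
   this lemma shows that the junk value does not occur in the intended range. *)
Lemma rep_set_finite (R : realType) (alpha : R) (d : nat) :
  1 < alpha -> (0 < d)%N -> finite_set (rep_set alpha d).
Proof.
move=> a1 d0.
pose B : R := (d%:R + 1) `^ (alpha - 1)^-1.
pose K := (Num.bound B).+1.
apply: (@sub_finite_set _ _ (`I_K `*` `I_K)); last first.
  by apply: finite_setX; exact: finite_II.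
move=> [m n] [/= m0 n0 dE].
have am0 : 0 < alpha - 1 by rewrite subr_gt0.
have powE (k : nat) : (0 < k)%N ->
  k%:R `^ alpha = k%:R * k%:R `^ (alpha - 1) :> R.
  by move=> k0; rewrite mulr_powRB1 ?ler0n// (lt_trans ltr01 a1).
have mn : (m < n)%N.
  rewrite ltnNge; apply/negP => nm.
  have : Num.floor (n%:R `^ alpha : R) <= Num.floor (m%:R `^ alpha : R).
    apply: le_floor; apply: ge0_ler_powR; rewrite ?nnegrE ?ler0n ?ler_nat//.
    exact: ltW (lt_trans ltr01 a1).
  by rewrite -subr_le0 -dE lez_nat leqn0 eqn0Ngt d0.
have nB : n%:R `^ (alpha - 1) <= d%:R + 1 :> R.
  have h1 : n%:R `^ alpha - m%:R `^ alpha <= d%:R + 1 :> R.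
    have f1 := floorD1_gt (n%:R `^ alpha : R).
    have f2 := floor_le (m%:R `^ alpha : R).
    have -> : d%:R = (Num.floor (n%:R `^ alpha : R))%:~R
                     - (Num.floor (m%:R `^ alpha : R))%:~R :> R.
      by rewrite -intrB -dE.
    rewrite intrD mulr1z in f1.
    by rewrite addrAC; apply: lerB => //; exact: ltW.
  apply: le_trans h1; rewrite !powE// lerBrDr.
  have h2 : m%:R `^ (alpha - 1) <= n%:R `^ (alpha - 1) :> R.
    by apply: ge0_ler_powR; rewrite ?nnegrE ?ler0n ?ler_nat ?(ltW am0) ?(ltnW mn).
  apply: (@le_trans _ _ (n%:R `^ (alpha - 1) + m%:R * n%:R `^ (alpha - 1))).
    by rewrite lerD2l ler_wpM2l ?ler0n.
  rewrite -[X in X + _]mul1r -mulrDl ler_wpM2r ?powR_ge0//.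
  by rewrite nat1r ler_nat.
have nK : (n < K)%N.
  have nleB : n%:R <= B.
    have -> : n%:R = (n%:R `^ (alpha - 1)) `^ (alpha - 1)^-1 :> R.
      by rewrite -powRrM mulfV ?lt0r_neq0// powRr1.
    apply: ge0_ler_powR => //; rewrite ?nnegrE ?powR_ge0 ?addr_ge0 ?ler0n//.
    by rewrite invr_ge0 ltW.
  rewrite /K ltnS ltnW// -(ltr_nat R); apply: le_lt_trans nleB _.
  by apply: archi_boundP; exact: powR_ge0.
by split => //=; exact: ltn_trans nK.
Qed.

Definition rep_count (R : realType) (alpha : R) (d : nat) : nat :=
  #|` fset_set (rep_set alpha d)|.

(* The Dirichlet series, which is the Riemann zeta function only for s > 1. *)
Definition zeta (R : realType) (s : R) : R :=
  limn (series (riemannR s)).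

(* Main.v *)
Require Import Defs.
From mathcomp Require Import all_boot all_order all_algebra finmap.
From mathcomp Require Import all_classical all_reals all_analysis.
From mathcomp Require Import ring lra zify.

Import Order.TTheory GRing.Theory Num.Theory.
Import numFieldNormedType.Exports.

Local Open Scope classical_set_scope.
Local Open Scope ring_scope.

(* Write n = m + k and g(m) = (m + k)^alpha - m^alpha - d.

   For fixed k, a solution m has |g(m)| < 1, and where |g| <= 1 the indicator of
   the equation is 1 - |floor((m + k)^alpha) - floor(m^alpha) - d|.  Since k is
   fixed, the sum over m of floor((m + k)^alpha) - floor(m^alpha) differs from
   the sum of (m + k)^alpha - m^alpha by a telescoping sum, hence by O(k).  So the
   number of solutions is the sum of the tent function 1 - |g(m)|, up to O(k), and
   this is a Riemann sum asymptotic to beta (alpha k)^(-beta) d^(beta - 1).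
   Summing over k produces zeta(beta), provided that large k contribute
   o(d^(beta - 1)) uniformly.

   For k up to almost d^(beta - 1) monotonicity of g is enough.  Beyond that the
   solutions are lattice points near a smooth curve, and no exponential sums are
   needed: if two consecutive points differ by (q, b), the curve has slope
   b/q + O(delta/q) there, so a lower bound on the second derivative limits how
   often (q, b) can occur.  Applying the same idea to x |-> f(x + a) - f(x), for
   consecutive points at distance a, gives a bound by the third derivative.
   The third derivative bound is used with k as the variable for
   k <= d^kappa1, the second derivative bound with m as the variable for larger k.
   At alpha = (sqrt 21 + 4)/5 both bounds are of order d^(beta - 1) when
   k = d^kappa1 with kappa1 = (sqrt 21 - 3)/3. *)

(** * Counting in separated sets *)

(** The obstacle is the summand 1 in the monotonicity bound 1 + O(d^(beta - 1) k^(-beta)) for each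
    k. The second summand adds up to a tail of the zeta series, but k runs up to about d^(1 /
    alpha), which exceeds d^(beta - 1) once alpha is above the golden ratio. So either few k may
    have a solution at all, or, for the largest k, few m may occur; each m then belongs to at most 3
    values of k.

    Origin of kappa1 and of sqrt 21: let tau be just below beta - 1. In a block of K = d^kappa
    values, gaps longer than L = K / d^tau cost K / L = d^tau. The critical term of the third
    derivative bound is X'' L^6 with X'' of order d^(beta - kappa beta - 2 kappa); it asks for kappa
    (4 - beta) <= 6 beta - 7. In the second derivative bound, for blocks of m up to M = d^(beta (1 -
    kappa)), the critical term is N'' M L^2, where N is n as a function of m; it asks for kappa
    (beta - 1) >= 3 - 2 beta. Equality in both gives 3 kappa = 4 (beta - 1) and 4 beta^2 - 2 beta -
    5 = 0. For large beta the ranges of blocks are empty, so no case distinction on alpha is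
    made. *)

Definition cnt (P : nat -> bool) (A B : nat) : nat :=
  (\sum_(A <= m < B) P m)%N.

Definition separated (q : nat) (P : nat -> bool) (A B : nat) : Prop :=
  forall m m', (A <= m)%N -> (m < m')%N -> (m' < B)%N -> P m -> P m' ->
  (m + q <= m')%N.

(** The induction on [B] keeps the first point [m0] and the last point [m1]: a new point at [B] lies
    at least [q] beyond [m1]. Both are returned so that a function can be evaluated at them. *)
Lemma cnt_span (P : nat -> bool) A B q : separated q P A B ->
  cnt P A B = 0%N \/ exists m0 m1, [/\ (A <= m0)%N, (m0 <= m1 < B)%N, P m0, P m1 &
    (q * (cnt P A B).-1 + m0 <= m1)%N].
Proof.
elim: B => [|B IH] sep; first by left; rewrite /cnt big_geq.
have [BA|AB] := ltnP B A; first by left; rewrite /cnt big_geq.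
have cntS : cnt P A B.+1 = (cnt P A B + P B)%N by rewrite /cnt big_nat_recr.
have sep' : separated q P A B.
  by move=> m m' Am mm' m'B; apply: sep => //; exact: ltnW.
case: (IH sep') => [c0|[m0 [m1 [Am0 /andP[m01 m1B] Pm0 Pm1 qm]]]].
  case: (boolP (P B)) => PB; last by left; rewrite cntS c0 (negbTE PB).
  by right; exists B, B; rewrite cntS c0 PB AB leqnn ltnSn muln0.
right; case: (boolP (P B)) => PB; last first.
  by exists m0, m1; rewrite cntS (negbTE PB) addn0 Am0 m01 ltnS (ltnW m1B).
exists m0, B; rewrite cntS PB addn1 /= Am0 (leq_trans m01 (ltnW m1B)) ltnSn; split => //.
have c1 : (0 < cnt P A B)%N.
  by rewrite /cnt (big_rem m0) ?mem_index_iota ?Am0 ?(leq_ltn_trans m01)//= Pm0.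
have := sep m1 B (leq_trans Am0 m01) m1B (ltnSn _) Pm1 PB.
apply: leq_trans; rewrite -(prednK c1) mulnS -addnA addnC.
by rewrite leq_add2r.
Qed.

(** Between the extreme points of [P] the function [h] moves by at least [mu] times their distance
    and by at most [2 * rho]. This bounds the distance, and the points in between are [q] apart. *)
Lemma sep_cnt_le (R : realType) (P : nat -> bool) A B q (h : nat -> R) (c mu rho : R) :
  (0 < q)%N -> 0 < mu -> 0 <= rho -> separated q P A B ->
  (forall m m', (A <= m)%N -> (m < m')%N -> (m' < B)%N -> P m -> P m' ->
     mu * (m'%:R - m%:R) <= `|h m' - h m|) ->
  (forall m, (A <= m < B)%N -> P m -> `|h m - c| <= rho) ->
  (cnt P A B)%:R <= 1 + 2 * rho / (q%:R * mu).
Proof.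
move=> q0 mu0 rho0 sep hmu hrho.
have qmu : 0 < q%:R * mu by rewrite mulr_gt0// ltr0n.
have r0 : 0 <= 2 * rho / (q%:R * mu) by rewrite divr_ge0 ?mulr_ge0// ltW.
case: (cnt_span P A B q sep) => [->|[m0 [m1 [Am0 /andP[m01 m1B] Pm0 Pm1 qm]]]].
  by rewrite addr_ge0.
have hm : mu * (m1%:R - m0%:R) <= 2 * rho.
  move: m01; rewrite leq_eqVlt => /orP[/eqP ->|m01].
    by rewrite subrr mulr0 mulr_ge0.
  apply: (le_trans (hmu _ _ Am0 m01 m1B Pm0 Pm1)).
  rewrite (_ : h m1 - h m0 = (h m1 - c) - (h m0 - c)); last by ring.
  apply: (le_trans (ler_normB _ _)).
  have := hrho m1; rewrite m1B (leq_trans Am0 (ltnW m01)) => /(_ isT Pm1).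
  have := hrho m0; rewrite Am0 (ltn_trans m01 m1B) => /(_ isT Pm0).
  lra.
rewrite -lerBlDl ler_pdivlMr//.
move: qm; rewrite -(ler_nat R) natrD natrM => qm.
have cp : (cnt P A B)%:R - 1 <= (cnt P A B).-1%:R :> R.
  by case: (cnt P A B) => [|n] /=; [lra|rewrite -natr1; lra].
apply: le_trans hm; rewrite mulrA (mulrC mu) ler_wpM2r ?(ltW mu0)//.
have : ((cnt P A B)%:R - 1) * q%:R <= q%:R * (cnt P A B).-1%:R :> R.
  by rewrite mulrC ler_wpM2l.
lra.
Qed.

Lemma cnt_union (P : nat -> bool) (Q : nat -> nat -> bool) A B a b :
  (forall m, (A <= m < B)%N -> P m -> exists2 j, (a <= j < b)%N & Q j m) ->
  (cnt P A B <= \sum_(a <= j < b) cnt (Q j) A B)%N.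
Proof.
move=> PQ; rewrite /cnt exchange_big /= big_nat_cond [leqRHS]big_nat_cond.
apply: leq_sum => m /andP[mAB _]; case: (boolP (P m)) => // Pm.
have [j jab Qj] := PQ m mAB Pm.
by rewrite (big_rem j) ?mem_index_iota//= Qj.
Qed.

(** The points are sorted by the integer [j] close to [h], and [sep_cnt_le] applies to each class.
    Asking for [0 < j] keeps the number of classes at [Y]; the two gap estimates below secure it by
    a shift and by convexity. *)
Lemma sep_cnt_int_le (R : realType) (P : nat -> bool) A B q (h : nat -> R) (mu rho Y : R) :
  (0 < q)%N -> 0 < mu -> 0 <= rho -> 0 <= Y -> separated q P A B ->
  (forall m m', (A <= m)%N -> (m < m')%N -> (m' < B)%N -> P m -> P m' ->
     mu * (m'%:R - m%:R) <= `|h m' - h m|) ->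
  (forall m, (A <= m < B)%N -> P m ->
     exists j : nat, [/\ (0 < j)%N, j%:R <= Y & `|h m - j%:R| <= rho]) ->
  (cnt P A B)%:R <= Y * (1 + 2 * rho / (q%:R * mu)).
Proof.
move=> q0 mu0 rho0 Y0 sep hmu hj.
pose J := Num.truncn Y.
pose Q j m := P m && (`|h m - j%:R| <= rho).
have JY : J%:R <= Y by rewrite /J truncn_le.
apply: (@le_trans _ _ (\sum_(1 <= j < J.+1) cnt (Q j) A B)%N%:R).
  rewrite ler_nat; apply: cnt_union => m mAB Pm.
  have [j [j0 jY hmj]] := hj m mAB Pm; exists j; last by rewrite /Q Pm.
  by rewrite j0 ltnS /= /J truncn_ge_nat.
rewrite natr_sum.
have r0 : 0 <= 2 * rho / (q%:R * mu).
  by rewrite divr_ge0 ?mulr_ge0 ?ler0n// ltW.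
apply: (@le_trans _ _ (J%:R * (1 + 2 * rho / (q%:R * mu)))); last first.
  by rewrite ler_wpM2r// addr_ge0.
rewrite mulr_natl -[J in X in _ <= X]subn0 -subSS -sumr_const_nat.
apply: ler_sum => j _.
apply: (@sep_cnt_le _ _ _ _ _ h j%:R) => //.
- by move=> m m' Am mm' m'B /andP[Pm _] /andP[Pm' _]; apply: sep.
- by move=> m m' Am mm' m'B /andP[Pm _] /andP[Pm' _]; apply: hmu.
- by move=> m _ /andP[].
Qed.

Definition gap (P : nat -> bool) (B q m : nat) : bool :=
  [&& P m, P (m + q)%N, (m + q < B)%N &
      all (fun i => ~~ P (m + i)%N) (iota 1 q.-1)].

Lemma gap_separated P B q A : separated q (gap P B q) A B.
Proof.
move=> m m' Am mm' m'B /and4P[Pm Pmq _ /allP al] /and4P[Pm' _ _ _].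
rewrite leqNgt; apply/negP => m'q.
have /al : (m' - m)%N \in iota 1 q.-1 by rewrite mem_iota; lia.
by rewrite subnKC ?Pm'// ltnW.
Qed.

(** A point whose successor is missing or more than [L] away is counted by [big]; such points are
    [L.+1] apart, hence the denominator. Every other point has a gap between 1 and [L]. *)
Lemma cnt_gap_le (R : realType) (P : nat -> bool) A B L : (A <= B)%N ->
  (cnt P A B)%:R <= 1 + (B%:R - A%:R) / L.+1%:R
     + \sum_(1 <= q < L.+1) (cnt (gap P B q) A B)%:R :> R.
Proof.
move=> AB.
pose big m := P m && all (fun i => ~~ (P (m + i)%N && (m + i < B)%N)) (iota 1 L).
pose Q j m := if j is 0%N then big m else gap P B j m.
have h1 : (cnt P A B <= \sum_(0 <= j < L.+1) cnt (Q j) A B)%N.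
  apply: cnt_union => m mAB Pm.
  case: (boolP (big m)) => bm; first by exists 0%N.
  move: bm; rewrite /big Pm /= -has_predC => hs.
  have /hasP[/= i0 i0L]:= hs; rewrite negbK => Pi0.
  have ex : exists i, [&& (0 < i)%N, P (m + i)%N & (m + i < B)%N].
    by exists i0; case/andP: Pi0 => -> ->; move: i0L; rewrite mem_iota; case/andP => ->.
  case: (ex_minnP ex) => i /and3P[i0' Pi iB] imin.
  have iL : (i <= L)%N.
    have : (i <= i0)%N.
      by apply: imin; case/andP: Pi0 => -> ->; move: i0L; rewrite mem_iota; case/andP => ->.
    by move: i0L; rewrite mem_iota; lia.
  exists i => //; rewrite /Q; case: i i0' Pi iB imin iL => // i _ Pi iB imin iL.
  rewrite /gap Pm Pi iB /=; apply/allP => l; rewrite mem_iota => /andP[l0 li].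
  apply/negP => Pl; have : (i.+1 <= l)%N.
    by apply: imin; rewrite l0 Pl /=; lia.
  lia.
move: h1; rewrite big_ltn// => h1.
have h2 : (cnt big A B)%:R <= 1 + (B%:R - A%:R) / L.+1%:R :> R.
  have sepb : separated L.+1 big A B.
    move=> m m' Am mm' m'B /andP[_ /allP al] /andP[Pm' _].
    rewrite leqNgt; apply/negP => m'q.
    have /al : (m' - m)%N \in iota 1 L by rewrite mem_iota; lia.
    by rewrite subnKC ?Pm' ?m'B// ltnW.
  case: (cnt_span big A B L.+1 sepb) => [->|[m0 [m1 [Am0 /andP[m01 m1B] Pm0 Pm1 qm]]]].
    by rewrite addr_ge0// divr_ge0// subr_ge0 ler_nat.
  rewrite -lerBlDl ler_pdivlMr ?ltr0n//.
  have : (L.+1 * (cnt big A B).-1 + A <= B)%N by lia.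
  rewrite -(ler_nat R) natrD natrM.
  have cp : (cnt big A B)%:R - 1 <= (cnt big A B).-1%:R :> R.
    by case: (cnt big A B) => [|n] /=; [lra|rewrite -natr1; lra].
  have : ((cnt big A B)%:R - 1) * L.+1%:R <= L.+1%:R * (cnt big A B).-1%:R :> R.
    by rewrite mulrC ler_wpM2l.
  lra.
move: h1; rewrite -(ler_nat R) natrD natr_sum => h1.
apply: (le_trans h1); apply: lerD => //.
rewrite [leRHS]big_nat [leLHS]big_nat; apply: ler_sum => j /andP[j0 _].
by case: j j0.
Qed.

(** * Lattice points close to a curve *)

Definition harm (R : realType) (L : nat) : R := \sum_(1 <= q < L.+1) q%:R^-1.

Lemma harm_ge0 (R : realType) L : 0 <= harm R L.
Proof. by apply: sumr_ge0 => q _; rewrite invr_ge0. Qed.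

Lemma sum_const_le (R : realType) L (F : nat -> R) c :
  (forall q, (0 < q <= L)%N -> F q <= c) ->
  \sum_(1 <= q < L.+1) F q <= L%:R * c.
Proof.
move=> Fc; rewrite mulr_natl -[L in X in _ <= X]subn0 -subSS -sumr_const_nat.
by rewrite big_nat [leRHS]big_nat; apply: ler_sum => q; rewrite ltnS; exact: Fc.
Qed.

Definition diff2 (R : realType) (f : nat -> R) (a q m : nat) : R :=
  f (m + a + q)%N - f (m + a)%N - (f (m + q)%N - f m).

Section lattice_points.
Variables (R : realType) (P : nat -> bool) (y : nat -> int) (f : nat -> R).
Variables (A B : nat) (delta lambda Lambda : R).
Hypothesis AB : (A <= B)%N.
Hypothesis delta0 : 0 <= delta.
Hypothesis lambda0 : 0 < lambda.
Hypothesis lambdaL : lambda <= Lambda.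
Hypothesis yf : forall m, (A <= m < B)%N -> P m -> `|(y m)%:~R - f m| <= delta.
Hypothesis f2 : forall a q m, (0 < a)%N -> (0 < q)%N -> (A <= m)%N ->
  (m + a + q < B)%N ->
  lambda * (a%:R * q%:R) <= diff2 R f a q m <= Lambda * (a%:R * q%:R).

Let N : R := B%:R - A%:R.
Let N0 : 0 <= N. Proof. by rewrite subr_ge0 ler_nat. Qed.
Let Lambda0 : 0 < Lambda. Proof. exact: lt_le_trans lambdaL. Qed.

(* A gap q with ordinate increment b puts f(m + q) - f(m), which increases by at
   least q lambda per unit of m, within 2 delta of b; and points with gap q are
   themselves q-separated. *)
Lemma gap_cnt_le2 q : (0 < q)%N -> delta <= 2^-1 ->
  (cnt (gap P B q) A B)%:R
    <= (q%:R * Lambda * N + 4) * (1 + 4 * delta / (q%:R ^+ 2 * lambda)).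
Proof.
move=> q0 d2; have q0R : 0 < q%:R :> R by rewrite ltr0n.
pose H m : R := f (m + q)%N - f m.
(* The shift by [z0] makes every ordinate increment a positive integer. It lies less than 2 below
   [H A - 2 * delta], so the increments reach at most q Lambda N + 4 delta + 2, which is where the 4
   comes from. *)
pose z0 : int := Num.floor (H A - 2 * delta) - 1.
have z0H : z0%:~R <= H A - 2 * delta - 1.
  by rewrite /z0 intrB mulr1z lerD2r floor_le.
have Hz0 : H A - 2 * delta - 2 <= z0%:~R.
  rewrite /z0 intrB mulr1z.
  have := floorD1_gt (H A - 2 * delta); rewrite intrD mulr1z; lra.
have Hmm' m m' : (A <= m)%N -> (m < m')%N -> (m' + q < B)%N ->
    lambda * (q%:R * (m'%:R - m%:R)) <= H m' - H m <= Lambda * (q%:R * (m'%:R - m%:R)).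
  move=> Am mm' m'B; have d0 : (0 < m' - m)%N by rewrite subn_gt0.
  have := @f2 (m' - m)%N q m d0 q0 Am; rewrite /diff2 subnKC ?(ltnW mm')//.
  by rewrite natrB ?(ltnW mm')// (mulrC (_ - _)) => /(_ m'B).
have HA m : (A <= m)%N -> (m + q < B)%N ->
    0 <= H m - H A <= q%:R * Lambda * N.
  rewrite leq_eqVlt => /orP[/eqP <- _|Am mB].
    by rewrite subrr lexx !mulr_ge0// ?ltW.
  have /andP[h1 h2] := Hmm' _ _ (leqnn A) Am mB.
  have mA : 0 <= m%:R - A%:R :> R by rewrite subr_ge0 ler_nat ltnW.
  apply/andP; split.
    by apply: le_trans h1; rewrite !mulr_ge0// ltW.
  apply: (le_trans h2); rewrite mulrCA mulrA ler_wpM2l ?mulr_ge0 ?(ltW Lambda0)//.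
  by rewrite /N lerD2r ler_nat; move: mB; clear; lia.
rewrite (_ : 4 * delta = 2 * (2 * delta)); last by ring.
rewrite (_ : q%:R ^+ 2 * lambda = q%:R * (q%:R * lambda)); last by ring.
apply: (@sep_cnt_int_le _ _ _ _ _ (fun m => H m - z0%:~R)) => //.
- by rewrite mulr_gt0.
- by rewrite mulr_ge0.
- by rewrite addr_ge0// !mulr_ge0// ltW.
- exact: gap_separated.
- move=> m m' Am mm' m'B /and4P[_ _ mB _] /and4P[_ _ m'qB _].
  rewrite (_ : H m' - _ - _ = H m' - H m); last by ring.
  have /andP[h1 _] := Hmm' _ _ Am mm' m'qB.
  by apply: le_trans (ler_norm _); move: h1; rewrite mulrA (mulrC lambda).
move=> m /andP[Am _] /and4P[Pm Pmq mB _].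
have y1 : `|(y m)%:~R - f m| <= delta.
  by apply: yf => //; move: Am mB; clear; lia.
have y2 : `|(y (m + q)%N)%:~R - f (m + q)%N| <= delta.
  by apply: yf => //; move: Am mB; clear; lia.
have /andP[h1 h2] := HA m Am mB.
pose j := y (m + q)%N - y m - z0.
move: y1 y2; rewrite !ler_norml => /andP[y1 y1'] /andP[y2 y2'].
have jE : j%:~R = (y (m + q)%N)%:~R - (y m)%:~R - z0%:~R :> R.
  by rewrite /j !intrB.
have Hm : H m = f (m + q)%N - f m by [].
have j1 : 1 <= j%:~R :> R by rewrite jE; lra.
have j0 : 0 < j by rewrite -(ltr_int R); lra.
have jn : (`|j|%N)%:R = j%:~R :> R by rewrite natr_absz gtr0_norm.
exists `|j|%N; split; first by rewrite absz_gt0 gt_eqF.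
  by rewrite jn jE; lra.
by rewrite jn jE ler_norml; apply/andP; split; lra.
Qed.

(** The number of increments grows like q, while the excess of points per increment is of order
    delta / (q^2 lambda). Their product has order 1 / q, so the sum over gaps costs only [harm]. *)
Lemma curve_cnt_le2 L : delta <= 2^-1 ->
  (cnt P A B)%:R <= 1 + N / L.+1%:R + Lambda * N * L%:R ^+ 2 + 4 * L%:R
    + (4 * Lambda * N + 16) * (delta / lambda) * harm R L.
Proof.
move=> d2; apply: (le_trans (cnt_gap_le R P A B L AB)).
rewrite -!addrA -/N lerD2l lerD2l.
apply: (@le_trans _ _ (\sum_(1 <= q < L.+1) ((L%:R * Lambda * N + 4)
   + (4 * Lambda * N + 16) * (delta / lambda) * q%:R^-1))).
  rewrite big_nat [leRHS]big_nat; apply: ler_sum => q /andP[q0 qL].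
  apply: (le_trans (gap_cnt_le2 q q0 d2)).
  have q1 : 1 <= q%:R :> R by rewrite ler1n.
  have qL' : q%:R <= L%:R :> R by rewrite ler_nat -ltnS.
  have LN : 0 <= Lambda * N by rewrite mulr_ge0// ltW.
  have h1 : q%:R * (Lambda * N) <= L%:R * (Lambda * N) by rewrite ler_wpM2r.
  have dl : 0 <= delta / lambda by rewrite divr_ge0// ltW.
  have i0 : 0 <= q%:R^-1 :> R by rewrite invr_ge0.
  have h2 : q%:R^-1 * q%:R^-1 <= q%:R^-1 :> R by rewrite ler_piMr// invf_le1//; lra.
  rewrite (_ : 4 * delta / (q%:R ^+ 2 * lambda) =
     4 * (delta / lambda) * (q%:R^-1 * q%:R^-1)); last first.
    by field; rewrite !gt_eqF//; lra.
  have q' : q%:R * q%:R^-1 = 1 :> R by rewrite mulfV// gt_eqF//; lra.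
  rewrite (_ : (q%:R * Lambda * N + 4) * (1 + 4 * (delta / lambda) * (q%:R^-1 * q%:R^-1))
    = q%:R * (Lambda * N) + 4 + 4 * (Lambda * N) * (delta / lambda) * q%:R^-1 * (q%:R * q%:R^-1)
      + 16 * (delta / lambda) * (q%:R^-1 * q%:R^-1)); last by ring.
  rewrite q' mulr1.
  have h3 : (delta / lambda) * (q%:R^-1 * q%:R^-1) <= (delta / lambda) * q%:R^-1.
    by rewrite ler_wpM2l.
  lra.
rewrite big_split /= -mulr_sumr -/(harm R L).
have : \sum_(1 <= q < L.+1) (L%:R * Lambda * N + 4) <= L%:R * (L%:R * Lambda * N + 4).
  exact: sum_const_le.
rewrite (_ : L%:R * (L%:R * Lambda * N + 4) = Lambda * N * L%:R ^+ 2 + 4 * L%:R); last by ring.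
by move=> h; rewrite [leRHS]addrA lerD2r.
Qed.

Variable lambda3 : R.
Hypothesis lambda30 : 0 < lambda3.
Hypothesis f3 : forall a q r m, (0 < a)%N -> (0 < q)%N -> (0 < r)%N -> (A <= m)%N ->
  (m + a + q + r < B)%N ->
  lambda3 * (a%:R * q%:R * r%:R) <= `|diff2 R f a q (m + r) - diff2 R f a q m|.

(* Two consecutive gaps a starting at m and m + q form a lattice parallelogram
   whose ordinates have an integer second difference within 4 delta of
   [diff2 f a q m].  By the hypothesis on delta that integer is positive, so it
   takes only O(a q Lambda) values. *)
Lemma gap_cnt_le3 a L : (0 < a)%N -> 8 * delta <= a%:R * lambda ->
  (cnt (gap P B a) A B)%:R <= 1 + N / L.+1%:R
    + (Lambda + lambda) * a%:R * L%:R ^+ 2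
    + 8 * (Lambda + lambda) * (delta / lambda3) * harm R L.
Proof.
move=> a0 da; have a0R : 0 < a%:R :> R by rewrite ltr0n.
(* Gaps are taken in the set of starting points of gaps [a]: [q] is the distance between consecutive
   ones. *)
apply: (le_trans (cnt_gap_le R (gap P B a) A B L AB)).
rewrite -!addrA -/N lerD2l lerD2l.
have LL : 0 < Lambda + lambda by rewrite addr_gt0.
apply: (@le_trans _ _ (\sum_(1 <= q < L.+1) ((Lambda + lambda) * a%:R * L%:R
   + 8 * (Lambda + lambda) * (delta / lambda3) * q%:R^-1))); last first.
  rewrite big_split /= -[X in _ + X]mulr_sumr -/(harm R L).
  have : \sum_(1 <= q < L.+1) ((Lambda + lambda) * a%:R * L%:R)
    <= L%:R * ((Lambda + lambda) * a%:R * L%:R) by exact: sum_const_le.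
  rewrite (_ : L%:R * ((Lambda + lambda) * a%:R * L%:R) = (Lambda + lambda) * a%:R * L%:R ^+ 2); last by ring.
  by move=> h; rewrite lerD2r.
rewrite big_nat [leRHS]big_nat; apply: ler_sum => q /andP[q0 qL].
have q0R : 0 < q%:R :> R by rewrite ltr0n.
have q1 : 1 <= q%:R :> R by rewrite ler1n.
have qL' : q%:R <= L%:R :> R by rewrite ler_nat -ltnS.
have Y0 : 0 <= (Lambda + lambda) * a%:R * q%:R by rewrite !mulr_ge0// ltW.
have -> : (Lambda + lambda) * a%:R * L%:R
   + 8 * (Lambda + lambda) * (delta / lambda3) * q%:R^-1 =
   ((Lambda + lambda) * a%:R * L%:R) + ((Lambda + lambda) * a%:R * q%:R)
     * (2 * (4 * delta) / (q%:R * (a%:R * q%:R * lambda3))).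
  by field; rewrite !gt_eqF.
apply: (@le_trans _ _ (((Lambda + lambda) * a%:R * q%:R)
     * (1 + 2 * (4 * delta) / (q%:R * (a%:R * q%:R * lambda3))))); last first.
  by rewrite mulrDr mulr1 lerD2r ler_wpM2l// mulr_ge0// ltW.
apply: (@sep_cnt_int_le _ _ _ _ _ (fun m => diff2 R f a q m)) => //.
- by rewrite !mulr_gt0.
- by rewrite mulr_ge0.
- exact: gap_separated.
- move=> m m' Am mm' m'B /and4P[_ _ mB _] /and4P[_ /and4P[_ _ m'aB _] _ _].
  have r0 : (0 < m' - m)%N by rewrite subn_gt0.
  have := @f3 a q (m' - m)%N m a0 q0 r0 Am; rewrite subnKC ?(ltnW mm')//.
  rewrite natrB ?(ltnW mm')// => h.
  rewrite mulrAC (mulrC _ lambda3); apply: h.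
  by move: m'aB mm'; clear; lia.
move=> m /andP[Am _] /and4P[/and4P[Pm Pma _ _] /and4P[Pmq Pmqa mB _] _ _].
have y1 : `|(y m)%:~R - f m| <= delta.
  by apply: yf => //; move: Am mB; clear; lia.
have y2 : `|(y (m + q)%N)%:~R - f (m + q)%N| <= delta.
  by apply: yf => //; move: Am mB; clear; lia.
have y3 : `|(y (m + a)%N)%:~R - f (m + a)%N| <= delta.
  by apply: yf => //; move: Am mB; clear; lia.
have y4 : `|(y (m + a + q)%N)%:~R - f (m + a + q)%N| <= delta.
  by rewrite addnAC; apply: yf => //; move: Am mB; clear; lia.
have /andP[h1 h2] : lambda * (a%:R * q%:R) <= diff2 R f a q m <= Lambda * (a%:R * q%:R).
  by apply: f2 => //; move: Am mB; clear; lia.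
pose j := y (m + a + q)%N - y (m + a)%N - (y (m + q)%N - y m).
move: y1 y2 y3 y4; rewrite !ler_norml => /andP[y1 y1'] /andP[y2 y2'] /andP[y3 y3'] /andP[y4 y4'].
have jE : j%:~R = (y (m + a + q)%N)%:~R - (y (m + a)%N)%:~R
    - ((y (m + q)%N)%:~R - (y m)%:~R) :> R.
  by rewrite /j !intrB.
move: h1 h2; rewrite /diff2 => h1 h2.
(* The error 4 delta is at most half of a lambda <= lambda a q. This makes [j] positive, and in the
   upper bound the error is absorbed by [Lambda + lambda]. *)
have aq : a%:R * lambda <= lambda * (a%:R * q%:R).
  by rewrite mulrA (mulrC lambda) ler_peMr// mulr_ge0// ltW.
have al : 0 < a%:R * lambda by rewrite mulr_gt0.
have j1 : 0 < j%:~R :> R by rewrite jE; lra.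
have j0 : 0 < j by rewrite -(ltr_int R).
have jn : (`|j|%N)%:R = j%:~R :> R by rewrite natr_absz gtr0_norm.
exists `|j|%N; split; first by rewrite absz_gt0 gt_eqF.
  by rewrite jn jE; lra.
by rewrite jn jE ler_norml; apply/andP; split; lra.
Qed.

(* Gaps a < 8 delta / lambda, for which the second difference may round to the
   integer 0, are left to [gap_cnt_le2]. *)
Lemma curve_cnt_le3 L : (0 < L)%N -> delta <= 2^-1 ->
  (cnt P A B)%:R <= 1 + 2 * (N / L%:R) + L%:R
    + (8 * delta / lambda) * ((8 * delta / lambda) * Lambda * N + 4) * (1 + 8 * delta / lambda)
    + (Lambda + lambda) * L%:R ^+ 6
    + 8 * L%:R * (Lambda + lambda) * (delta / lambda3) * harm R (L ^ 2).
Proof.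
move=> L0 d2; have L0R : 0 < L%:R :> R by rewrite ltr0n.
apply: (le_trans (cnt_gap_le R P A B L AB)); rewrite -/N.
set a0 := 8 * delta / lambda.
have a00 : 0 <= a0 by rewrite divr_ge0 ?mulr_ge0// ltW.
have LN : 0 <= Lambda * N by rewrite mulr_ge0// ltW.
pose C2 := (a0 * Lambda * N + 4) * (1 + a0).
have C20 : 0 <= C2 by rewrite mulr_ge0// addr_ge0// -mulrA mulr_ge0.
(* Equal gaps are cut at distance L^2 instead of L: summed over a <= L, the sparse ones then cost at
   most N / L, like the long gaps. The term L^6 arises from a (L^2)^2 summed over a <= L. *)
pose C3 := 1 + N / (L ^ 2).+1%:R + (Lambda + lambda) * L%:R * (L ^ 2)%:R ^+ 2
  + 8 * (Lambda + lambda) * (delta / lambda3) * harm R (L ^ 2).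
have LL : 0 < Lambda + lambda by rewrite addr_gt0.
have C3p : 0 <= 8 * (Lambda + lambda) * (delta / lambda3) * harm R (L ^ 2).
  by rewrite !mulr_ge0 ?harm_ge0 ?invr_ge0// ltW.
have C30 : 0 <= C3.
  rewrite addr_ge0// addr_ge0//; first by rewrite addr_ge0// divr_ge0.
  by rewrite !mulr_ge0// ltW.
have gapa a : (0 < a <= L)%N ->
    (cnt (gap P B a) A B)%:R <= C2 * (a%:R < a0)%R%:R + C3.
  move=> /andP[a1 aL]; have a1R : 1 <= a%:R :> R by rewrite ler1n.
  have aLR : a%:R <= L%:R :> R by rewrite ler_nat.
  case: ltP => /= aa0.
    rewrite mulr1 -[leLHS]addr0; apply: lerD => //.
    apply: (le_trans (gap_cnt_le2 a a1 d2)); rewrite /C2.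
    have h1 : a%:R * (Lambda * N) <= a0 * (Lambda * N) by rewrite ler_wpM2r// ltW.
    have h2 : 4 * delta / (a%:R ^+ 2 * lambda) <= a0.
      rewrite ler_pdivrMr; last by rewrite mulr_gt0// exprn_gt0//; lra.
      have e : a0 * (a%:R ^+ 2 * lambda) = 8 * delta * a%:R ^+ 2.
        by rewrite /a0; field; rewrite gt_eqF.
      have : 1 <= a%:R ^+ 2 :> R by rewrite exprn_ege1.
      rewrite e => e1; have : 8 * delta * 1 <= 8 * delta * a%:R ^+ 2 by rewrite ler_wpM2l ?mulr_ge0.
      have := delta0; lra.
    apply: ler_pM.
    - by rewrite addr_ge0// -mulrA mulr_ge0.
    - by rewrite addr_ge0// divr_ge0 ?mulr_ge0// ?exprn_ge0// ltW.
    - by rewrite lerD2r -!(mulrA _ Lambda).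
    - by rewrite lerD2l.
  rewrite mulr0 add0r.
  have da : 8 * delta <= a%:R * lambda.
    by move: aa0; rewrite /a0 ler_pdivrMr.
  apply: (le_trans (gap_cnt_le3 a (L ^ 2) a1 da)).
  rewrite /C3 lerD2r lerD2l ler_wpM2r ?exprn_ge0// ler_wpM2l// ltW//.
have h1 : \sum_(1 <= q < L.+1) (cnt (gap P B q) A B)%:R <= C2 * a0 + L%:R * C3.
  apply: (@le_trans _ _ (\sum_(1 <= q < L.+1) (C2 * (q%:R < a0)%R%:R + C3))).
    by rewrite big_nat [leRHS]big_nat; apply: ler_sum => a; rewrite ltnS; exact: gapa.
  rewrite big_split /= -mulr_sumr; apply: lerD; last exact: sum_const_le.
  rewrite ler_wpM2l// -natr_sum -/(cnt (fun q => q%:R < a0) _ _).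
  (* With [rho = 0] this says that at most [a0] positive integers lie below [a0]. *)
  have := @sep_cnt_int_le R (fun q => q%:R < a0) 1 L.+1 1 (fun q => q%:R) 1 0 a0.
  rewrite mulr0 mul0r addr0 mulr1; apply => //.
  - by move=> m m' _ mm' _ _ _; rewrite addn1.
  - by move=> m m' _ mm' _ _ _; rewrite mul1r ler_norm.
  - by move=> m /andP[m1 _] ma; exists m; split => //; [exact: ltW|rewrite subrr normr0].
have h2 : N / L.+1%:R <= N / L%:R.
  by rewrite ler_wpM2l// lef_pV2 ?posrE ?ltr0n// ler_nat.
have h3 : L%:R * (N / (L ^ 2).+1%:R) <= N / L%:R.
  rewrite mulrCA ler_wpM2l// ler_pdivrMr ?ltr0n// mulrC ler_pdivlMr//.
  by rewrite -natr1 natrX expr2; lra.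
rewrite /C2 /C3 in h1.
have e1 : L%:R * (1 + N / (L ^ 2).+1%:R + (Lambda + lambda) * L%:R * (L ^ 2)%:R ^+ 2 +
   8 * (Lambda + lambda) * (delta / lambda3) * harm R (L ^ 2)) = L%:R +
   L%:R * (N / (L ^ 2).+1%:R) + (Lambda + lambda) * L%:R ^+ 6 +
   8 * L%:R * (Lambda + lambda) * (delta / lambda3) * harm R (L ^ 2).
  by rewrite natrX; ring.
rewrite e1 in h1; apply: (le_trans (lerD (lerD (lexx 1) h2) h1)).
move: h3; move: (N / L%:R) (L%:R * (N / _)) (harm R _) (delta / lambda3) => u v w x h3.
lra.
Qed.

End lattice_points.

(** * Real powers and the curve (x + k)^alpha - x^alpha = D *)

Section is_derive_real.
Variable R : realType.
Implicit Types (f g : R -> R) (x df dg a c : R).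

Lemma is_derive_cst1 c x : is_derive x (1:R) (fun=> c) (0:R).
Proof. exact: is_derive_cst. Qed.

Lemma is_derive_idR x : is_derive x (1:R) (fun z : R => z) (1:R).
Proof. exact: is_derive_id. Qed.

Lemma is_derive_addR f g x df dg : is_derive x (1:R) f df ->
  is_derive x (1:R) g dg -> is_derive x (1:R) (fun z => f z + g z) (df + dg).
Proof. by move=> hf hg; exact: is_deriveD. Qed.

Lemma is_derive_subR f g x df dg : is_derive x (1:R) f df ->
  is_derive x (1:R) g dg -> is_derive x (1:R) (fun z => f z - g z) (df - dg).
Proof. by move=> hf hg; exact: is_deriveB. Qed.

Lemma is_derive_mulR f g x df dg : is_derive x (1:R) f df ->
  is_derive x (1:R) g dg ->
  is_derive x (1:R) (fun z => f z * g z) (df * g x + f x * dg).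
Proof.
move=> hf hg; apply: (is_derive_eq (@is_deriveM _ _ f g x 1 df dg hf hg)).
by rewrite /= /GRing.scale /= addrC (mulrC (g x)).
Qed.

Lemma is_derive_invR f x df : f x != 0 -> is_derive x (1:R) f df ->
  is_derive x (1:R) (fun z => (f z)^-1) (- df / f x ^+ 2).
Proof.
move=> f0 hf; apply: (is_derive_eq (@is_deriveV _ f x df 1 f0 hf)).
by rewrite /GRing.scale /= !mulNr; congr (- _); rewrite mulrC.
Qed.

Lemma is_derive_powR f x df a : 0 < f x -> is_derive x (1:R) f df ->
  is_derive x (1:R) (fun z => f z `^ a) (a * f x `^ (a - 1) * df).
Proof.
move=> f0 hf.
exact: (@is_derive1_comp _ (fun z => z `^ a) f x _ _ (is_derive1_powR a f0) hf).
Qed.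

Lemma MVT_le (f df : R -> R) (a b : R) : a < b ->
  (forall x, a <= x <= b -> is_derive x (1:R) f (df x)) ->
  exists2 c, a < c < b & f b - f a = df c * (b - a).
Proof.
move=> ab fdf; have [||c cab ->] := @MVT R f df a b ab.
- by move=> x; rewrite in_itv /= => /andP[ax xb]; apply: fdf; rewrite !ltW.
- apply: derivable_within_continuous => x; rewrite in_itv /= => axb.
  by have [] := fdf x axb.
by exists c => //; move: cab; rewrite in_itv.
Qed.

End is_derive_real.

Section powR_facts.
Variable R : realType.
Implicit Types a x y s E k : R.

Lemma ler_powRN s x y : s <= 0 -> 0 < x -> x <= y -> y `^ s <= x `^ s.
Proof.
move=> s0 x0 xy; have y0 := lt_le_trans x0 xy.
rewrite -[s]opprK !(powRN _ (- s)) lef_pV2 ?posrE ?powR_gt0//.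
by apply: ge0_ler_powR; rewrite ?nnegrE ?oppr_ge0// ltW.
Qed.

Lemma ler_powRl s x y : 0 <= s -> 0 <= x -> x <= y -> x `^ s <= y `^ s.
Proof.
by move=> s0 x0 xy; apply: ge0_ler_powR; rewrite ?nnegrE// (le_trans x0 xy).
Qed.

Lemma powR_mvt a x y : 0 < x -> x < y ->
  exists2 c, x < c < y & y `^ a - x `^ a = a * c `^ (a - 1) * (y - x).
Proof.
move=> x0 xy.
apply: (MVT_le _ (fun z => z `^ a) (fun z => a * z `^ (a - 1)) _ _ xy) => z /andP[xz _].
exact/is_derive1_powR/(lt_le_trans x0).
Qed.

Lemma powR_split a x : 0 < a -> 0 <= x -> x `^ a = x * x `^ (a - 1).
Proof. by move=> a0 x0; rewrite mulr_powRB1. Qed.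

(** Both powers are written as z z^(a - 1), and x^(a - 1) is raised to y^(a - 1). Unlike the mean
    value theorem this puts the larger endpoint into a lower bound and allows x = 0, at the cost of
    the factor a. *)
Lemma powR_diff_ge a x y : 1 <= a -> 0 <= x -> x <= y ->
  (y - x) * y `^ (a - 1) <= y `^ a - x `^ a.
Proof.
move=> a1 x0 xy; have a0 : 0 < a by lra.
have y0 := le_trans x0 xy.
rewrite !(powR_split a)// mulrBl lerD2l lerN2 ler_wpM2l//.
by apply: ler_powRl => //; lra.
Qed.

Lemma powR_diff_le a x y : 1 <= a -> 0 < x -> x <= y ->
  y `^ a - x `^ a <= a * y `^ (a - 1) * (y - x).
Proof.
move=> a1 x0; rewrite le_eqVlt => /orP[/eqP ->|xy]; first by rewrite !subrr mulr0.
have [c /andP[xc cy] ->] := powR_mvt a x y x0 xy.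
rewrite ler_wpM2r ?subr_ge0 ?(ltW xy)// ler_wpM2l//; first lra.
by apply: ler_powRl; lra.
Qed.

Lemma powR_diff_le_concave a x y : 0 <= a <= 1 -> 0 < x -> x <= y ->
  a * y `^ (a - 1) * (y - x) <= y `^ a - x `^ a <= a * x `^ (a - 1) * (y - x).
Proof.
move=> /andP[a0 a1] x0; rewrite le_eqVlt => /orP[/eqP ->|xy].
  by rewrite !subrr !mulr0 lexx.
have [c /andP[xc cy] ->] := powR_mvt a x y x0 xy.
rewrite !ler_wpM2r ?subr_ge0 ?(ltW xy)//=.
  by rewrite ler_wpM2l//; apply: ler_powRN; lra.
by rewrite ler_wpM2l//; apply: ler_powRN; lra.
Qed.

End powR_facts.

(** * Size and growth of x |-> (x + k)^alpha - x^alpha *)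

Section curve.
Variables (R : realType) (alpha : R).
Hypothesis alpha1 : 1 < alpha.
Hypothesis alpha2 : alpha < 2.
Let p := alpha - 1.
Let beta := p^-1.

Definition Gk (k x : R) : R := (x + k) `^ alpha - x `^ alpha.

Let p0 : 0 < p. Proof. by rewrite subr_gt0. Qed.
Let p1 : p < 1. Proof. by rewrite ltrBlDr. Qed.
Let beta0 : 0 < beta. Proof. by rewrite invr_gt0. Qed.

Lemma Gk_ge k x : 0 <= x -> 0 <= k -> k * (x + k) `^ p <= Gk k x.
Proof.
move=> x0 k0; have := powR_diff_ge R alpha x (x + k) (ltW alpha1) x0.
by rewrite lerDl addrAC subrr add0r => /(_ k0).
Qed.

Lemma Gk_le k x : 0 < x -> 0 <= k -> Gk k x <= alpha * k * (x + k) `^ p.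
Proof.
move=> x0 k0; have := powR_diff_le R alpha x (x + k) (ltW alpha1) x0.
by rewrite lerDl addrAC subrr add0r mulrAC => /(_ k0).
Qed.

Lemma Gk_le_bound k x E : 0 <= x -> 0 < k -> Gk k x <= E ->
  x + k <= (E / k) `^ beta.
Proof.
move=> x0 k0 GE; have xk0 : 0 < x + k by lra.
have h : k * (x + k) `^ p <= E.
  by apply: le_trans GE; apply: Gk_ge => //; exact: ltW.
have -> : x + k = ((x + k) `^ p) `^ beta.
  by rewrite -powRrM mulfV ?gt_eqF// powRr1// ltW.
apply: ler_powRl; rewrite ?powR_ge0 ?(ltW beta0)//.
by rewrite ler_pdivlMr// mulrC.
Qed.

Lemma Gk_ge_bound k x E : 0 < x -> 0 < k -> 0 <= E -> E <= Gk k x ->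
  (E / (alpha * k)) `^ beta <= x + k.
Proof.
move=> x0 k0 E0 GE; have xk0 : 0 < x + k by lra.
have h : E <= alpha * k * (x + k) `^ p.
  by apply: (le_trans GE); apply: Gk_le => //; exact: ltW.
have -> : x + k = ((x + k) `^ p) `^ beta.
  by rewrite -powRrM mulfV ?gt_eqF// powRr1// ltW.
have ak0 : 0 < alpha * k by rewrite mulr_gt0// (lt_trans _ alpha1).
apply: ler_powRl; rewrite ?divr_ge0 ?(ltW beta0) ?(ltW ak0)//.
by rewrite ler_pdivrMr// mulrC.
Qed.

Lemma is_derive_Gk (k x : R) : 0 < k -> 0 < x ->
  is_derive x 1 (Gk k) (alpha * ((x + k) `^ p - x `^ p)).
Proof.
move=> k0 x0; have xk : 0 < x + k by lra.
rewrite /Gk.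
have d1 : is_derive x (1:R) (fun z => (z + k) `^ alpha) (alpha * (x + k) `^ p * (1 + 0)).
  by apply: is_derive_powR.
apply: (is_derive_eq (is_derive_subR _ _ _ _ _ _ d1 (is_derive1_powR alpha x0))).
by rewrite /p; ring.
Qed.

(** The derivative at c is alpha ((c + k)^p - c^p) >= alpha p k (c + k)^(p - 1). As p < 1, the bound
    c + k <= (E / k)^beta is inserted here, and beta (p - 1) = 1 - beta gives the powers of k and
    E. *)
Lemma Gk_sep k x x' E : 0 < x -> x <= x' -> 0 < k -> Gk k x' <= E ->
  alpha * p * (k `^ beta * E `^ (1 - beta)) * (x' - x) <= Gk k x' - Gk k x.
Proof.
move=> x0; rewrite le_eqVlt => /orP[/eqP -> _ _|xx' k0 GE].
  by rewrite !subrr mulr0.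
have x'0 : 0 < x' by lra.
have [|c /andP[xc cx'] ->] := MVT_le _ (Gk k) (fun z => alpha * ((z + k) `^ p - z `^ p)) x x' xx'.
  by move=> z /andP[xz _]; apply: is_derive_Gk => //; lra.
rewrite ler_wpM2r ?subr_ge0 ?(ltW xx')// -mulrA ler_wpM2l//; first by rewrite ltW// (lt_trans _ alpha1).
have c0 : 0 < c by lra.
have pp : 0 <= p <= 1 by rewrite !ltW.
have ck : c <= c + k by lra.
have /andP[h _] := powR_diff_le_concave R p c (c + k) pp c0 ck.
apply: le_trans h; rewrite (_ : c + k - c = k); last by ring.
rewrite -mulrA ler_wpM2l ?(ltW p0)//.
have E0 : 0 < E.
  apply: lt_le_trans GE; apply: (lt_le_trans _ (Gk_ge k x' (ltW x'0) (ltW k0))).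
  by rewrite mulr_gt0 ?powR_gt0//; lra.
have h1 : x' + k <= (E / k) `^ beta by apply: Gk_le_bound => //; lra.
have h2 : ((E / k) `^ beta) `^ (p - 1) <= (c + k) `^ (p - 1).
  by apply: ler_powRN; rewrite ?subr_le0 ?(ltW p1)//; lra.
have -> : k `^ beta * E `^ (1 - beta) = k * ((E / k) `^ beta) `^ (p - 1).
  rewrite -powRrM (_ : beta * (p - 1) = 1 - beta); last first.
    by rewrite mulrBr mulr1 mulVf ?gt_eqF.
  rewrite powRM ?invr_ge0 ?(ltW E0) ?(ltW k0)// mulrCA mulrC; congr (_ * _).
  rewrite -powR_inv1 ?(ltW k0)// -powRrM mulN1r opprB.
  rewrite powR_split ?(ltW k0)//.
by rewrite mulrC ler_wpM2r// ltW.
Qed.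

End curve.

(** * The abscissa as a differentiable function of k *)

Section curve_inverse.
Variables (R : realType) (alpha D : R).
Hypothesis alpha1 : 1 < alpha.
Hypothesis alpha2 : alpha < 2.
Hypothesis D0 : 0 < D.
Let p := alpha - 1.
Let beta := p^-1.
Let p0 : 0 < p. Proof. by rewrite subr_gt0. Qed.
Let p1 : p < 1. Proof. by rewrite ltrBlDr. Qed.
Let beta0 : 0 < beta. Proof. by rewrite invr_gt0. Qed.
Let alpha0 : 0 < alpha. Proof. exact: lt_trans alpha1. Qed.

(** For fixed [D] the difference k is explicit in the abscissa, whereas the abscissa is given only
    implicitly by k. It is therefore obtained as the inverse of this function. *)
Definition curveF (t : R) : R := (D + t `^ alpha) `^ alpha^-1 - t.

(* The abscissa x with (x + k)^alpha - x^alpha = D, meaningful only for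
   0 < k < D^(1/alpha); outside this range [xget] returns the default value 0. *)
Definition curveX (k : R) : R := xget 0 [set t | 0 < t /\ curveF t = k].

Lemma curveF_gt0 t : 0 < t -> 0 < curveF t.
Proof.
move=> t0; rewrite subr_gt0.
have {1}-> : t = (t `^ alpha) `^ alpha^-1.
  by rewrite -powRrM mulfV ?gt_eqF// powRr1// ltW.
apply: gt0_ltr_powR; rewrite ?invr_gt0 ?nnegrE ?powR_ge0 ?ltrDr//.
by rewrite addr_ge0 ?powR_ge0// ltW.
Qed.

Lemma curveFP k t : 0 < t -> 0 < k -> (curveF t = k) <-> (Gk R alpha k t = D).
Proof.
move=> t0 k0; rewrite /curveF /Gk; split=> [<-|].
  rewrite [t + _]addrC subrK -powRrM mulVf ?gt_eqF// powRr1 ?addrK//.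
  by rewrite addr_ge0 ?powR_ge0// ltW.
move=> <-; rewrite subrK -powRrM mulfV ?gt_eqF// powRr1; last lra.
ring.
Qed.

Lemma curveF_inj t t' : 0 < t -> 0 < t' -> curveF t = curveF t' -> t = t'.
Proof.
wlog tt' : t t' / t <= t'.
  move=> H t0 t'0 E; case: (leP t t') => [h|/ltW h]; first exact: H.
  by apply/esym/H.
move=> t0 t'0 E.
have k0 := curveF_gt0 t t0; set k := curveF t in E k0.
have G1 : Gk R alpha k t = D by apply/curveFP.
have G2 : Gk R alpha k t' = D by apply/curveFP.
have GD : Gk R alpha k t' <= D by rewrite G2.
have := Gk_sep R alpha alpha1 alpha2 k t t' D t0 tt' k0 GD.
rewrite G1 G2 subrr pmulr_rle0 ?subr_le0; first by move=> h; apply/eqP; rewrite eq_le tt' h.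
by rewrite !mulr_gt0 ?powR_gt0.
Qed.

Lemma curveXK t : 0 < t -> curveX (curveF t) = t.
Proof.
move=> t0; rewrite /curveX; case: xgetP => [y -> [y0 yt]|/(_ t)]; last by case.
exact: curveF_inj.
Qed.

(** Intermediate value theorem for [Gk] between the points at which the upper and the lower bound of
    [Gk] take the value [D]. The hypothesis on [k] says that the left one, [t0], is positive. *)
Lemma curve_exists k : 0 < k -> k < (D / (alpha * k)) `^ beta ->
  exists2 t, 0 < t & curveF t = k.
Proof.
move=> k0 kD; have ak0 : 0 < alpha * k by rewrite mulr_gt0.
pose t0 := (D / (alpha * k)) `^ beta - k; pose t1 := (D / k) `^ beta.
have t00 : 0 < t0 by rewrite subr_gt0.
have Dk : 0 < D / k by rewrite divr_gt0.
have t10 : 0 < t1 by rewrite powR_gt0.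
have bp (z : R) : 0 < z -> (z `^ beta) `^ p = z.
  by move=> z0; rewrite -powRrM mulVf ?gt_eqF// powRr1// ltW.
have t01 : t0 <= t1.
  rewrite /t0 lerBlDr (@le_trans _ _ t1) ?lerDl ?(ltW k0)//.
  apply: ler_powRl; rewrite ?(ltW beta0) ?divr_ge0 ?(ltW D0) ?(ltW ak0)//.
  rewrite ler_wpM2l ?(ltW D0)// lef_pV2 ?posrE//.
  by rewrite ler_peMl ?(ltW k0) ?(ltW alpha1).
have G0 : Gk R alpha k t0 <= D.
  apply: (le_trans (Gk_le R alpha alpha1 k t0 t00 (ltW k0))); rewrite -/p subrK bp ?divr_gt0//.
  by rewrite mulrC divfK ?gt_eqF.
have G1 : D <= Gk R alpha k t1.
  apply: (le_trans _ (Gk_ge R alpha alpha1 k t1 (ltW t10) (ltW k0))); rewrite -/p -ler_pdivrMl// mulrC -{1}(bp (D / k))//.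
  by apply: ler_powRl; rewrite ?powR_ge0 ?(ltW p0) ?lerDl ?(ltW k0).
have [|//|t] := @IVT R (Gk R alpha k) t0 t1 D t01.
- apply: derivable_within_continuous => z; rewrite in_itv /= => /andP[z0 _].
  have z00 : 0 < z by apply: lt_le_trans z0.
  by have [] := is_derive_Gk R alpha k z k0 z00.
- by rewrite ge_min le_max G0 G1 orbT.
rewrite in_itv /= => /andP[tt0 _] Gt; exists t; first exact: lt_le_trans tt0.
by apply/curveFP => //; apply: lt_le_trans tt0.
Qed.

Lemma is_derive_curveF (t : R) : 0 < t ->
  is_derive t (1:R) curveF ((t / (t + curveF t)) `^ p - 1).
Proof.
move=> t0; have ta : 0 < D + t `^ alpha by rewrite addr_gt0 ?powR_gt0.
have := is_derive_subR _ _ _ _ _ _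
  (is_derive_powR R (fun t => D + t `^ alpha) t _ alpha^-1 ta
    (is_derive_addR _ _ _ _ _ _ (is_derive_cst1 R D t) (is_derive1_powR alpha t0)))
  (is_derive_idR R t).
move=> h; apply: (is_derive_eq h).
rewrite add0r (_ : alpha^-1 * _ * _ = (t / (t + curveF t)) `^ p)//.
have N0 : 0 <= t + curveF t by rewrite addr_ge0 ?ltW ?curveF_gt0.
rewrite powRM ?invr_ge0 ?(ltW t0)// mulrACA mulVf ?gt_eqF// mul1r mulrC -/p.
congr (_ * _); rewrite -(powR_inv1 N0) /curveF [t + _]addrC subrK -!powRrM; congr (_ `^ _).
by rewrite /p; field; rewrite gt_eqF.
Qed.

(** The derivative of the inverse function: the slope of [curveF] is q^p - 1 with q = t / (t + k) <
    1, hence not zero. *)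
Lemma is_derive_curveX (k : R) : 0 < k -> k < (D / (alpha * k)) `^ beta ->
  [/\ 0 < curveX k, Gk R alpha k (curveX k) = D &
   is_derive k (1:R) curveX (((curveX k / (curveX k + k)) `^ p - 1)^-1)].
Proof.
move=> k0 kD; have [t t0 Ft] := curve_exists k k0 kD.
have Xk : curveX k = t by rewrite -Ft curveXK.
rewrite Xk; split => //; first exact/curveFP.
rewrite -Ft; apply: (@is_derive_inverse R curveF curveX _ t _ _ (is_derive_curveF t t0)).
- by near=> z; apply: curveXK; near: z; exact: lt_nbhsr.
- near=> z; apply: differentiable_continuous; apply/derivable1_diffP.
  have z0 : 0 < z by near: z; exact: lt_nbhsr.
  by have [] := is_derive_curveF z z0.
rewrite subr_eq0 lt_eqF//.
have N0 : 0 < t + curveF t by rewrite addr_gt0 ?curveF_gt0.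
have e1 : 1 `^ p = 1 :> R by rewrite powR1.
rewrite -[ltRHS]e1.
apply: gt0_ltr_powR; rewrite ?nnegrE ?divr_ge0 ?ltW//.
by rewrite ltr_pdivrMr// mul1r ltrDl curveF_gt0.
Unshelve. all: by end_near. Qed.

End curve_inverse.

Section curve_derivatives.
Variables (R : realType) (alpha D : R).
Hypothesis alpha1 : 1 < alpha.
Hypothesis alpha2 : alpha < 2.
Hypothesis D0 : 0 < D.
Let p := alpha - 1.
Let beta := p^-1.
Let p0 : 0 < p. Proof. by rewrite subr_gt0. Qed.
Let p1 : p < 1. Proof. by rewrite ltrBlDr. Qed.
Let beta0 : 0 < beta. Proof. by rewrite invr_gt0. Qed.
Let alpha0 : 0 < alpha. Proof. exact: lt_trans alpha1. Qed.

Let X := curveX R alpha D.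

Definition curveQ (k : R) : R := X k / (X k + k).
Definition curveR (k : R) : R := curveQ k `^ p.
Let q := curveQ.
Let r := curveR.

(* The first three derivatives of [curveX], obtained from X' = 1 / (r - 1) and
   r' = - p r (1 - r q) / ((1 - r) X), with q = X / (X + k) and r = q^p. *)
Definition curveX1 (k : R) : R := (r k - 1)^-1.
Definition curveX2 (k : R) : R :=
  p * r k * (1 - r k * q k) * ((1 - r k) * (1 - r k) * (1 - r k) * X k)^-1.
Definition curveX3 (k : R) : R :=
  curveX2 k * (1 - p * (1 - r k * q k) + (p + 1) * (r k * q k)
               - 3 * p * r k * (1 - r k * q k) / (1 - r k)) / (X k * (1 - r k)).

Section at_point.
Variable k : R.
Hypothesis k0 : 0 < k.
Hypothesis kD : k < (D / (alpha * k)) `^ beta.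

Let X0 : 0 < X k.
Proof. by have [] := is_derive_curveX R alpha D alpha1 alpha2 D0 k k0 kD. Qed.

Let N0 : 0 < X k + k. Proof. exact: addr_gt0. Qed.

Let dX : is_derive k (1:R) X (curveX1 k).
Proof. by have [] := is_derive_curveX R alpha D alpha1 alpha2 D0 k k0 kD. Qed.

Lemma curveQ_itv : 0 < q k < 1.
Proof. by rewrite /q /curveQ divr_gt0//= ltr_pdivrMr// mul1r ltrDl. Qed.

Lemma curveR_itv : 0 < r k < 1.
Proof.
have /andP[q0 q1] := curveQ_itv.
rewrite powR_gt0//= /r /curveR.
have e1 : 1 `^ p = 1 :> R by rewrite powR1.
by rewrite -[ltRHS]e1; apply: gt0_ltr_powR; rewrite ?nnegrE// ltW.
Qed.

Let s0 : 0 < 1 - r k.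
Proof. by have /andP[_] := curveR_itv; rewrite subr_gt0. Qed.

Let s1 : r k - 1 != 0.
Proof. by have /andP[_ h] := curveR_itv; rewrite subr_eq0 lt_eqF. Qed.

Lemma is_derive_curveQ :
  is_derive k (1:R) q (- (1 - r k * q k) * q k / ((1 - r k) * X k)).
Proof.
have N1 : X k + k != 0 by rewrite gt_eqF.
have h := is_derive_mulR _ _ _ _ _ _ dX
  (is_derive_invR R (fun z => X z + z) k _ N1
    (is_derive_addR _ _ _ _ _ _ dX (is_derive_idR R k))).
apply: (is_derive_eq h); rewrite /curveX1 /q /curveQ.
have s2 := s1; have s3 : 1 - r k != 0 by rewrite gt_eqF.
have X1 : X k != 0 by rewrite gt_eqF.
by field; rewrite X1 N1 s2 s3.
Qed.

Lemma is_derive_curveR :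
  is_derive k (1:R) r (- p * r k * (1 - r k * q k) / ((1 - r k) * X k)).
Proof.
have /andP[q0 _] := curveQ_itv.
apply: (is_derive_eq (is_derive_powR _ _ _ _ p q0 is_derive_curveQ)).
have rE : r k = q k * q k `^ (p - 1) by rewrite -powR_split// ltW.
have s3 : 1 - r k != 0 by rewrite gt_eqF.
have X1 : X k != 0 by rewrite gt_eqF.
rewrite [in X in _ = - p * X * _ / _]rE.
by field; rewrite X1 s3.
Qed.

Lemma is_derive_curveX1 : is_derive k (1:R) curveX1 (curveX2 k).
Proof.
have h := is_derive_invR R (fun z => r z - 1) k _ s1
  (is_derive_subR _ _ _ _ _ _ is_derive_curveR (is_derive_cst1 R 1 k)).
apply: (is_derive_eq h); rewrite /curveX2.
have s2 := s1; have s3 : 1 - r k != 0 by rewrite gt_eqF.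
have X1 : X k != 0 by rewrite gt_eqF.
by field; rewrite X1 s2 s3.
Qed.

Lemma is_derive_curveX2 : is_derive k (1:R) curveX2 (curveX3 k).
Proof.
have s3 : 1 - r k != 0 by rewrite gt_eqF.
have X1 : X k != 0 by rewrite gt_eqF.
have dr := is_derive_curveR; have dq := is_derive_curveQ.
have ds := is_derive_subR _ _ _ _ _ _ (is_derive_cst1 R 1 k) dr.
have dw := is_derive_subR _ _ _ _ _ _ (is_derive_cst1 R 1 k)
  (is_derive_mulR _ _ _ _ _ _ dr dq).
have dpr := is_derive_mulR _ _ _ _ _ _ (is_derive_cst1 R p k) dr.
have dss := is_derive_mulR _ _ _ _ _ _ ds ds.
have dsss := is_derive_mulR _ _ _ _ _ _ dss ds.
have dsX := is_derive_mulR _ _ _ _ _ _ dsss dX.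
have sX : (1 - r k) * (1 - r k) * (1 - r k) * X k != 0 by rewrite !mulf_neq0.
have h := is_derive_mulR _ _ _ _ _ _ (is_derive_mulR _ _ _ _ _ _ dpr dw)
  (is_derive_invR R _ k _ sX dsX).
apply: (is_derive_eq h); rewrite /curveX3 /curveX2 /curveX1.
have s2 := s1.
by field; rewrite X1 s2 s3.
Qed.

Let u := k / (X k + k).
Hypothesis u8 : u <= 8^-1.

Let qu : q k = 1 - u.
Proof. by rewrite /q /curveQ /u; field; rewrite gt_eqF. Qed.

Let u0 : 0 < u. Proof. exact: divr_gt0. Qed.

(** Put N = X + k. Concavity of z^p and q <= r give p u <= 1 - r <= u and u <= 1 - r q <= 2 u, so
    X'' has order u / (u^3 N) = N / k^2. In the upper constant, p^(-2) is the factor p of X''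
    against (p u)^3, and 4 comes from 1 - r q <= 2 u and N <= 2 X. *)
Lemma curveX2_bounds :
  p / 2 * (X k + k) / k ^+ 2 <= curveX2 k <= 4 / p ^+ 2 * (X k + k) / k ^+ 2.
Proof.
have uu := u0; have u8' := u8; have pp0 := p0; have pp1 := p1.
have /andP[q0 q1] := curveQ_itv; have /andP[r0 r1] := curveR_itv.
have qe := qu.
have p01 : 0 <= p <= 1 by lra.
have /andP[h1 h2] := powR_diff_le_concave R p (q k) 1 p01 q0 (ltW q1).
have e1 : 1 `^ p = 1 :> R by rewrite powR1.
have e2 : 1 `^ (p - 1) = 1 :> R by rewrite powR1.
rewrite e1 e2 -/(curveR k) -/r mulr1 in h1 h2.
have rq : q k <= r k.
  rewrite /r /curveR -/q; rewrite -[leLHS](powRr1 (ltW q0)).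
  by apply: ger_powR; lra.
have sl : p * u <= 1 - r k by rewrite qe in h1; lra.
have su : 1 - r k <= u by lra.
have ru : r k * q k <= q k by rewrite ler_piMl// ltW.
have wl : u <= 1 - r k * q k by lra.
have wu : 1 - r k * q k <= 2 * u.
  have : q k * q k <= r k * q k by rewrite ler_wpM2r// ltW.
  rewrite qe => h; have : 0 <= u * u by rewrite mulr_ge0// ltW.
  lra.
have N0' := N0; have X0' := X0; have k0' := k0.
have ku : k = u * (X k + k) by rewrite /u divfK// gt_eqF.
have XN : X k = (1 - u) * (X k + k) by rewrite mulrBl mul1r -ku; ring.
set N := X k + k in N0' ku XN *.
have s3 : 0 < (1 - r k) * (1 - r k) * (1 - r k) * X k.
  by rewrite !mulr_gt0.
have uN : 0 < u ^+ 2 * N by rewrite mulr_gt0// exprn_gt0.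
have ss0 : 0 <= 1 - r k by lra.
have uu0 := ltW uu; have pu0 : 0 <= p * u by rewrite mulr_ge0// ltW.
have cu : (1 - r k) * (1 - r k) * (1 - r k) <= u * u * u.
  by rewrite !ler_pM ?mulr_ge0.
have cl : (p * u) * (p * u) * (p * u) <= (1 - r k) * (1 - r k) * (1 - r k).
  by apply: ler_pM => //; [exact: mulr_ge0|exact: ler_pM].
have -> : p / 2 * N / k ^+ 2 = p / 2 / (u ^+ 2 * N).
  by rewrite {1}ku; field; rewrite !gt_eqF.
have -> : 4 / p ^+ 2 * N / k ^+ 2 = 4 / p ^+ 2 / (u ^+ 2 * N).
  by rewrite {1}ku; field; rewrite !gt_eqF.
have uuu : 0 < u * u * u by exact: (mulr_gt0 (mulr_gt0 uu uu) uu).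
apply/andP; split; rewrite /curveX2.
  rewrite ler_pdivlMr// mulrAC ler_pdivrMr//.
  have a1 : p * 2^-1 * u <= p * r k * (1 - r k * q k).
    have r12 : 2^-1 <= r k by lra.
    have pr : p * 2^-1 <= p * r k by exact: (ler_wpM2l (ltW pp0) r12).
    by apply: ler_pM => //; apply: mulr_ge0; [exact: ltW|rewrite invr_ge0].
  apply: (@le_trans _ _ (p / 2 * (u * (u ^+ 2 * N)))); last first.
    by rewrite mulrA ler_wpM2r// ltW.
  rewrite ler_wpM2l ?divr_ge0 ?(ltW pp0)//.
  rewrite (_ : u * (u ^+ 2 * N) = (u * u * u) * N); last by ring.
  apply: ler_pM => //; first exact: (mulr_ge0 (mulr_ge0 ss0 ss0) ss0).
    exact: ltW.
  by rewrite /N lerDl ltW.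
rewrite ler_pdivrMr// [leRHS]mulrAC ler_pdivlMr//.
have a1 : p * r k * (1 - r k * q k) <= p * (2 * u).
  apply: ler_pM => //.
  - by apply: mulr_ge0; exact: ltW.
  - exact: le_trans uu0 wl.
  - by rewrite ger_pMr// ltW.
apply: (@le_trans _ _ (p * (2 * u) * (u ^+ 2 * N))); first by rewrite ler_wpM2r// ltW.
have XN2 : N <= 2 * X k.
  have : u * N <= 8^-1 * N by rewrite ler_wpM2r// ltW.
  by rewrite -ku /N; lra.
have b : (p * u) * (p * u) * (p * u) * N <=
   ((1 - r k) * (1 - r k) * (1 - r k)) * (2 * X k).
  apply: ler_pM => //; last exact: ltW.
  exact: (mulr_ge0 (mulr_ge0 pu0 pu0) pu0).
have -> : p * (2 * u) * (u ^+ 2 * N) = 2 / p ^+ 2 * ((p * u) * (p * u) * (p * u) * N).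
  by field; rewrite gt_eqF.
have -> : 4 / p ^+ 2 * ((1 - r k) * (1 - r k) * (1 - r k) * X k) =
  2 / p ^+ 2 * (((1 - r k) * (1 - r k) * (1 - r k)) * (2 * X k)).
  by field; rewrite gt_eqF.
by rewrite ler_wpM2l// divr_ge0// exprn_ge0// ltW.
Qed.

(** In X''' = X'' Z / (X (1 - r)) the denominator is at most u (X + k) = k, so it is enough that the
    bracket Z is at most -1/2. *)
Lemma curveX3_le : curveX3 k <= - (curveX2 k / (2 * k)).
Proof.
have uu := u0; have u8' := u8; have pp0 := p0; have pp1 := p1.
have /andP[q0 q1] := curveQ_itv; have /andP[r0 r1] := curveR_itv.
have qe := qu.
have X20 : 0 < curveX2 k.
  have /andP[h _] := curveX2_bounds; apply: lt_le_trans h.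
  by rewrite !mulr_gt0 ?invr_gt0 ?exprn_gt0.
have al1 : 1 <= alpha := ltW alpha1.
have := powR_diff_le R alpha (q k) 1 al1 q0 (ltW q1).
have e1 : 1 `^ alpha = 1 :> R by rewrite powR1.
have e2 : 1 `^ (alpha - 1) = 1 :> R by rewrite powR1.
rewrite e1 e2 mulr1 => h1.
have rq : q k `^ alpha = r k * q k.
  by rewrite (powR_split _ alpha)// ?ltW// mulrC.
rewrite rq in h1.
have ap : alpha = p + 1 by rewrite /p subrK.
have a2 := alpha2.
(* This is where u <= 1/8 is used: r q = q^alpha >= 1 - alpha u, and alpha < 2. *)
have rq34 : 3 / 4 <= r k * q k.
  have : alpha * (1 - q k) <= 2 * u by rewrite ler_pM//; lra.
  lra.
(* Bernoulli: with it the bracket in [curveX3] is at most 1 - 2 (p + 1) r q. *)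
have bern : (p + 1) * q k * (1 - r k) <= p * (1 - r k * q k).
  by rewrite ap in h1; lra.
have ss := s0.
have t1 : (p + 1) * q k <= p * (1 - r k * q k) / (1 - r k) by rewrite ler_pdivlMr.
have t2 : r k * ((p + 1) * q k) <= r k * (p * (1 - r k * q k) / (1 - r k)).
  by rewrite ler_wpM2l// ltW.
have pw : 0 <= p * (1 - r k * q k).
  rewrite mulr_ge0//; first lra.
  have : r k * q k <= q k by rewrite ler_piMl// ltW.
  lra.
have t3 : 3 / 2 <= 2 * ((p + 1) * (r k * q k)).
  have : 0 <= p * (r k * q k) by apply: mulr_ge0; [|apply: mulr_ge0]; exact: ltW.
  lra.
rewrite /curveX3; set Z := (Z in curveX2 k * Z / _).
have Z2 : Z <= - (1 / 2).
  have e : 3 * p * r k * (1 - r k * q k) / (1 - r k) =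
    3 * (r k * (p * (1 - r k * q k) / (1 - r k))) by ring.
  by rewrite /Z e; lra.
have Xs0 : 0 < X k * (1 - r k) by rewrite mulr_gt0.
have Xs : X k * (1 - r k) <= k.
  have p01 : 0 <= p <= 1 by lra.
  have rq' : q k <= r k.
    rewrite /r /curveR -/q; rewrite -[leLHS](powRr1 (ltW q0)).
    by apply: ger_powR; lra.
  have N0' := N0; have k0' := k0; have X0' := X0.
  have ku : k = u * (X k + k) by rewrite /u divfK// gt_eqF.
  have su : 1 - r k <= u by lra.
  have XN : X k <= X k + k by rewrite lerDl ltW.
  by rewrite [leRHS]ku mulrC; apply: ler_pM => //; exact: ltW.
have k0' := k0.
rewrite -mulrA -mulrN ler_wpM2l ?(ltW X20)//.
rewrite ler_pdivrMr//; apply: (le_trans Z2).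
rewrite mulNr lerN2 mulrC ler_pdivrMr ?mulr_gt0//.
lra.
Qed.

End at_point.
End curve_derivatives.

(** * Finite differences as derivatives at intermediate points *)

Section finite_differences.
Variables (R : realType) (f f1 f2 : R -> R) (lo hi : R).
Hypothesis df : forall x : R, lo <= x <= hi -> is_derive x (1:R) f (f1 x).
Hypothesis df1 : forall x : R, lo <= x <= hi -> is_derive x (1:R) f1 (f2 x).

Lemma is_derive_shift (g : R -> R) (x c dg : R) :
  is_derive (x + c) (1:R) g dg -> is_derive x (1:R) (fun z => g (z + c)) dg.
Proof.
move=> h; have h2 : is_derive x (1:R) (fun z : R => z + c) (1 + 0).
  exact: is_derive_addR.
by apply: (is_derive_eq (@is_derive1_comp _ g (fun z => z + c) x _ _ h h2)); ring.
Qed.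

Lemma diff2_mvt (a q x : R) : 0 < a -> 0 < q -> lo <= x -> x + a + q <= hi ->
  exists2 c, lo < c < hi &
    f (x + a + q) - f (x + a) - (f (x + q) - f x) = f2 c * (a * q).
Proof.
move=> a0 q0 lx xh.
pose g z := f (z + a) - f z.
have xq : x < x + q by lra.
have [|c /andP[xc cq] e] := MVT_le R g (fun z => f1 (z + a) - f1 z) x (x + q) xq.
  move=> z /andP[xz zq]; apply: is_derive_subR; last by apply: df; lra.
  by apply: is_derive_shift; apply: df; lra.
have ca : c < c + a by lra.
have [|b /andP[cb ba] e2] := MVT_le R f1 f2 c (c + a) ca.
  by move=> z /andP[cz za]; apply: df1; lra.
exists b; first lra.
rewrite (_ : x + a + q = x + q + a); last by ring.
rewrite (_ : _ - _ = g (x + q) - g x); last by rewrite /g; ring.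
by rewrite e e2; ring.
Qed.

End finite_differences.

Section diff2_nat.
Variables (R : realType) (f f1 f2 f3 : R -> R) (lo hi : nat).
Hypothesis df : forall x : R, lo%:R <= x <= hi%:R -> is_derive x (1:R) f (f1 x).
Hypothesis df1 : forall x : R, lo%:R <= x <= hi%:R -> is_derive x (1:R) f1 (f2 x).

Lemma diff2_nat_mvt (a q m : nat) : (0 < a)%N -> (0 < q)%N -> (lo <= m)%N ->
  (m + a + q <= hi)%N ->
  exists2 c : R, lo%:R < c < hi%:R &
    diff2 R (fun m => f m%:R) a q m = f2 c * (a%:R * q%:R).
Proof.
move=> a0 q0 lm mh; rewrite /diff2 !natrD.
apply: (diff2_mvt R f f1 f2 _ _ df df1); rewrite ?ltr0n ?ler_nat//.
by rewrite -!natrD ler_nat.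
Qed.

Hypothesis df2 : forall x : R, lo%:R <= x <= hi%:R -> is_derive x (1:R) f2 (f3 x).

(** The mean value theorem for the second difference as a function of its base point, followed by
    [diff2_mvt] for [f1]. *)
Lemma diff3_nat_mvt (a q r m : nat) : (0 < a)%N -> (0 < q)%N -> (0 < r)%N ->
  (lo <= m)%N -> (m + a + q + r <= hi)%N ->
  exists2 c : R, lo%:R < c < hi%:R &
    diff2 R (fun m => f m%:R) a q (m + r) - diff2 R (fun m => f m%:R) a q m
      = f3 c * (a%:R * q%:R * r%:R).
Proof.
move=> a0 q0 r0 lm; rewrite -(ler_nat R) !natrD => mh.
have lm' : lo%:R <= m%:R :> R by rewrite ler_nat.
have a0' : 0 < a%:R :> R by rewrite ltr0n.
have q0' : 0 < q%:R :> R by rewrite ltr0n.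
have r0' : 0 < r%:R :> R by rewrite ltr0n.
pose h (z : R) := f (z + a%:R + q%:R) - f (z + a%:R) - (f (z + q%:R) - f z).
pose h1 (z : R) := f1 (z + a%:R + q%:R) - f1 (z + a%:R) - (f1 (z + q%:R) - f1 z).
have mr : m%:R < m%:R + r%:R :> R by lra.
have [|c /andP[mc cr] e] := MVT_le R h h1 _ _ mr.
  move=> z /andP[mz zr]; apply: is_derive_subR; apply: is_derive_subR.
  - apply: (is_derive_shift R (fun z => f (z + q%:R))).
    by apply: is_derive_shift; apply: df; lra.
  - by apply: is_derive_shift; apply: df; lra.
  - by apply: is_derive_shift; apply: df; lra.
  - by apply: df; lra.
have lc : lo%:R <= c by lra.
have ch : c + a%:R + q%:R <= hi%:R by lra.
have [b bb e2] := diff2_mvt R f1 f2 f3 _ _ df1 df2 _ _ c a0' q0' lc ch.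
exists b => //.
rewrite (_ : diff2 _ _ _ _ (m + r) - _ = h (m%:R + r%:R) - h m%:R); last first.
  by rewrite /diff2 /h !natrD.
by rewrite e /h1 e2; ring.
Qed.

End diff2_nat.

(** * A dyadic block of k: the third derivative bound *)

Section block3.
Variables (R : realType) (alpha D : R) (K : nat) (P : nat -> bool) (y : nat -> nat).
Hypothesis alpha1 : 1 < alpha.
Hypothesis alpha2 : alpha < 2.
Hypothesis D0 : 0 < D.
Hypothesis K0 : (0 < K)%N.
Let p := alpha - 1.
Let beta := p^-1.
Let p0 : 0 < p. Proof. by rewrite subr_gt0. Qed.
Let beta0 : 0 < beta. Proof. by rewrite invr_gt0. Qed.
Let alpha0 : 0 < alpha. Proof. exact: lt_trans alpha1. Qed.
Let K0R : 0 < K%:R :> R. Proof. by rewrite ltr0n. Qed.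
Hypothesis KD : 16 * K%:R <= (D / (alpha * (2 * K%:R))) `^ beta.
Hypothesis Py : forall k, (K <= k < K + K)%N -> P k ->
  (0 < y k)%N /\ `|Gk R alpha k%:R (y k)%:R - D| <= 1.

Variable delta : R.
Hypothesis deltaE : (alpha * p * (K%:R `^ beta * (D + 1) `^ (1 - beta)))^-1 <= delta.
Let W := (D / K%:R) `^ beta / K%:R ^+ 2.
Let lambda := p / 8 * (2 * alpha) `^ (- beta) * W.
Let Lambda := 4 / p ^+ 2 * W.

Let range (k : R) : K%:R <= k <= (K + K)%:R -> 
  [/\ 0 < k, k < (D / (alpha * k)) `^ beta,
   k / (curveX R alpha D k + k) <= 8^-1,
   (D / (alpha * (2 * K%:R))) `^ beta <= curveX R alpha D k + k &
   curveX R alpha D k + k <= (D / K%:R) `^ beta].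
Proof.
move=> /andP[Kk k2]; have K0' := K0R; have KD' := KD.
rewrite natrD in k2.
have k0 : 0 < k by lra.
have ak0 : 0 < alpha * k by rewrite mulr_gt0.
have kk : (D / (alpha * (2 * K%:R))) `^ beta <= (D / (alpha * k)) `^ beta.
  apply: ler_powRl; rewrite ?(ltW beta0) ?divr_ge0 ?mulr_ge0 ?(ltW D0) ?(ltW alpha0)//.
  rewrite ler_wpM2l ?(ltW D0)// lef_pV2 ?posrE ?mulr_gt0//.
  by rewrite ler_wpM2l ?(ltW alpha0)//; lra.
have kD : k < (D / (alpha * k)) `^ beta by lra.
have [X0 GX _] := is_derive_curveX R alpha D alpha1 alpha2 D0 k k0 kD.
have lb : (D / (alpha * k)) `^ beta <= curveX R alpha D k + k.
  by apply: Gk_ge_bound; rewrite ?GX// ltW.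
have ub : curveX R alpha D k + k <= (D / k) `^ beta.
  by apply: Gk_le_bound; rewrite ?GX// ltW.
(* On the block k <= 2 K, while X + k >= 16 K by [KD]; hence the ratio 1/8. *)
split => //; first by rewrite ler_pdivrMr; lra.
- exact: le_trans lb.
apply: (le_trans ub); apply: ler_powRl; rewrite ?(ltW beta0) ?divr_ge0 ?(ltW D0) ?(ltW k0)//.
by rewrite ler_wpM2l ?(ltW D0)// lef_pV2 ?posrE.
Qed.

(** [curve_cnt_le3] for [curveX]. As k <= 2 K, the factor 1/8 of [lambda] is 1/2 from
    [curveX2_bounds] times K^2 / k^2 >= 1/4, and |X'''| >= X'' / (2 k) supplies
    [lambda / (4 * K)]. *)
Lemma block3_cnt_le L : (0 < L)%N -> delta <= 2^-1 ->
  (cnt P K (K + K))%:R <= 1 + 2 * (K%:R / L%:R) + L%:R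
    + (8 * delta / lambda) * ((8 * delta / lambda) * Lambda * K%:R + 4) * (1 + 8 * delta / lambda)
    + (Lambda + lambda) * L%:R ^+ 6
    + 8 * L%:R * (Lambda + lambda) * (delta / (lambda / (4 * K%:R))) * harm R (L ^ 2).
Proof.
move=> L0 d2.
have K0' := K0R; have p0' := p0; have alpha0' := alpha0; have D0' := D0.
have W0 : 0 < W by rewrite divr_gt0 ?powR_gt0 ?divr_gt0 ?exprn_gt0.
have DK0 : 0 < D / K%:R by rewrite divr_gt0.
have l0 : 0 < lambda.
  by apply: mulr_gt0 => //; apply: mulr_gt0; [rewrite divr_gt0|rewrite powR_gt0// mulr_gt0].
have dl0 : 0 <= delta.
  apply: le_trans deltaE.
  by rewrite invr_ge0; do ![apply: mulr_ge0]; rewrite ?powR_ge0// ltW.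
have DaK : (D / (alpha * (2 * K%:R))) `^ beta = (2 * alpha) `^ (- beta) * (D / K%:R) `^ beta.
  have a20 : 0 <= 2 * alpha by rewrite mulr_ge0// ltW.
  have -> : D / (alpha * (2 * K%:R)) = (2 * alpha)^-1 * (D / K%:R).
    by field; rewrite !gt_eqF.
  rewrite (@powRM _ (2 * alpha)^-1 (D / K%:R)) ?invr_ge0 ?(ltW DK0)//.
  by rewrite -(powR_inv1 a20) -powRrM mulN1r.
have f2b (k : R) : K%:R <= k <= (K + K)%:R -> lambda <= curveX2 R alpha D k <= Lambda.
  move=> kK; have [k0 kD u8 Nl Nu] := range k kK.
  have /andP[b1 b2] := curveX2_bounds R alpha D alpha1 alpha2 D0 k k0 kD u8.
  move/andP: kK => [Kk k2]; rewrite natrD in k2.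
  have k2K : k ^+ 2 <= 4 * K%:R ^+ 2.
    have -> : 4 * K%:R ^+ 2 = (2 * K%:R) ^+ 2 :> R by ring.
    by rewrite ler_sqr ?nnegrE; lra.
  have kK2 : K%:R ^+ 2 <= k ^+ 2 by rewrite ler_sqr ?nnegrE; lra.
  have kk0 : 0 < k ^+ 2 by rewrite exprn_gt0.
  have KK0 : 0 < K%:R ^+ 2 :> R by rewrite exprn_gt0.
  apply/andP; split.
    apply: le_trans b1; rewrite DaK in Nl.
    have -> : lambda = p / 2 * ((2 * alpha) `^ (- beta) * (D / K%:R) `^ beta / (4 * K%:R ^+ 2)).
      by rewrite /lambda /W; field; rewrite gt_eqF.
    rewrite -[leRHS]mulrA ler_wpM2l//; first lra.
    apply: ler_pM => //; first by rewrite mulr_ge0 ?powR_ge0.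
    by rewrite lef_pV2 ?posrE ?mulr_gt0.
  apply: (le_trans b2); rewrite /Lambda /W -mulrA ler_wpM2l//.
    by rewrite divr_ge0// exprn_ge0// ltW.
  apply: ler_pM => //.
  - by apply: le_trans Nl; rewrite powR_ge0.
  - by rewrite invr_ge0 ltW.
  - by rewrite lef_pV2 ?posrE.
have lL : lambda <= Lambda.
  have /andP[h1 h2] : lambda <= curveX2 R alpha D K%:R <= Lambda.
    by apply: f2b; rewrite lexx/= natrD; lra.
  exact: le_trans h1 h2.
have d0 (k : R) : K%:R <= k <= (K + K)%:R ->
    is_derive k (1:R) (curveX R alpha D) (curveX1 R alpha D k).
  move=> /range[k0 kD _ _ _].
  by have [] := is_derive_curveX R alpha D alpha1 alpha2 D0 k k0 kD.
have d1 (k : R) : K%:R <= k <= (K + K)%:R ->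
    is_derive k (1:R) (curveX1 R alpha D) (curveX2 R alpha D k).
  by move=> /range[k0 kD _ _ _]; exact: is_derive_curveX1.
have d2' (k : R) : K%:R <= k <= (K + K)%:R ->
    is_derive k (1:R) (curveX2 R alpha D) (curveX3 R alpha D k).
  by move=> /range[k0 kD _ _ _]; exact: is_derive_curveX2.
have KB : (K + K)%:R - K%:R = K%:R :> R by rewrite natrD addrK.
rewrite -[X in X / L%:R]KB -[X in _ * Lambda * X]KB.
apply: (@curve_cnt_le3 R P (fun k => (y k)%:Z) (fun k => curveX R alpha D k%:R)) => //.
- exact: leq_addr.
- move=> k kK Pk; have [yk0 yk] := Py k kK Pk.
  have kKR : K%:R <= (k%:R : R) <= (K + K)%:R.
    by move: kK => /andP[h1 h2]; rewrite !ler_nat h1 ltnW.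
  have [k0 kD _ _ _] := range k%:R kKR.
  have [X0 GX _] := is_derive_curveX R alpha D alpha1 alpha2 D0 _ k0 kD.
  set X := curveX R alpha D k%:R in X0 GX *; rewrite -pmulrn.
  have y0 : 0 < (y k)%:R :> R by rewrite ltr0n.
  move: yk; rewrite ler_norml => /andP[yk1 yk2].
  have dk0 : 0 < alpha * p * (K%:R `^ beta * (D + 1) `^ (1 - beta)).
    by do ![apply: mulr_gt0]; rewrite ?powR_gt0//; lra.
  have ck : alpha * p * (K%:R `^ beta * (D + 1) `^ (1 - beta)) <=
     alpha * p * (k%:R `^ beta * (D + 1) `^ (1 - beta)).
    rewrite ler_wpM2l//; first by apply: mulr_ge0; exact: ltW.
    rewrite ler_wpM2r ?powR_ge0//; apply: ler_powRl; rewrite ?(ltW beta0)//.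
    by move/andP: kKR => [].
  apply: (le_trans _ deltaE); rewrite -[leRHS]div1r ler_pdivlMr//.
  set c := _ * _ in dk0 ck *.
  set c' := _ * _ in ck.
  (* [Gk_sep] with [E = D + 1] converts the error 1 in [Gk] into an error in the abscissa, on either
     side of [X]. *)
  case: (leP X (y k)%:R) => h.
    rewrite ger0_norm ?subr_ge0//.
    have GE : Gk R alpha k%:R (y k)%:R <= D + 1 by lra.
    have := Gk_sep R alpha alpha1 alpha2 _ _ _ (D + 1) X0 h k0 GE.
    rewrite -/p -/beta -/c' GX => h2.
    have h3 : ((y k)%:R - X) * c <= ((y k)%:R - X) * c' by rewrite ler_wpM2l// subr_ge0.
    apply: (le_trans h3); rewrite mulrC; lra.
  rewrite distrC ger0_norm ?subr_ge0 ?(ltW h)//.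
  have GE : Gk R alpha k%:R X <= D + 1 by rewrite GX; lra.
  have := Gk_sep R alpha alpha1 alpha2 _ _ _ (D + 1) y0 (ltW h) k0 GE.
  rewrite -/p -/beta -/c' GX => h2.
  have h3 : (X - (y k)%:R) * c <= (X - (y k)%:R) * c'.
    by rewrite ler_wpM2l// subr_ge0 ltW.
  apply: (le_trans h3); rewrite mulrC; lra.
- move=> a q m a0 q0 Km mB.
  have [c /andP[c1 c2] ->] := diff2_nat_mvt R _ _ _ K (K + K) d0 d1 a q m a0 q0 Km (ltnW mB).
  have cc : K%:R <= c <= (K + K)%:R by rewrite !ltW.
  have /andP[h1 h2] := f2b c cc.
  by rewrite !ler_wpM2r ?mulr_ge0.
- by rewrite divr_gt0// mulr_gt0.
move=> a q r m a0 q0 r0 Km mB.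
have [c /andP[c1 c2] ->] := diff3_nat_mvt R _ _ _ _ K (K + K) d0 d1 d2' a q r m a0 q0 r0 Km (ltnW mB).
have cc : K%:R <= c <= (K + K)%:R by rewrite !ltW.
have aqr : 0 <= a%:R * q%:R * r%:R :> R by rewrite !mulr_ge0.
rewrite normrM (ger0_norm aqr) ler_wpM2r//.
have /andP[h1 h2] := f2b c cc.
have [k0 kD u8 Nl Nu] := range c cc.
have h3 := curveX3_le R alpha D alpha1 alpha2 D0 c k0 kD u8.
apply: (@le_trans _ _ (curveX2 R alpha D c / (2 * c))).
  apply: ler_pM => //; first exact: ltW.
  rewrite lef_pV2 ?posrE ?mulr_gt0//.
  by move/andP: cc => [_]; rewrite natrD; lra.
by rewrite ler_normr [X in _ || X](_ : _ = true) ?orbT// lerNr.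
Qed.

End block3.

(** * A dyadic block of m: the second derivative bound *)

Section block2.
Variables (R : realType) (alpha D : R).
Hypothesis alpha1 : 1 < alpha.
Hypothesis alpha2 : alpha < 2.
Hypothesis D0 : 0 < D.
Let p := alpha - 1.
Let p0 : 0 < p. Proof. by rewrite subr_gt0. Qed.
Let p1 : p < 1. Proof. by rewrite ltrBlDr. Qed.
Let alpha0 : 0 < alpha. Proof. exact: lt_trans alpha1. Qed.

Definition curveN (t : R) : R := (D + t `^ alpha) `^ alpha^-1.

Let Da t : 0 < D + t `^ alpha.
Proof. by rewrite ltr_pwDl// powR_ge0. Qed.

Lemma curveN_gt0 t : 0 < curveN t.
Proof. by rewrite powR_gt0. Qed.

Lemma curveN_alpha t : curveN t `^ alpha = D + t `^ alpha.
Proof. by rewrite -powRrM mulVf ?gt_eqF// powRr1// ltW. Qed.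

Lemma curveN_le t t' : 0 <= t -> t <= t' -> curveN t <= curveN t'.
Proof.
move=> t0 tt'; apply: ler_powRl; rewrite ?invr_ge0 ?(ltW alpha0) ?(ltW (Da _))//.
by rewrite lerD2l ler_powRl// ltW.
Qed.

(** Doubling scales t^alpha by 2^alpha but leaves [D] alone. Hence the second derivative varies only
    by a constant factor on a dyadic block, whether [D] or t^alpha dominates. *)
Lemma curveN_double t : 0 <= t -> curveN (t + t) <= 2 * curveN t.
Proof.
move=> t0.
have e : 2 * curveN t = ((2 : R) `^ alpha * (D + t `^ alpha)) `^ alpha^-1.
  rewrite powRM ?powR_ge0 ?(ltW (Da _))// -powRrM mulfV ?gt_eqF// powRr1//.
rewrite e; apply: ler_powRl; rewrite ?invr_ge0 ?(ltW alpha0) ?(ltW (Da _))//.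
have -> : t + t = 2 * t by ring.
rewrite powRM// mulrDr lerD2r ler_peMl ?(ltW D0)//.
by rewrite -[leLHS](powRr0 2); apply: ler_powR; [rewrite ler1n|exact: ltW].
Qed.

Lemma curveN_ge t : 0 <= t -> t <= curveN t.
Proof.
move=> t0; rewrite -[leLHS](powRr1 t0) -(mulfV (lt0r_neq0 alpha0)) powRrM.
by apply: ler_powRl; rewrite ?invr_ge0 ?(ltW alpha0) ?powR_ge0// lerDr ltW.
Qed.

Let slope t := (t / curveN t) `^ p.
(** The second derivative of N = [curveN]: N' = (t / N)^p, and t / N has the derivative D / N^(alpha
    + 1). *)
Definition curveN2 (t : R) : R := p * D * t `^ (p - 1) * curveN t `^ (- (p + alpha)).

Lemma is_derive_curveN (t : R) : 0 < t -> is_derive t (1:R) curveN (slope t).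
Proof.
move=> t0; have h := is_derive_addR _ _ _ _ _ _
  (is_derive_curveF R alpha D alpha1 D0 t t0) (is_derive_idR R t).
have NE : curveN = (fun z => curveF R alpha D z + z).
  by apply/funext => z; rewrite /curveF subrK.
rewrite {1}NE; apply: (is_derive_eq h).
by rewrite subrK /slope NE addrC.
Qed.

Lemma is_derive_slope (t : R) : 0 < t -> is_derive t (1:R) slope (curveN2 t).
Proof.
move=> t0; have N0 := curveN_gt0 t.
have N1 : curveN t != 0 by rewrite gt_eqF.
have dq := is_derive_mulR _ _ _ _ _ _ (is_derive_idR R t)
  (is_derive_invR _ _ _ _ N1 (is_derive_curveN t t0)).
have q0 : 0 < t / curveN t by rewrite divr_gt0.
apply: (is_derive_eq (is_derive_powR R (fun z => z / curveN z) t _ p q0 dq)).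
have e1 : t * slope t = t `^ alpha / curveN t `^ p.
  rewrite /slope powRM ?invr_ge0 ?(ltW t0) ?(ltW N0)// mulrA (powR_split _ alpha) ?(ltW t0)//.
  by rewrite -(powR_inv1 (ltW N0)) -powRrM mulN1r powRN.
have Na : curveN t * curveN t `^ p = curveN t `^ alpha.
  by rewrite [RHS](powR_split _ alpha) ?(ltW N0).
have Np : curveN t `^ p != 0 by rewrite gt_eqF// powR_gt0.
have -> : 1 * (curveN t)^-1 + t * (- slope t / curveN t ^+ 2) = D / (curveN t * curveN t `^ alpha).
  have -> : 1 * (curveN t)^-1 + t * (- slope t / curveN t ^+ 2) =
    (curveN t - t * slope t) / curveN t ^+ 2 by field.
  rewrite e1; have -> : D = curveN t `^ alpha - t `^ alpha by rewrite curveN_alpha addrK.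
  by rewrite -Na; field; rewrite N1 Np.
rewrite /curveN2 powRM ?invr_ge0 ?(ltW t0) ?(ltW N0)//.
have -> : (curveN t)^-1 `^ (p - 1) = curveN t / curveN t `^ p.
  rewrite -{1}(powR_inv1 (ltW N0)) -powRrM mulN1r opprB.
  rewrite powRB; last by rewrite N1 implybT.
  by rewrite powRr1// ltW.
have -> : curveN t `^ (- (p + alpha)) = (curveN t `^ p * curveN t `^ alpha)^-1.
  by rewrite powRN powRD// N1 implybT.
have Nal : curveN t `^ alpha != 0 by rewrite gt_eqF// powR_gt0.
by field; rewrite N1 Np Nal.
Qed.

Variables (M : nat) (P : nat -> bool) (y : nat -> nat).
Hypothesis M0 : (0 < M)%N.
Hypothesis Py : forall m, (M <= m < M + M)%N -> P m ->
  `|(y m)%:R `^ alpha - m%:R `^ alpha - D| <= 1.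

Variables V delta : R.
Hypothesis VE : V = p * D * M%:R `^ (p - 1) * curveN M%:R `^ (- (p + alpha)).
Hypothesis deltaE : delta = (curveN M%:R `^ p)^-1.

(** On [M, 2 M] both t and [curveN] grow by at most a factor 2 and occur with negative exponents, so
    the second derivative stays between 2^(-(1 + alpha)) V >= V / 8 and V. The width [delta] follows
    from |y - N| N^p <= |y^alpha - N^alpha| <= 1. *)
Lemma block2_cnt_le L : delta <= 2^-1 ->
  (cnt P M (M + M))%:R <= 1 + M%:R / L.+1%:R + V * M%:R * L%:R ^+ 2 + 4 * L%:R
    + (4 * V * M%:R + 16) * (delta / (V / 8)) * harm R L.
Proof.
move=> d2.
have M0R : 0 < M%:R :> R by rewrite ltr0n.
have NM0 := curveN_gt0 M%:R.
have V0 : 0 < V.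
  rewrite VE.
  by do 3?[apply: mulr_gt0 => //]; exact: powR_gt0.
have pa : 0 <= p + alpha by rewrite addr_ge0// ltW.
have f2b (t : R) : M%:R <= t <= (M + M)%:R -> V / 8 <= curveN2 t <= V.
  move=> /andP[Mt tM]; rewrite natrD in tM.
  have t0 : 0 < t by lra.
  have t2M : t <= 2 * M%:R by lra.
  have pD : 0 <= p * D by rewrite mulr_ge0// ltW.
  have p1' : p - 1 <= 0 by rewrite subr_le0 ltW.
  have pa' : - (p + alpha) <= 0 by rewrite oppr_le0.
  have Nt : curveN t <= 2 * curveN M%:R.
    apply: le_trans (curveN_double _ (ltW M0R)).
    by apply: curveN_le => //; exact: ltW.
  apply/andP; split; last first.
    rewrite /curveN2 VE; apply: ler_pM.
    - by apply: mulr_ge0 => //; exact: powR_ge0.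
    - exact: powR_ge0.
    - by apply: ler_wpM2l => //; exact: ler_powRN.
    - exact: (ler_powRN R _ _ _ pa' NM0 (curveN_le _ _ (ltW M0R) Mt)).
  have h : (2 * M%:R) `^ (p - 1) * (2 * curveN M%:R) `^ (- (p + alpha)) <=
      t `^ (p - 1) * curveN t `^ (- (p + alpha)).
    apply: ler_pM; [exact: powR_ge0|exact: powR_ge0| |].
      exact: (ler_powRN R _ _ _ p1' t0 t2M).
    exact: (ler_powRN R _ _ _ pa' (curveN_gt0 t) Nt).
  rewrite /curveN2 -[leRHS]mulrA.
  apply: (le_trans _ (ler_wpM2l pD h)).
  rewrite (@powRM _ 2 M%:R)// (@powRM _ 2 (curveN _)) ?(ltW NM0)//.
  have e : (2 : R) `^ (p - 1) * 2 `^ (- (p + alpha)) = (2 `^ (1 + alpha))^-1.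
    rewrite -powRN -powRD; last by rewrite pnatr_eq0 implybT.
    by congr (_ `^ _); ring.
  have e8 : (2 : R) `^ (1 + alpha) <= 8.
    have -> : (8 : R) = 2 `^ 3%:R by rewrite powR_mulrn//; ring.
    apply: ler_powR; first by rewrite ler1n.
    by rewrite (_ : 3%:R = 1 + 2 :> R) ?lerD2l ?(ltW alpha2)//; ring.
  have e8' : (8 : R)^-1 <= 2 `^ (p - 1) * 2 `^ (- (p + alpha)).
    by rewrite e lef_pV2 ?posrE// powR_gt0.
  have -> : p * D * (2 `^ (p - 1) * M%:R `^ (p - 1) * (2 `^ (- (p + alpha)) * curveN M%:R `^ (- (p + alpha))))
   = V * (2 `^ (p - 1) * 2 `^ (- (p + alpha))) by rewrite VE; ring.
  exact: (ler_wpM2l (ltW V0) e8').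
have d0 (t : R) : M%:R <= t <= (M + M)%:R -> is_derive t (1:R) curveN (slope t).
  by move=> /andP[Mt _]; apply: is_derive_curveN; lra.
have d1 (t : R) : M%:R <= t <= (M + M)%:R -> is_derive t (1:R) slope (curveN2 t).
  by move=> /andP[Mt _]; apply: is_derive_slope; lra.
have MB : (M + M)%:R - M%:R = M%:R :> R by rewrite natrD addrK.
have -> : 1 + M%:R / L.+1%:R + V * M%:R * L%:R ^+ 2 + 4 * L%:R
    + (4 * V * M%:R + 16) * (delta / (V / 8)) * harm R L =
  1 + ((M + M)%:R - M%:R) / L.+1%:R + V * ((M + M)%:R - M%:R) * L%:R ^+ 2 + 4 * L%:R
    + (4 * V * ((M + M)%:R - M%:R) + 16) * (delta / (V / 8)) * harm R L by rewrite MB.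
apply: (@curve_cnt_le2 R P (fun m => (y m)%:Z) (fun m => curveN m%:R)) => //.
- exact: leq_addr.
- by rewrite deltaE invr_ge0 powR_ge0.
- by rewrite divr_gt0.
- by rewrite ler_pdivrMr//; lra.
- move=> m mM Pm; have := Py m mM Pm; rewrite -pmulrn.
  have M1 : M%:R <= m%:R :> R by move: mM => /andP[h _]; rewrite ler_nat.
  have NN : curveN M%:R <= curveN m%:R by apply: curveN_le.
  have Nm0 := curveN_gt0 m%:R.
  have Nd : curveN M%:R `^ p <= curveN m%:R `^ p.
    exact: (ler_powRl R _ _ _ (ltW p0) (ltW NM0) NN).
  have Np0 : 0 < curveN M%:R `^ p by rewrite powR_gt0.
  rewrite (_ : _ - _ - D = (y m)%:R `^ alpha - curveN m%:R `^ alpha); last first.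
    by rewrite curveN_alpha; ring.
  move=> h; rewrite deltaE -[leRHS]div1r ler_pdivlMr//.
  move: h; rewrite ler_norml => /andP[h1 h2].
  case: (leP (curveN m%:R) (y m)%:R) => hy.
    rewrite ger0_norm ?subr_ge0//.
    have := powR_diff_ge R alpha _ _ (ltW alpha1) (ltW Nm0) hy; rewrite -/p => h3.
    apply: le_trans h2; apply: le_trans h3; rewrite ler_wpM2l ?subr_ge0//.
    exact: (le_trans Nd (ler_powRl R _ _ _ (ltW p0) (ltW Nm0) hy)).
  rewrite distrC ger0_norm ?subr_ge0 ?(ltW hy)//.
  have y0 : 0 <= (y m)%:R :> R by [].
  have := powR_diff_ge R alpha _ _ (ltW alpha1) y0 (ltW hy); rewrite -/p => h3.
  have s0 : 0 <= curveN m%:R - (y m)%:R by rewrite subr_ge0; exact: ltW.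
  apply: (le_trans (ler_wpM2l s0 Nd)); apply: (le_trans h3).
  by rewrite -opprB lerNl.
move=> a q m a0 q0 Mm mB.
have [c /andP[c1 c2] ->] := diff2_nat_mvt R _ _ _ M (M + M) d0 d1 a q m a0 q0 Mm (ltnW mB).
have cc : M%:R <= c <= (M + M)%:R by rewrite !ltW.
have /andP[h1 h2] := f2b c cc.
by rewrite !ler_wpM2r ?mulr_ge0.
Qed.

End block2.

(** * Exponents *)

Lemma harm_le_ln (R : realType) L : (0 < L)%N -> harm R L <= 1 + ln L%:R.
Proof.
case: L => // L _; elim: L => [|L IH].
  by rewrite /harm big_nat1 invr1 ln1 addr0.
rewrite /harm big_nat_recr//= -/(harm R L.+1); apply: (le_trans (lerD IH (lexx _))).
rewrite -addrA lerD2l.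
have L0 : 0 < L.+1%:R :> R by rewrite ltr0n.
have L1 : 0 < L.+2%:R :> R by rewrite ltr0n.
have : ln (1 + (- L.+2%:R^-1)) <= - L.+2%:R^-1 :> R.
  apply: le_ln1Dx; rewrite ltrNl opprK invf_lt1// ltr1n//.
have -> : 1 + (- L.+2%:R^-1) = L.+1%:R / L.+2%:R :> R.
  have g (x : R) : x != 0 -> 1 + (- x^-1) = (x - 1) / x by move=> x0; field.
  by rewrite g ?gt_eqF// -(@natr1 _ L.+1) addrK.
rewrite ln_div ?posrE//.
move: (ln _) (ln _) (_^-1) => a b c; lra.
Qed.

Lemma harm_le_powR (R : realType) (s : R) L : 0 < s -> (0 < L)%N ->
  harm R L <= (1 + s^-1) * L%:R `^ s.
Proof.
move=> s0 L0; apply: (le_trans (harm_le_ln R L L0)).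
have L1 : 1 <= L%:R :> R by rewrite ler1n.
have Ls1 : 1 <= L%:R `^ s by rewrite -[leLHS](powRr0 L%:R) ler_powR// ltW.
have Ls0 : 0 < L%:R `^ s by rewrite powR_gt0//; lra.
have := ln_sublinear Ls0; rewrite ln_powR => h.
have : ln L%:R <= s^-1 * L%:R `^ s by rewrite ler_pdivlMl// ltW.
lra.
Qed.

Lemma powR_eventually_ge (R : realType) (c e : R) : 0 < e ->
  exists2 D1 : R, 1 <= D1 & forall D, D1 <= D -> c <= D `^ e.
Proof.
move=> e0; exists (1 + `|c| `^ e^-1); first by rewrite lerDl powR_ge0.
move=> D D1; have c0 : 0 <= `|c| `^ e^-1 by exact: powR_ge0.
apply: (le_trans (ler_norm c)).
have -> : `|c| = (`|c| `^ e^-1) `^ e.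
  by rewrite -powRrM mulVf ?gt_eqF// powRr1.
by apply: ler_powRl => //; [exact: ltW|lra].
Qed.

Section exponents.
Variable R : realType.

(* The hypothesis on alpha is equivalent to betas < beta. *)
Definition betas : R := (1 + Num.sqrt 21) / 4.
Definition kappa1 : R := (Num.sqrt 21 - 3) / 3.

Lemma sqrt21_bounds : 32 / 7 < (Num.sqrt 21 : R) < 23 / 5.
Proof.
have s0 : 0 <= Num.sqrt 21 :> R by exact: sqrtr_ge0.
have s2 : Num.sqrt 21 ^+ 2 = 21 :> R by rewrite sqr_sqrtr.
move: (Num.sqrt 21) s0 s2 => s s0 s2.
apply/andP; split; rewrite ltNge; apply/negP => h.
  have : 0 <= (32 / 7 - s) * (32 / 7 + s) by apply: mulr_ge0; lra.
  lra.
have : 0 <= (s - 23 / 5) * (s + 23 / 5) by apply: mulr_ge0; lra.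
lra.
Qed.

Lemma betas_bounds : 39 / 28 < betas < 7 / 5.
Proof. by have /andP[h1 h2] := sqrt21_bounds; rewrite /betas; lra. Qed.

Lemma kappa1_bounds : 11 / 21 < kappa1 < 8 / 15.
Proof. by have /andP[h1 h2] := sqrt21_bounds; rewrite /kappa1; lra. Qed.

(** Equality in the condition of the second derivative bound. Combined with [kappa1E] it yields
    equality in the other one, kappa1 (4 - betas) = 6 betas - 7. *)
Lemma kappa1_betas : kappa1 * (betas - 1) = 3 - 2 * betas.
Proof.
have s2 : Num.sqrt 21 ^+ 2 = 21 :> R by rewrite sqr_sqrtr.
rewrite /kappa1 /betas.
rewrite (_ : (_ - 3) / 3 * _ = (Num.sqrt 21 ^+ 2 - 6 * Num.sqrt 21 + 9) / 12); last by field.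
by rewrite s2; field.
Qed.

Lemma kappa1E : 3 * kappa1 = 4 * (betas - 1).
Proof. by rewrite /kappa1 /betas; field. Qed.

(* The exponents of D of the terms of [block3_cnt_le] for K = D^kappa and
   L = D^(kappa - tau). *)
Lemma exponents3 (beta kappa : R) : betas < beta ->
  let tau := beta - 1 - (beta - betas) / 50 in
  tau <= kappa -> kappa <= kappa1 ->
  [/\ kappa - tau <= tau, 2 * kappa - 1 <= tau & 4 * kappa - 2 <= tau] /\
  [/\ 2 * kappa - 1 + (beta - 1 - kappa * beta + kappa) <= tau,
   4 * kappa - 2 + (beta - 1 - kappa * beta + kappa) <= tau,
   beta - kappa * beta - 2 * kappa + 6 * (kappa - tau) <= tau &
   kappa - tau + (beta - 1 - kappa * beta) + kappa <= tau] /\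
  [/\ beta - 1 - kappa * beta <= - (1 / 10) & 1 / 10 <= beta - kappa * beta - kappa].
Proof.
move=> hb tau ht hk; have /andP[b1 b2] := betas_bounds.
have /andP[k1 k2] := kappa1_bounds; have kb := kappa1_betas; have k3 := kappa1E.
rewrite /tau in ht *; clear tau.
move: betas kappa1 hb ht hk b1 b2 k1 k2 kb k3 => B K1 hb ht hk b1 b2 k1 k2 kb k3.
have k0 : 0 < kappa by lra.
(* A nonempty range tau <= kappa <= kappa1 bounds beta from above; for larger beta the lemma is
   vacuous. *)
have eta : beta - B <= 1 / 6 by lra.
have pos3 (x y : R) : 0 <= x -> 0 <= y -> 0 <= x * y by exact: mulr_ge0.
have k66 : 0 <= 8 / 15 - kappa by lra.
have e0 : 0 <= beta - B by lra.
split; first by split; lra.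
split; last first.
  have m11 : 0 <= (8 / 15 - kappa) * (beta + 1) by apply: pos3; lra.
  have m5 : 0 <= (kappa - (beta - 1 - (beta - B) / 50)) * beta by apply: pos3; lra.
  have m7 : 0 <= (beta - B) * (beta - B) by apply: pos3; lra.
  have m8 : 0 <= (B - 39 / 28) * (beta - B) by apply: pos3; lra.
  have m9 : 0 <= (B - 39 / 28) * (B - 39 / 28) by apply: pos3; lra.
  split; [clear m11|clear m5 m7 m8 m9]; lra.
split.
- have m2 : 0 <= (8 / 15 - kappa) * (3 - beta) by apply: pos3; lra.
  lra.
- have m10 : 0 <= (8 / 15 - kappa) * (5 - beta) by apply: pos3; lra.
  lra.
(* The critical term, from L^6: at kappa = kappa1 and beta = betas its exponent equals tau. *)
- have m4 : 0 <= (K1 - kappa) * (4 - beta) by apply: pos3; lra.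
  have m6 : 0 <= K1 * (beta - B) by apply: pos3; lra.
  lra.
- have m3 : 0 <= (8 / 15 - kappa) * (2 - beta) by apply: pos3; lra.
  lra.
Qed.

(** A solution with k > d^kappa1 has m <= ((d + 1) / k)^beta, at most a constant times d^(beta (1 -
    kappa1)); the second summand absorbs the constant. *)
Definition mu1 (beta : R) : R := beta * (1 - kappa1) + (beta - betas) / 100.

(* The exponents of D of the terms of [block2_cnt_le] for M = D^mu and
   L = D^(mu - tau). *)
Lemma exponents2 (p beta mu : R) : 0 < p -> p < 1 -> p * beta = 1 -> betas < beta ->
  let tau := beta - 1 - (beta - betas) / 50 in
  tau <= mu -> mu <= mu1 beta ->
  [/\ mu - tau <= tau, 1 - (1 + (p + 1)) * mu + mu + 2 * (mu - tau) <= tau,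
      mu - p * mu <= tau & 2 * mu - 1 <= tau].
Proof.
move=> p0 p1 pb hb tau ht hk; have /andP[b1 b2] := betas_bounds.
have /andP[k1 k2] := kappa1_bounds; have kb := kappa1_betas.
rewrite /tau /mu1 in ht hk *; clear tau.
move: betas kappa1 hb ht hk b1 b2 k1 k2 kb => B K1 hb ht hk b1 b2 k1 k2 kb.
have pos3 (x y : R) : 0 <= x -> 0 <= y -> 0 <= x * y by exact: mulr_ge0.
(* As p beta = 1, the factor (1 - p) beta is beta - 1. With this the exponent of V M L^2 meets tau
   exactly at the critical values, by kappa1 (betas - 1) = 3 - 2 betas. *)
have m1 : (1 - p) * mu <= (beta - 1) * (1 - K1) + (beta - B) / 100.
  have h : (1 - p) * mu <= (1 - p) * (beta * (1 - K1) + (beta - B) / 100).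
    by rewrite ler_wpM2l//; lra.
  have e : (1 - p) * (beta * (1 - K1) + (beta - B) / 100) =
    (beta - p * beta) * (1 - K1) + (1 - p) * ((beta - B) / 100) by ring.
  have h2 : 0 <= p * ((beta - B) / 100) by apply: pos3; lra.
  by rewrite e pb in h; lra.
have m2 : 0 <= (K1 - 11 / 21) * (beta - B) by apply: pos3; lra.
have m3 : 0 <= (K1 - 11 / 21) * beta by apply: pos3; lra.
split; [clear m1 m2|clear m3|clear m3|clear m1 m2]; lra.
Qed.

End exponents.

Section powers_of_D.
Variables (R : realType) (D : R).
Hypothesis D1 : 1 < D.

Lemma powRDD (x y : R) : D `^ (x + y) = D `^ x * D `^ y.
Proof. by rewrite powRD// (gt_eqF (lt_trans ltr01 D1)) implybT. Qed.

(** Block lengths are written as powers of [D], so that comparing terms becomes comparing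
    exponents. *)
Lemma powR_log (K : R) : 0 < K -> K = D `^ (ln K / ln D).
Proof.
move=> K0; have l0 : 0 < ln D by exact: ln_gt0.
by rewrite /powR (gt_eqF (lt_trans ltr01 D1)) divfK ?gt_eqF// lnK.
Qed.

Lemma powR_le_exp (x y : R) : (D `^ x <= D `^ y) = (x <= y).
Proof.
have D0 : 0 < D by exact: lt_trans D1.
rewrite -(@ler_ln _ (D `^ x) (D `^ y)) ?posrE ?powR_gt0// !ln_powR.
by rewrite ler_pM2r// ln_gt0.
Qed.

Lemma pmul_powR_le (c x y : R) : 0 <= c -> x <= y -> c * D `^ x <= c * D `^ y.
Proof. by move=> c0 xy; rewrite ler_wpM2l// powR_le_exp. Qed.

End powers_of_D.

Lemma trunc_quotient (R : realType) (x : R) : 1 <= x ->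
  exists L, [/\ (0 < L)%N, x <= L%:R & L%:R <= 2 * x].
Proof.
move=> x1; exists (Num.truncn x).+1; split => //.
  by rewrite ltW// truncnS_gt.
have x0 : 0 <= x by lra.
have : (Num.truncn x)%:R <= x by rewrite truncn_le.
by rewrite -natr1; lra.
Qed.

Lemma harm_powR_le (R : realType) (D s e : R) L : 1 < D -> 0 < s -> (0 < L)%N ->
  L%:R <= 4 * D `^ e -> harm R L <= (1 + s^-1) * 4 `^ s * D `^ (e * s).
Proof.
move=> D1 s0 L0 LD; apply: (le_trans (harm_le_powR R s L s0 L0)).
rewrite -mulrA; apply: ler_wpM2l; first by rewrite addr_ge0// invr_ge0 ltW.
have L1 : 0 <= L%:R :> R by exact: ler0n.
apply: (le_trans (ler_powRl R s _ _ (ltW s0) L1 LD)).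
by rewrite powRM ?powR_ge0// powRrM.
Qed.

Section block3_asymptotic.
Variables (R : realType) (alpha : R).
Hypothesis alpha1 : 1 < alpha.
Hypothesis alpha2 : alpha < 2.
Let p := alpha - 1.
Let beta := p^-1.
Hypothesis beta_gt : betas R < beta.
Let tau := beta - 1 - (beta - betas R) / 50.

(** Every term of [block3_cnt_le] becomes a constant times a power of [D] with exponent at most tau;
    only the harmonic sum costs the extra 4 s. [C] and [D1] are chosen before [D] and the block, so
    the bound is uniform. *)
Lemma block3_asymptotic (s : R) : 0 < s ->
  exists C D1 : R, [/\ 0 <= C, 1 <= D1 & forall D, D1 <= D ->
    forall (K : nat) (P : nat -> bool) (y : nat -> nat),
    (0 < K)%N -> D `^ tau <= K%:R -> K%:R <= D `^ kappa1 R ->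
    (forall k, (K <= k < K + K)%N -> P k ->
       (0 < y k)%N /\ `|Gk R alpha k%:R (y k)%:R - D| <= 1) ->
    (cnt P K (K + K))%:R <= C * D `^ (tau + 4 * s)].
Proof.
move=> s0.
have p0 : 0 < p by rewrite subr_gt0.
have beta0 : 0 < beta by rewrite invr_gt0.
have alpha0 : 0 < alpha by exact: lt_trans alpha1.
have ap0 : 0 < alpha * p by exact: mulr_gt0.
have a20 : 0 < 2 * alpha by rewrite mulr_gt0.
pose Cd := (alpha * p)^-1 * 2 `^ (beta - 1).
have Cd0 : 0 < Cd by apply: mulr_gt0; [rewrite invr_gt0|exact: powR_gt0].
pose c1 := p / 8 * (2 * alpha) `^ (- beta).
have c10 : 0 < c1 by apply: mulr_gt0; [exact: divr_gt0|exact: powR_gt0].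
pose c2 := 4 / p ^+ 2.
have c20 : 0 < c2 by apply: divr_gt0 => //; exact: exprn_gt0.
pose a := 8 * Cd / c1.
have a0 : 0 < a by apply: divr_gt0 => //; exact: mulr_gt0.
pose ch := (1 + s^-1) * 4 `^ s.
have ch0 : 0 < ch by apply: mulr_gt0; [rewrite addr_gt0// invr_gt0|exact: powR_gt0].
have tau0 : 0 <= tau.
  by have /andP[h1 _] := betas_bounds R; have := beta_gt; rewrite /tau; lra.
have b1 : 1 < beta by have /andP[h _] := betas_bounds R; have := beta_gt; lra.
(* The first summand makes [delta] at most 1/2, the second gives the hypothesis [KD] of the block
   bound; 1 / 10 is the margin left by [exponents3]. *)
have [Da Da1 HDa] := powR_eventually_ge R (2 * Cd + 16 * (2 * alpha) `^ beta) (1 / 10) ltac:(lra).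
pose C := 1 + 2 + 2 + (a * (a * c2) + 4 * a + a * (a * c2) * a + 4 * a * a)
  + 64 * (c1 + c2) + 64 * ((c1 + c2) / c1) * Cd * ch.
have C0 : 0 < C.
  have x1 := mulr_gt0 a0 c20; have x2 := mulr_gt0 a0 x1; have x3 := mulr_gt0 x2 a0.
  have x4 := mulr_gt0 a0 a0; have x5 := addr_gt0 c10 c20; have x6 := divr_gt0 x5 c10.
  have x7 := mulr_gt0 (mulr_gt0 x6 Cd0) ch0; rewrite /C.
  lra.
exists C, (Da + 1); split; [exact: ltW|lra|].
move=> D DD K P y K0 KT KU Py.
have D1 : 1 < D by lra.
have D0 : 0 < D by lra.
have K0R : 0 < K%:R :> R by rewrite ltr0n.
have [kappa KE] : exists kappa, K%:R = D `^ kappa by exists (ln K%:R / ln D); exact: powR_log.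
rewrite KE !powR_le_exp// in KT KU.
have ED := powRDD R D D1.
have [[x1 x2 x3] [[x4 x5 x6 x7] [x8 x9]]] := exponents3 R beta kappa beta_gt KT KU.
rewrite -/tau in x1 x2 x3 x4 x5 x6 x7.
have kt2 : (kappa - tau) * 2%:R <= 4.
  have /andP[_ h1] := kappa1_bounds R.
  have h2 : kappa - tau <= 1 by move: KU tau0; lra.
  lra.
have HD : 2 * Cd + 16 * (2 * alpha) `^ beta <= D `^ (1 / 10) by apply: HDa; lra.
have ac0 : 0 < (2 * alpha) `^ beta by exact: powR_gt0.
pose delta := Cd * D `^ (beta - 1 - kappa * beta).
have delta12 : delta <= 2^-1.
  apply: (le_trans (pmul_powR_le R D D1 Cd _ _ (ltW Cd0) x8)).
  rewrite powRN ler_pdivrMr ?powR_gt0//; lra.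
have KD : 16 * K%:R <= (D / (alpha * (2 * K%:R))) `^ beta.
  have -> : D / (alpha * (2 * K%:R)) = (2 * alpha)^-1 * (D / K%:R).
    by field; rewrite !gt_eqF.
  rewrite powRM ?invr_ge0 ?(ltW a20) ?divr_ge0 ?(ltW D0)//.
  have -> : D / K%:R = D `^ (1 - kappa).
    by rewrite ED powRN -KE powRr1// ltW.
  have -> : (2 * alpha)^-1 `^ beta = ((2 * alpha) `^ beta)^-1.
    by rewrite -(powR_inv1 (ltW a20)) -powRrM mulN1r powRN.
  rewrite ler_pdivlMl// KE -powRrM.
  have -> : (1 - kappa) * beta = (beta - kappa * beta - kappa) + kappa by ring.
  rewrite ED mulrA ler_wpM2r ?powR_ge0//.
  have h : D `^ (1 / 10) <= D `^ (beta - kappa * beta - kappa) by rewrite powR_le_exp.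
  by apply: le_trans h; rewrite mulrC; lra.
have deltaE : (alpha * p * (K%:R `^ beta * (D + 1) `^ (1 - beta)))^-1 <= delta.
  have -> : delta = (alpha * p * (K%:R `^ beta * (2 * D) `^ (1 - beta)))^-1.
    rewrite /delta /Cd !invfM -!mulrA; congr (_ * (_ * _)).
    rewrite KE -powRrM powRM// ?(ltW D0)//.
    rewrite invfM mulrCA -!powRN opprB; congr (_ * _).
    by rewrite -ED; congr (_ `^ _); ring.
  rewrite lef_pV2 ?posrE; last 2 first.
  - by rewrite !mulr_gt0 ?powR_gt0// addr_gt0.
  - by rewrite !mulr_gt0 ?powR_gt0// mulr_gt0.
  apply: ler_wpM2l; first exact: ltW.
  apply: ler_wpM2l; first exact: powR_ge0.
  have bn : 1 - beta <= 0 by rewrite subr_le0 ltW.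
  have D10 : 0 < D + 1 by rewrite addr_gt0.
  have D2 : D + 1 <= 2 * D by rewrite mulr_natl mulr2n lerD2l ltW.
  exact: (ler_powRN R _ _ _ bn D10 D2).
have [L [L0 Ll Lu]] : exists L : nat, [/\ (0 < L)%N, D `^ (kappa - tau) <= L%:R & L%:R <= 2 * D `^ (kappa - tau)].
  by apply: trunc_quotient; rewrite -[leLHS](powRr0 D) powR_le_exp// subr_ge0.
have L0R : 0 < L%:R :> R by rewrite ltr0n.
have := block3_cnt_le R alpha D K P y alpha1 alpha2 D0 K0 KD Py delta deltaE L L0 delta12.
rewrite -/p -/beta -/c1 -/c2.
have -> : (D / K%:R) `^ beta / K%:R ^+ 2 = D `^ (beta - kappa * beta - 2 * kappa).
  have -> : D / K%:R = D `^ (1 - kappa).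
    by rewrite ED powRN -KE powRr1// ltW.
  have -> : K%:R ^+ 2 = D `^ (2 * kappa).
    by rewrite -(powR_mulrn 2 (ltW K0R)) KE -powRrM mulrC.
  by rewrite -powRN -powRrM -ED; congr (_ `^ _); ring.
set W := D `^ (beta - kappa * beta - 2 * kappa).
have W0 : 0 < W by exact: powR_gt0.
have Wn : W != 0 by rewrite gt_eqF.
have c1n : c1 != 0 by rewrite gt_eqF.
have dW : 8 * delta / (c1 * W) = a * D `^ (2 * kappa - 1).
  have -> : delta = Cd * (D `^ (2 * kappa - 1) * W).
    by rewrite /delta /W -ED; congr (_ * _ `^ _); ring.
  by rewrite /a; field; rewrite Wn c1n.
rewrite dW.
set E2 := D `^ (2 * kappa - 1).
have -> : delta / (c1 * W / (4 * K%:R)) = 4 / c1 * (Cd * (E2 * K%:R)).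
  have -> : delta = Cd * (E2 * W).
    by rewrite /delta /W /E2 -ED; congr (_ * _ `^ _); ring.
  by field; rewrite Wn c1n gt_eqF.
move=> main; apply: (le_trans main).
pose T := D `^ (tau + 4 * s).
have T0 : 0 < T by exact: powR_gt0.
have ts : tau <= tau + 4 * s by rewrite lerDl; apply: mulr_ge0 => //; exact: ltW.
have TE x : x <= tau -> D `^ x <= T.
  by move=> h; rewrite powR_le_exp//; exact: le_trans ts.
have E20 : 0 < E2 by exact: powR_gt0.
have t0 : 1 <= T.
  have e1 : 1 = D `^ 0 by rewrite powRr0.
  rewrite e1; apply: TE.
  exact: tau0.
have t1 : K%:R / L%:R <= T.
  apply: (@le_trans _ _ (D `^ tau)); last by apply: TE.
  rewrite ler_pdivrMr// KE (_ : kappa = tau + (kappa - tau)); last by ring.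
  by rewrite ED; apply: ler_wpM2l; [exact: powR_ge0|].
have t2 : L%:R <= 2 * T.
  by apply: (le_trans Lu); apply: ler_wpM2l => //; apply: TE.
have t3 : E2 <= T by apply: TE.
have t4 : E2 * E2 <= T.
  by rewrite /E2 -ED; apply: TE; apply: le_trans x3; rewrite le_eqVlt; apply/orP; left; apply/eqP; ring.
have WK : E2 * (W * K%:R) = D `^ (beta - 1 - kappa * beta + kappa).
  by rewrite KE /E2 /W -!ED; congr (_ `^ _); ring.
have t5 : E2 * (E2 * (W * K%:R)) <= T by rewrite WK /E2 -ED; apply: TE.
have t6 : E2 * E2 * (E2 * (W * K%:R)) <= T.
  rewrite WK /E2 -!ED; apply: TE; apply: le_trans x5.
  by rewrite le_eqVlt; apply/orP; left; apply/eqP; ring.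
have t7 : W * L%:R ^+ 6 <= 64 * T.
  have l6 : L%:R ^+ 6 <= (2 * D `^ (kappa - tau)) ^+ 6.
    by rewrite lerXn2r ?nnegrE ?ler0n ?mulr_ge0 ?powR_ge0.
  apply: (le_trans (ler_wpM2l (ltW W0) l6)).
  rewrite exprMn mulrCA (_ : 2 ^+ 6 = 64 :> R); last by ring.
  apply: ler_wpM2l => //.
  rewrite -powR_mulrn ?powR_ge0// -powRrM /W -ED; apply: TE.
  by rewrite (_ : (kappa - tau) * 6%:R = 6 * (kappa - tau))//; ring.
(* The exponent 4 is generous for L^2; only its product with the small [s] matters. *)
have hh : harm R (L ^ 2) <= ch * D `^ (4 * s).
  have ld : (L ^ 2)%:R <= 4 * D `^ 4.
    rewrite natrX; have h : L%:R ^+ 2 <= (2 * D `^ (kappa - tau)) ^+ 2.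
      by rewrite lerXn2r ?nnegrE ?ler0n ?mulr_ge0 ?powR_ge0.
    apply: (le_trans h); rewrite exprMn (_ : 2 ^+ 2 = 4 :> R); last by ring.
    by apply: ler_wpM2l => //; rewrite -powR_mulrn ?powR_ge0// -powRrM powR_le_exp.
  by have := harm_powR_le R D s 4 (L ^ 2) D1 s0 (ltac:(by rewrite expn_gt0 L0)) ld.
have t8 : L%:R * (E2 * K%:R * W) * harm R (L ^ 2) <= 2 * ch * T.
  have h0 : 0 <= L%:R * (E2 * K%:R * W) by rewrite !mulr_ge0// ltW.
  apply: (le_trans (ler_wpM2l h0 hh)).
  have -> : E2 * K%:R * W = D `^ (beta - 1 - kappa * beta + kappa) by rewrite -WK; ring.
  have h1 : L%:R * D `^ (beta - 1 - kappa * beta + kappa) <=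
     2 * D `^ (kappa - tau) * D `^ (beta - 1 - kappa * beta + kappa).
    by apply: ler_wpM2r => //; exact: powR_ge0.
  have h2 : 0 <= ch * D `^ (4 * s) by apply: mulr_ge0; [exact: ltW|exact: powR_ge0].
  apply: (le_trans (ler_wpM2r h2 h1)).
  have -> : 2 * D `^ (kappa - tau) * D `^ (beta - 1 - kappa * beta + kappa) * (ch * D `^ (4 * s)) =
    2 * ch * (D `^ (kappa - tau) * D `^ (beta - 1 - kappa * beta + kappa) * D `^ (4 * s)) by ring.
  apply: ler_wpM2l; first by apply: mulr_ge0 => //; exact: ltW.
  by rewrite -!ED powR_le_exp// lerD2r; apply: le_trans x7; rewrite !addrA.
have -> : C * D `^ (tau + 4 * s) = C * T by [].
have p1 : 0 <= a * (a * c2) := ltW (mulr_gt0 a0 (mulr_gt0 a0 c20)).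
have p2 : 0 <= a * (a * c2) * a := mulr_ge0 p1 (ltW a0).
have p3 : 0 <= a * a := ltW (mulr_gt0 a0 a0).
have p4 : 0 <= c1 + c2 := ltW (addr_gt0 c10 c20).
have p5 : 0 <= 32 * ((c1 + c2) / c1) * Cd.
  have p6 : 0 <= (c1 + c2) / c1 := divr_ge0 p4 (ltW c10).
  by apply: mulr_ge0; [exact: mulr_ge0|exact: ltW].
have q1 := ler_wpM2l p1 t5.
have q2 := ler_wpM2l p2 t6.
have q3 := ler_wpM2l p3 t4.
have q4 := ler_wpM2l (ltW a0) t3.
have q5 := ler_wpM2l p4 t7.
have q6 := ler_wpM2l p5 t8.
have -> : a * E2 * (a * E2 * (c2 * W) * K%:R + 4) * (1 + a * E2) =
  a * (a * c2) * (E2 * (E2 * (W * K%:R))) + 4 * (a * E2) +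
  a * (a * c2) * a * (E2 * E2 * (E2 * (W * K%:R))) + 4 * (a * a * (E2 * E2)) by ring.
have -> : (c2 * W + c1 * W) * L%:R ^+ 6 = (c1 + c2) * (W * L%:R ^+ 6) by ring.
have -> : 8 * L%:R * (c2 * W + c1 * W) * (4 / c1 * (Cd * (E2 * K%:R))) * harm R (L ^ 2) =
  32 * ((c1 + c2) / c1) * Cd * (L%:R * (E2 * K%:R * W) * harm R (L ^ 2)) by field.
have -> : C * T = T + 2 * T + 2 * T + (a * (a * c2) * T + 4 * (a * T) + a * (a * c2) * a * T
   + 4 * (a * a * T)) + (c1 + c2) * (64 * T) + 32 * ((c1 + c2) / c1) * Cd * (2 * ch * T).
  by rewrite /C; ring.
apply: lerD => //; apply: lerD => //; apply: lerD.
  by apply: lerD => //; apply: lerD => //; rewrite ler_pM2l.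
apply: lerD; last by rewrite ler_pM2l.
by apply: lerD => //; apply: lerD => //; rewrite ler_pM2l.
Qed.

End block3_asymptotic.

Section block2_asymptotic.
Variables (R : realType) (alpha : R).
Hypothesis alpha1 : 1 < alpha.
Hypothesis alpha2 : alpha < 2.
Let p := alpha - 1.
Let beta := p^-1.
Hypothesis beta_gt : betas R < beta.
Let tau := beta - 1 - (beta - betas R) / 50.

Lemma block2_asymptotic (s : R) : 0 < s ->
  exists C D1 : R, [/\ 0 <= C, 1 <= D1 & forall D, D1 <= D ->
    forall (M : nat) (P : nat -> bool) (y : nat -> nat),
    (0 < M)%N -> D `^ tau <= M%:R -> M%:R <= D `^ mu1 R beta ->
    (forall m, (M <= m < M + M)%N -> P m ->
       `|(y m)%:R `^ alpha - m%:R `^ alpha - D| <= 1) ->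
    (cnt P M (M + M))%:R <= C * D `^ (tau + tau * s)].
Proof.
move=> s0.
have p0 : 0 < p by rewrite subr_gt0.
have p1 : p < 1 by rewrite ltrBlDr.
have alpha0 : 0 < alpha by exact: lt_trans alpha1.
have tau0 : 0 < tau.
  by have /andP[h1 _] := betas_bounds R; have := beta_gt; rewrite /tau; lra.
pose ch := (1 + s^-1) * 4 `^ s.
have ch0 : 0 < ch by apply: mulr_gt0; [rewrite addr_gt0// invr_gt0|exact: powR_gt0].
(* Since N >= M >= D^tau, the width N^(-p) is at most D^(-p tau) <= 1/2. *)
have [Da Da1 HDa] := powR_eventually_ge R 2 (p * tau) (mulr_gt0 p0 tau0).
pose C := 1 + 1 + 4 * p + 8 + (32 + p^-1 * 256) * ch.
have C0 : 0 <= C.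
  have x1 : 0 <= p^-1 * 256 by apply: mulr_ge0; [rewrite invr_ge0 ltW|exact: ler0n].
  have x2 : 0 <= (32 + p^-1 * 256) * ch by apply: mulr_ge0; [exact: addr_ge0|exact: ltW].
  by rewrite /C; do ![apply: addr_ge0 => //]; apply: mulr_ge0 => //; exact: ltW.
exists C, (Da + 1); split; [by []|lra|].
move=> D DD M P y M0 MT MU Py.
have D1 : 1 < D by lra.
have D0 : 0 < D by lra.
have M0R : 0 < M%:R :> R by rewrite ltr0n.
have [mu ME] : exists mu, M%:R = D `^ mu by exists (ln M%:R / ln D); exact: powR_log.
rewrite ME !powR_le_exp// in MT MU.
have ED := powRDD R D D1.
have pb : p * beta = 1 by rewrite mulfV// gt_eqF.
have [x1 x2 x3 x4] := exponents2 R p beta mu p0 p1 pb beta_gt MT MU.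
rewrite -/tau in x1 x2 x3 x4.
have N0 := curveN_gt0 R alpha D D0 M%:R.
have NM : M%:R <= curveN R alpha D M%:R by apply: curveN_ge => //; exact: ltW.
have NA := curveN_alpha R alpha D alpha1 D0 M%:R.
set N := curveN R alpha D M%:R in N0 NM NA.
have [L [L0 Ll Lu]] : exists L : nat, [/\ (0 < L)%N, D `^ (mu - tau) <= L%:R & L%:R <= 2 * D `^ (mu - tau)].
  by apply: trunc_quotient; rewrite -[leLHS](powRr0 D) powR_le_exp// subr_ge0.
have L0R : 0 < L%:R :> R by rewrite ltr0n.
have dM : (N `^ p)^-1 <= D `^ (- (p * mu)).
  have -> : D `^ (- (p * mu)) = (M%:R `^ p)^-1.
    by rewrite ME -powRrM powRN mulrC.
  rewrite lef_pV2 ?posrE ?(powR_gt0 _ N0) ?(powR_gt0 _ M0R)//.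
  exact: (ler_powRl R _ _ _ (ltW p0) (ltW M0R) NM).
have d2 : (N `^ p)^-1 <= 2^-1.
  apply: (le_trans dM); rewrite powRN lef_pV2 ?posrE ?(powR_gt0 _ D0)//.
  have h : 2 <= D `^ (p * tau) by apply: HDa; lra.
  by apply: (le_trans h); rewrite powR_le_exp// ler_wpM2l// ltW.
have := block2_cnt_le R alpha D alpha1 alpha2 D0 M P y M0 Py _ _ erefl erefl L d2.
rewrite -/p -/N; clearbody N.
set V := p * D * _ * _.
have V0 : 0 < V.
  by do 3?[apply: mulr_gt0 => //]; exact: powR_gt0.
have VM : V <= p * D `^ (1 - (1 + (p + 1)) * mu).
  have -> : D `^ (1 - (1 + (p + 1)) * mu) = D * M%:R `^ (p - 1) * M%:R `^ (- (p + alpha)).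
    rewrite ME -!powRrM -{2}(powRr1 (ltW D0)) -!ED; congr (_ `^ _); rewrite /p; ring.
  rewrite !mulrA; apply: ler_wpM2l.
    by apply: mulr_ge0; [apply: mulr_ge0; exact: ltW|exact: powR_ge0].
  have pa : - (p + alpha) <= 0 by rewrite oppr_le0; apply: addr_ge0; exact: ltW.
  exact: (ler_powRN R _ _ _ pa M0R NM).
(* In delta / V = N^alpha M^(1 - p) / (p D) the power N^alpha is D + M^alpha, which produces M^(1 -
   p) and M^2 / D. *)
have dV : (N `^ p)^-1 / V = p^-1 * (D `^ (mu - p * mu) + D `^ (2 * mu - 1)).
  have Nn : N != 0 by rewrite gt_eqF.
  have -> : V = p * (D * M%:R `^ (p - 1)) * (N `^ p * N `^ alpha)^-1.
    rewrite /V [N `^ _]powRN (@powRD _ N p alpha) ?Nn ?implybT//.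
    by rewrite !mulrA.
  rewrite NA.
  have -> : D `^ (mu - p * mu) = (M%:R `^ (p - 1))^-1.
    by rewrite ME -powRrM -powRN; congr (_ `^ _); ring.
  have -> : D `^ (2 * mu - 1) = M%:R `^ alpha * (M%:R `^ (p - 1))^-1 / D.
    rewrite ME -!powRrM -powRN -(powR_inv1 (ltW D0)) -!ED; congr (_ `^ _); rewrite /p; ring.
  have n1 : N `^ p != 0 by rewrite gt_eqF// powR_gt0.
  have n2 : M%:R `^ (p - 1) != 0 by rewrite gt_eqF// powR_gt0.
  have n3 : D + M%:R `^ alpha != 0 by rewrite gt_eqF// addr_gt0// powR_gt0.
  have n4 : p != 0 by rewrite gt_eqF.
  have n5 : D != 0 by rewrite gt_eqF.
  by field; rewrite n1 n2 n3 n4 n5.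
have -> : (4 * V * M%:R + 16) * ((N `^ p)^-1 / (V / 8)) =
   32 * (M%:R * (N `^ p)^-1) + 128 * ((N `^ p)^-1 / V).
  have n1 : N `^ p != 0 by rewrite gt_eqF// powR_gt0.
  by field; rewrite n1 gt_eqF.
rewrite dV.
move=> main; apply: (le_trans main).
pose T := D `^ tau.
have T0 : 0 < T by exact: powR_gt0.
pose T2 := D `^ (tau + tau * s).
have T20 : 0 < T2 by exact: powR_gt0.
have TT2 : T <= T2.
  by rewrite powR_le_exp// lerDl; apply: mulr_ge0; exact: ltW.
have TE x : x <= tau -> D `^ x <= T by move=> h; rewrite powR_le_exp.
have t0 : 1 <= T.
  have e1 : 1 = D `^ 0 by rewrite powRr0.
  by rewrite e1; apply: TE; exact: ltW.
have t1 : M%:R / L.+1%:R <= T.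
  apply: (@le_trans _ _ (M%:R / L%:R)).
    apply: ler_wpM2l; first exact: ltW.
    by rewrite lef_pV2 ?posrE ?ltr0n// ler_nat.
  rewrite ler_pdivrMr// ME (_ : mu = tau + (mu - tau)); last by ring.
  by rewrite ED; apply: ler_wpM2l; [exact: powR_ge0|].
have t2 : L%:R <= 2 * T.
  by apply: (le_trans Lu); apply: ler_wpM2l => //; apply: TE.
have t3 : V * M%:R * L%:R ^+ 2 <= 4 * p * T.
  have l2 : L%:R ^+ 2 <= (2 * D `^ (mu - tau)) ^+ 2.
    by rewrite lerXn2r ?nnegrE ?ler0n ?mulr_ge0 ?powR_ge0.
  have VM0 : 0 <= V * M%:R by apply: mulr_ge0; exact: ltW.
  apply: (le_trans (ler_wpM2l VM0 l2)).
  have h1 : V * M%:R <= p * D `^ (1 - (1 + (p + 1)) * mu) * M%:R.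
    by apply: ler_wpM2r VM; exact: ltW.
  have h2 : 0 <= (2 * D `^ (mu - tau)) ^+ 2 by exact: sqr_ge0.
  apply: (le_trans (ler_wpM2r h2 h1)).
  have -> : (2 * D `^ (mu - tau)) ^+ 2 = 4 * D `^ (2 * (mu - tau)).
    rewrite exprMn -(powR_mulrn 2 (powR_ge0 D _)) -powRrM (_ : 2 ^+ 2 = 4 :> R); last by ring.
    by rewrite [(mu - tau) * _]mulrC.
  rewrite ME.
  have -> : p * D `^ (1 - (1 + (p + 1)) * mu) * D `^ mu * (4 * D `^ (2 * (mu - tau))) =
    4 * p * (D `^ (1 - (1 + (p + 1)) * mu) * D `^ mu * D `^ (2 * (mu - tau))) by ring.
  apply: ler_wpM2l; first by apply: mulr_ge0 => //; exact: ltW.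
  by rewrite -!ED; apply: TE.
have hh : harm R L <= ch * D `^ (tau * s).
  have ld : L%:R <= 4 * D `^ tau.
    by apply: (le_trans t2); apply: ler_wpM2r; [exact: ltW|rewrite ler_nat].
  exact: harm_powR_le R D s tau L D1 s0 L0 ld.
have t4 : M%:R * (N `^ p)^-1 <= T.
  apply: (le_trans (ler_wpM2l (ltW M0R) dM)).
  by rewrite ME -ED; apply: TE; rewrite -mulrN mulrN.
have t5 : 128 * (p^-1 * (D `^ (mu - p * mu) + D `^ (2 * mu - 1))) <= p^-1 * 256 * T.
  have -> : p^-1 * 256 * T = 128 * (p^-1 * (T + T)) by ring.
  apply: ler_wpM2l => //; apply: ler_wpM2l; first by rewrite invr_ge0 ltW.
  by apply: lerD; apply: TE.
have t6 : (32 * (M%:R * (N `^ p)^-1) +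
   128 * (p^-1 * (D `^ (mu - p * mu) + D `^ (2 * mu - 1)))) * harm R L <= (32 + p^-1 * 256) * ch * T2.
  have -> : (32 + p^-1 * 256) * ch * T2 = ((32 + p^-1 * 256) * T) * (ch * D `^ (tau * s)).
    by rewrite /T2 ED /T; ring.
  apply: ler_pM => //.
  - apply: addr_ge0; apply: mulr_ge0 => //.
      by apply: mulr_ge0; [exact: ltW|rewrite invr_ge0 powR_ge0].
    by apply: mulr_ge0; [rewrite invr_ge0 ltW|apply: addr_ge0; exact: powR_ge0].
  - exact: harm_ge0.
  by rewrite [leRHS]mulrDl; apply: lerD => //; apply: ler_wpM2l.
have -> : C * D `^ (tau + tau * s) = T2 + T2 + 4 * p * T2 + 8 * T2 + (32 + p^-1 * 256) * ch * T2.
  by rewrite /C -/T2; ring.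
apply: lerD; last exact: t6.
apply: lerD; last first.
  apply: (@le_trans _ _ (8 * T)); last by apply: ler_wpM2l.
  by rewrite (_ : 8 * T = 4 * (2 * T)); [apply: ler_wpM2l|ring].
apply: lerD; last first.
  by apply: (le_trans t3); apply: ler_wpM2l => //; apply: mulr_ge0 => //; exact: ltW.
by apply: lerD; [exact: le_trans TT2|exact: le_trans TT2].
Qed.

End block2_asymptotic.

(** * The solutions with a fixed difference k *)

(* Applied to fractional parts, this replaces any equidistribution statement. *)
Lemma telescope_shift_le (R : realType) (u : nat -> R) (k b c : nat) : (b <= c)%N ->
  (forall m, 0 <= u m <= 1) ->
  `|\sum_(b <= m < c) (u (m + k)%N - u m)| <= k%:R.
Proof.
move=> bc u01; elim: k => [|k IH].
  by rewrite big1 ?normr0// => m _; rewrite addn0 subrr.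
have -> : \sum_(b <= m < c) (u (m + k.+1)%N - u m) =
  \sum_(b <= m < c) (u (m.+1 + k)%N - u (m + k)%N) + \sum_(b <= m < c) (u (m + k)%N - u m).
  by rewrite -big_split /=; apply: eq_bigr => m _; rewrite addnS addSn; ring.
rewrite (telescope_sumr (fun m => u (m + k)%N))// -natr1 addrC.
apply: (le_trans (ler_normD _ _)); apply: lerD => //.
have /andP[h1 h2] := u01 (c + k)%N; have /andP[h3 h4] := u01 (b + k)%N.
by rewrite ler_norml; apply/andP; split; lra.
Qed.

(** [T] is a primitive of 1 - s y. Over a step D it grows by D (1 - s g m) - s D^2 / 2; the growth
    telescopes, and the squares cost at most u (g c - g b) / 2. The two sides of the tent are s = 1
    and s = -1. *)
Lemma weight_sum_bounds (R : realType) (g : nat -> R) (s l u : R) (b c : nat) :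
  (b <= c)%N -> 0 < l -> -1 <= s <= 1 ->
  (forall m, (b <= m < c)%N -> l <= g m.+1 - g m <= u) ->
  (forall m, (b <= m < c)%N -> 0 <= 1 - s * g m) ->
  let T y := y - s * (y * y) / 2 in
  l * \sum_(b <= m < c) (1 - s * g m)
    <= T (g c) - T (g b) + u * (g c - g b) / 2 /\
  T (g c) - T (g b) - u * (g c - g b) / 2 <= u * \sum_(b <= m < c) (1 - s * g m).
Proof.
move=> bc l0 /andP[s1 s2] gl w0 T.
have Tt : T (g c) - T (g b) = \sum_(b <= m < c) (T (g m.+1) - T (g m)).
  by rewrite (telescope_sumr (fun m => T (g m))).
have gt : g c - g b = \sum_(b <= m < c) (g m.+1 - g m) by rewrite telescope_sumr.
have step m : (b <= m < c)%N ->
   l * (1 - s * g m) <= T (g m.+1) - T (g m) + u * (g m.+1 - g m) / 2 /\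
   T (g m.+1) - T (g m) - u * (g m.+1 - g m) / 2 <= u * (1 - s * g m).
  move=> bm; have /andP[h1 h2] := gl m bm; have w := w0 m bm.
  set D := g m.+1 - g m in h1 h2 *.
  have -> : g m.+1 = g m + D by rewrite /D; ring.
  have e : T (g m + D) - T (g m) = D * (1 - s * g m) - s * (D * D) / 2.
    by rewrite /T; field.
  rewrite e.
  have a1 : l * (1 - s * g m) <= D * (1 - s * g m) by rewrite ler_wpM2r.
  have a2 : D * (1 - s * g m) <= u * (1 - s * g m) by rewrite ler_wpM2r.
  have D0 : 0 <= D by lra.
  have a3 : D * D <= u * D by rewrite ler_wpM2r.
  have DD : 0 <= D * D by rewrite mulr_ge0.
  have a4 : s * (D * D) <= D * D by rewrite ler_piMl.
  have a5 : - (D * D) <= s * (D * D) by rewrite -mulN1r ler_wpM2r.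
  by split; lra.
split.
  rewrite Tt gt mulr_sumr mulr_sumr mulr_suml -big_split /=.
  by rewrite big_nat [leRHS]big_nat; apply: ler_sum => m bm; have [] := step m bm.
rewrite Tt gt mulr_sumr [u * \sum_(b <= m < c) (1 - _)]mulr_sumr mulr_suml -sumrB.
by rewrite big_nat [leRHS]big_nat; apply: ler_sum => m bm; have [] := step m bm.
Qed.

Definition floor_gap (R : realType) (v : nat -> R) (d k m : nat) : bool :=
  d%:Z == Num.floor (v (m + k)%N) - Num.floor (v m).

(** The integer [e] differs from [g] by less than 1. For [g] in [0, 1] this leaves 0 and 1, for [g]
    in [-1, 0] it leaves 0 and -1, and the indicator of e = 0 is then affine in [e]. *)
Lemma floor_gapE (R : realType) (v : nat -> R) (d k m : nat) :
  let g := v (m + k)%N - v m - d%:R in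
  let e : R := (Num.floor (v (m + k)%N))%:~R - (Num.floor (v m))%:~R - d%:R in
  (0 <= g <= 1 -> (floor_gap R v d k m)%:R = 1 - e) /\
  (-1 <= g <= 0 -> (floor_gap R v d k m)%:R = 1 + e) /\
  (floor_gap R v d k m -> -1 < g < 1).
Proof.
move=> g e.
have x1 := floor_le (v (m + k)%N); have x2 := floorD1_gt (v (m + k)%N).
have y1 := floor_le (v m); have y2 := floorD1_gt (v m).
rewrite intrD mulr1z in x2 y2.
set X := Num.floor (v (m + k)%N) in e x1 x2 *.
set Y := Num.floor (v m) in e y1 y2 *.
pose ei : int := X - Y - d%:Z.
have eE : e = ei%:~R by rewrite /ei !intrB -pmulrn.
have fe : floor_gap R v d k m = (ei == 0).
  by rewrite /floor_gap -/X -/Y /ei subr_eq0 eq_sym.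
have e1 : g - 1 < e by rewrite /g /e; lra.
have e2 : e < g + 1 by rewrite /g /e; lra.
split; last split.
- move=> /andP[g0 g1].
  have : (-1 < ei)%R by rewrite -(ltr_int R) -eE; lra.
  have : (ei < 2)%R by rewrite -(ltr_int R) -eE; lra.
  move=> h1 h2; have [h|h] : ei = 0 \/ ei = 1 by lia.
    by rewrite fe eE h eqxx subr0.
  by rewrite fe eE h subrr.
- move=> /andP[g0 g1].
  have : (-2 < ei)%R by rewrite -(ltr_int R) -eE; lra.
  have : (ei < 1)%R by rewrite -(ltr_int R) -eE; lra.
  move=> h1 h2; have [h|h] : ei = 0 \/ ei = -1 by lia.
    by rewrite fe eE h eqxx addr0.
  by rewrite fe eE h subrr.
rewrite fe => /eqP ei0; rewrite eE ei0 in e1 e2.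
by apply/andP; split; lra.
Qed.

Section tent_count.
Variables (R : realType) (v : nat -> R) (d k a b c : nat) (l u : R).
Hypothesis k0 : (0 < k)%N.
Hypothesis ab : (a <= b)%N.
Hypothesis bc : (b <= c)%N.
Hypothesis l0 : 0 < l.
Hypothesis lu : l <= u.
Hypothesis u1 : u <= 1.
Let g m := v (m + k)%N - v m - d%:R.
Hypothesis gstep : forall m, (a <= m < c)%N -> l <= g m.+1 - g m <= u.
Hypothesis gneg : forall m, (a <= m < b)%N -> -1 <= g m <= 0.
Hypothesis gpos : forall m, (b <= m < c)%N -> 0 <= g m <= 1.
Hypothesis ga : -1 <= g a <= -1 + u.
Hypothesis gb : 0 <= g b <= u.
Hypothesis gc : 1 <= g c <= 1 + u.

Let fr m : R := v m - (Num.floor (v m))%:~R.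

Let fr01 m : 0 <= fr m <= 1.
Proof.
have h1 := floor_le (v m); have h2 := floorD1_gt (v m).
by rewrite intrD mulr1z in h2; rewrite /fr; apply/andP; split; lra.
Qed.

(** Up to fractional parts the indicator is 1 + g between [a] and [b] and 1 - g between [b] and [c];
    the fractional parts cost k on each side. Each half of the tent has area 1/2, reproduced up to
    O(u) because [g] overshoots -1, 0 and 1 by at most [u]. *)
Lemma tent_count_bounds :
  1 - 5 * u <= u * ((cnt (floor_gap R v d k) a c)%:R + 2 * k%:R) /\
  l * ((cnt (floor_gap R v d k) a c)%:R - 2 * k%:R) <= 1 + 4 * u.
Proof.
have u0 : 0 < u by exact: lt_le_trans lu.
have u1' := u1; have l0' := l0; have lu' := lu.
have -> : (cnt (floor_gap R v d k) a c)%:R =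
    \sum_(a <= m < b) (floor_gap R v d k m)%:R + \sum_(b <= m < c) (floor_gap R v d k m)%:R :> R.
  by rewrite /cnt natr_sum (big_cat_nat ab bc).
have -> : \sum_(b <= m < c) (floor_gap R v d k m)%:R =
  \sum_(b <= m < c) (1 - 1 * g m) + \sum_(b <= m < c) (fr (m + k)%N - fr m) :> R.
  rewrite -big_split [LHS]big_nat [RHS]big_nat; apply: eq_bigr => m bm.
  have [h _] := floor_gapE R v d k m; rewrite (h (gpos m bm)).
  by rewrite /g /fr /=; ring.
have -> : \sum_(a <= m < b) (floor_gap R v d k m)%:R =
  \sum_(a <= m < b) (1 - (-1) * g m) - \sum_(a <= m < b) (fr (m + k)%N - fr m) :> R.
  rewrite -sumrB [LHS]big_nat [RHS]big_nat; apply: eq_bigr => m bm.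
  have [_ [h _]] := floor_gapE R v d k m; rewrite (h (gneg m bm)).
  by rewrite /g /fr /=; ring.
have := telescope_shift_le R fr k b c bc fr01.
have := telescope_shift_le R fr k a b ab fr01.
move: (\sum_(a <= m < b) (fr _ - _)) (\sum_(b <= m < c) (fr _ - _)) => f1 f2.
rewrite !ler_norml => /andP[f11 f12] /andP[f21 f22].
have [|||p1 p2] := weight_sum_bounds R g 1 l u b c bc l0.
- by rewrite lexx andbT; lra.
- by move=> m /andP[bm mc]; apply: gstep; rewrite mc (leq_trans ab bm).
- by move=> m bm; have /andP[h1 h2] := gpos m bm; lra.
have [|||n1 n2] := weight_sum_bounds R g (-1) l u a b ab l0.
- by rewrite lexx /=; lra.
- by move=> m /andP[am mb]; apply: gstep; rewrite am (leq_trans mb bc).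
- by move=> m bm; have /andP[h1 h2] := gneg m bm; lra.
move: p1 p2 n1 n2; move: (\sum_(a <= m < b) (1 - _)) (\sum_(b <= m < c) (1 - _)) => S1 S2.
move: gb ga gc => /andP[]; move: (g a) (g b) (g c) => A B C B1 B2 /andP[A1 A2] /andP[C1 C2].
have uu : u * u <= u by rewrite ler_piMr// ltW.
have uu0 : 0 <= u * u by rewrite mulr_ge0// ltW.
have c1 : 0 <= (C - 1) * (C - 1) by rewrite mulr_ge0; lra.
have c2 : (C - 1) * (C - 1) <= u * u by apply: ler_pM; lra.
have b1 : 0 <= B * B by rewrite mulr_ge0; lra.
have b2 : B * B <= u * B by apply: ler_wpM2r; lra.
have b3 : u * B <= B by rewrite ler_piMl.
have a1 : 0 <= (A + 1) * (A + 1) by rewrite mulr_ge0; lra.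
have a2 : (A + 1) * (A + 1) <= u * u by apply: ler_pM; lra.
have cb : u * (C - B) <= u * (1 + u) by apply: ler_wpM2l; lra.
have ba : u * (B - A) <= u * (1 + u) by apply: ler_wpM2l; lra.
have q1 : u * f1 <= u * k%:R by apply: ler_wpM2l; [exact: ltW|].
have q2 : u * - f2 <= u * k%:R by apply: ler_wpM2l; [exact: ltW|lra].
have q3 : l * f2 <= l * k%:R by apply: ler_wpM2l; [exact: ltW|].
have q4 : l * - f1 <= l * k%:R by apply: ler_wpM2l; [exact: ltW|lra].
move=> p1 p2 n1 n2; split; lra.
Qed.

End tent_count.

Lemma cvg_natr_powRN (R : realType) (e : R) : 0 < e ->
  d%:R `^ (- e) @[d --> \oo] --> (0 : R).
Proof.
move=> e0; apply/cvgrPdist_le => eps eps0.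
have [D1 D11 HD] := powR_eventually_ge R eps^-1 e e0.
near=> d.
have dD : D1 <= d%:R by near: d; exact: nbhs_infty_ger.
rewrite sub0r normrN ger0_norm ?powR_ge0// powRN.
rewrite -[leRHS]invrK lef_pV2 ?posrE ?invr_gt0//; first exact: HD.
by rewrite powR_gt0//; lra.
Unshelve. all: by end_near. Qed.

Lemma cvg_powR (R : realType) (f : nat -> R) (x e : R) : 0 < x ->
  f n @[n --> \oo] --> x -> (f n) `^ e @[n --> \oo] --> x `^ e.
Proof.
move=> x0 fx; apply: (@continuous_cvg _ _ _ (\oo) _ f (fun z => z `^ e) x) => //.
apply: differentiable_continuous; apply/derivable1_diffP.
by have [] := is_derive1_powR e x0.
Qed.

Lemma cnt_stable (P : nat -> bool) A B B' : (A <= B)%N -> (B <= B')%N ->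
  (forall m, (B <= m)%N -> ~~ P m) -> cnt P A B' = cnt P A B.
Proof.
move=> AB BB nP; rewrite /cnt (big_cat_nat AB BB)/= [X in (_ + X)%N]big_nat.
by rewrite [X in (_ + X)%N]big1 ?addn0// => m /andP[Bm _]; rewrite (negbTE (nP m Bm)).
Qed.

Definition is_sol (R : realType) (alpha : R) (d k m : nat) : bool :=
  (0 < m)%N && floor_gap R (fun m => m%:R `^ alpha) d k m.

Section main_term.
Variables (R : realType) (alpha : R).
Hypothesis alpha1 : 1 < alpha.
Hypothesis alpha2 : alpha < 2.
Let p := alpha - 1.
Let beta := p^-1.
Let p0 : 0 < p. Proof. by rewrite subr_gt0. Qed.
Let p1 : p < 1. Proof. by rewrite ltrBlDr. Qed.
Let beta0 : 0 < beta. Proof. by rewrite invr_gt0. Qed.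
Let alpha0 : 0 < alpha. Proof. exact: lt_trans alpha1. Qed.

Lemma is_solP d k m : is_sol R alpha d k m ->
  (0 < m)%N /\ `|Gk R alpha k%:R m%:R - d%:R| < 1.
Proof.
move=> /andP[m0 fe]; split => //.
have [_ [_ h]] := floor_gapE R (fun m => m%:R `^ alpha) d k m.
by rewrite /Gk -natrD ltr_norml; exact: h.
Qed.

(** Unlike [powR_diff_ge] this keeps the factor alpha, which the limit constant needs: with it [lo]
    and [up] below are asymptotically equal. *)
Lemma powR_diff_ge_left (x y : R) : 0 < x -> x <= y ->
  alpha * x `^ p * (y - x) <= y `^ alpha - x `^ alpha.
Proof.
move=> x0; rewrite le_eqVlt => /orP[/eqP ->|xy]; first by rewrite !subrr mulr0.
have [c /andP[xc cy] ->] := powR_mvt R alpha x y x0 xy.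
rewrite ler_wpM2r ?subr_ge0 ?(ltW xy)// ler_wpM2l ?(ltW alpha0)//.
exact: (ler_powRl R _ _ _ (ltW p0) (ltW x0) (ltW xc)).
Qed.

Lemma Gk_step (k x : R) : 0 < k -> 0 < x ->
  alpha * p * k * (x + 1 + k) `^ (p - 1) <= Gk R alpha k (x + 1) - Gk R alpha k x
    <= alpha * p * k * x `^ (p - 1).
Proof.
move=> k0 x0; have x1 : x < x + 1 by rewrite ltrDl.
have pn : p - 1 <= 0 by rewrite subr_le0 ltW.
have [|c /andP[xc cx'] ->] := MVT_le R (Gk R alpha k) (fun z => alpha * ((z + k) `^ p - z `^ p)) x (x + 1) x1.
  by move=> z /andP[xz _]; apply: is_derive_Gk => //; lra.
have c0 : 0 < c by lra.
have -> : x + 1 - x = 1 by ring.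
have pp : 0 <= p <= 1 by rewrite !ltW.
have ck : c <= c + k by lra.
have /andP[h1 h2] := powR_diff_le_concave R p c (c + k) pp c0 ck.
have ckE : c + k - c = k by ring.
rewrite ckE in h1 h2; rewrite mulr1 -!mulrA.
have xk : c + k <= x + 1 + k by lra.
have ck0 : 0 < c + k by lra.
have h3 := ler_powRN R _ _ _ pn ck0 xk.
have h4 := ler_powRN R _ _ _ pn x0 (ltW xc).
apply/andP; split; apply: ler_wpM2l => //; try exact: ltW.
  apply: le_trans h1; rewrite -mulrA; apply: ler_wpM2l; first exact: ltW.
  by rewrite mulrC; apply: ler_wpM2r => //; exact: ltW.
apply: (le_trans h2); rewrite -mulrA; apply: ler_wpM2l; first exact: ltW.
by rewrite mulrC; apply: ler_wpM2l => //; exact: ltW.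
Qed.

Let Ep (d k : nat) : R := ((d%:R + 1) / (alpha * k%:R)) `^ beta.
Let Em (d k : nat) : R := ((d%:R - 1) / (alpha * k%:R)) `^ beta.
Let lo (d k : nat) : R := alpha * p * k%:R * (Ep d k + (1 + k%:R)) `^ (p - 1).
Let up (d k : nat) : R := alpha * p * k%:R * (Em d k - (1 + k%:R)) `^ (p - 1).

(** Where |g| <= 1, the bounds alpha k m^p <= Gk k m <= alpha k (m + k)^p confine m, so the steps of
    g lie between [lo] and [up], which depend on [d] and [k] only. The indices a, b, c of the tent
    are the first at which g exceeds -1, 0, 1. *)
Lemma sol_cnt_bounds d k B : (0 < k)%N -> (0 < d)%N ->
  0 < Em d k - (1 + k%:R) -> up d k <= 1 -> Gk R alpha k%:R 1 <= d%:R - 1 ->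
  (forall m, is_sol R alpha d k m -> (m < B)%N) ->
  1 - 5 * up d k <= up d k * ((cnt (is_sol R alpha d k) 0 B)%:R + 2 * k%:R) /\
  lo d k * ((cnt (is_sol R alpha d k) 0 B)%:R - 2 * k%:R) <= 1 + 4 * up d k.
Proof.
move=> k0 d0 E0 u1 G1 solB.
have k0R : 0 < k%:R :> R by rewrite ltr0n.
have d1 : 1 <= d%:R :> R by rewrite ler1n.
have ak0 : 0 < alpha * k%:R by rewrite mulr_gt0.
have apk0 : 0 < alpha * p * k%:R by rewrite mulr_gt0// mulr_gt0.
have pn : p - 1 <= 0 by rewrite subr_le0 ltW.
have l0 : 0 < lo d k.
  apply: mulr_gt0 => //; apply: powR_gt0; rewrite ltr_wpDl ?powR_ge0//; lra.
pose G m := Gk R alpha k%:R m%:R.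
pose g (m : nat) := G m - d%:R.
have pwK (x : R) : 0 <= x -> (x `^ p) `^ beta = x.
  by move=> x0; rewrite -powRrM mulfV ?gt_eqF// powRr1.
have step m : (0 < m)%N -> g m <= 1 -> -1 <= g m.+1 -> lo d k <= g m.+1 - g m <= up d k.
  move=> m0 gm gm1; have m0R : 0 < m%:R :> R by rewrite ltr0n.
  have := Gk_step k%:R m%:R k0R m0R.
  have -> : g m.+1 - g m = Gk R alpha k%:R (m%:R + 1) - Gk R alpha k%:R m%:R.
    by rewrite /g /G natr1; ring.
  move=> /andP[h1 h2].
  have mE : m%:R <= Ep d k.
    rewrite -(pwK m%:R (ltW m0R)); apply: ler_powRl; rewrite ?powR_ge0 ?(ltW beta0)//.
    have mk : m%:R <= m%:R + k%:R :> R by rewrite lerDl ltW.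
    have := powR_diff_ge_left _ _ m0R mk; rewrite -/(Gk _ _ _ _) addrAC subrr add0r => h3.
    rewrite ler_pdivlMr// mulrC mulrAC; apply: (le_trans h3).
    by move: gm; rewrite /g /G; lra.
  have Em' : Em d k <= m%:R + 1 + k%:R.
    have m1 : 0 < m%:R + 1 :> R by lra.
    have := Gk_le R alpha alpha1 k%:R (m%:R + 1) m1 (ltW k0R).
    rewrite -/p => h3.
    rewrite -(pwK (m%:R + 1 + k%:R)); last lra.
    apply: ler_powRl; rewrite ?(ltW beta0)//.
      by apply: divr_ge0; [lra|exact: ltW].
    rewrite ler_pdivrMr// mulrC; apply: le_trans h3.
    by move: gm1; rewrite /g /G -natr1; lra.
  apply/andP; split.
    apply: le_trans h1; apply: ler_wpM2l; first exact: ltW.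
    by apply: ler_powRN => //; lra.
  apply: (le_trans h2); apply: ler_wpM2l; first exact: ltW.
  by apply: ler_powRN => //; lra.
have gmono m m' : (0 < m)%N -> (m <= m')%N -> g m <= g m'.
  move=> m0 /subnK <-; elim: (m' - m)%N => [//|n IH].
  apply: (le_trans IH); have n0 : 0 < (n + m)%:R :> R by rewrite ltr0n addn_gt0 m0 orbT.
  have /andP[h _] := Gk_step k%:R _ k0R n0.
  have -> : g (n.+1 + m)%N = Gk R alpha k%:R ((n + m)%:R + 1) - d%:R by rewrite /g /G natr1.
  rewrite /g /G lerD2r -subr_ge0; apply: le_trans h; apply: mulr_ge0; [exact: ltW|exact: powR_ge0].
have ex x : exists m, (0 < m)%N && (x < g m).
  exists (Num.truncn (((`|x| + d%:R) / k%:R) `^ beta)).+1 => /=.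
  set m := (Num.truncn _).+1.
  have hm : ((`|x| + d%:R) / k%:R) `^ beta < m%:R by exact: truncnS_gt.
  have hx : (`|x| + d%:R) / k%:R < (m%:R + k%:R) `^ p.
    have y0 : 0 <= (`|x| + d%:R) / k%:R by apply: divr_ge0; [exact: addr_ge0|exact: ltW].
    have -> : (`|x| + d%:R) / k%:R = (((`|x| + d%:R) / k%:R) `^ beta) `^ p.
      by rewrite -powRrM mulVf ?gt_eqF// powRr1.
    apply: gt0_ltr_powR => //; rewrite ?nnegrE ?powR_ge0 ?addr_ge0//.
    by apply: (lt_le_trans hm); rewrite lerDl ltW.
  have := Gk_ge R alpha alpha1 k%:R m%:R (ler0n _ _) (ltW k0R); rewrite -/p.
  move: hx; rewrite ltr_pdivrMr// mulrC => hx h.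
  have := ler_norm x; rewrite /g /G; lra.
have g1 : g 1%N <= -1 by rewrite /g /G; lra.
have gE m : (fun m : nat => m%:R `^ alpha : R) (m + k)%N - m%:R `^ alpha - d%:R = g m.
  by rewrite /g /G /Gk natrD.
have solg m : is_sol R alpha d k m -> (0 < m)%N /\ -1 < g m < 1.
  by move=> /is_solP[m0]; rewrite ltr_norml.
clearbody g; clear E0 G1; move: (up d k) (lo d k) u1 l0 step => U l u1 l0 step.
(* The minimal index exceeds 1 because g 1 <= -1. Its predecessor is thus positive and has g at most
   x, so g overshoots x by at most one step. *)
have minP x : -1 <= x -> exists m, [/\ (1 < m)%N, x < g m, g m.-1 <= x &
    forall n, (0 < n)%N -> x < g n -> (m <= n)%N].
  move=> x1; case: (ex_minnP (ex x)) => m /andP[m0 xm] mmin; exists m.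
  have m1 : (1 < m)%N.
    rewrite ltn_neqAle m0 andbT; apply/eqP => m1; move: xm; rewrite -m1.
    by rewrite ltNge (le_trans g1).
  split => //.
    rewrite leNgt; apply/negP => h.
    have : (m <= m.-1)%N by apply: mmin; rewrite h andbT -ltnS prednK.
    by case: (m) m0 => // n _; rewrite /= ltnn.
  by move=> n n0 xn; apply: mmin; rewrite n0 xn.
have jump m x : (1 < m)%N -> -1 <= x <= 1 -> x < g m -> g m.-1 <= x -> g m <= x + U.
  move=> m1 /andP[x1 x2] xm mx; have m0 : (0 < m.-1)%N by rewrite -ltnS prednK// ltnW.
  have := step m.-1 m0; rewrite prednK ?(ltnW m1)// => /(_ (le_trans mx x2)).
  by move=> /(_ (ltW (le_lt_trans x1 xm)))/andP[_ h]; lra.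
have [a [a1 ga ga' amin]] := minP (-1) (lexx _).
have [b [b1 gb gb' bmin]] := minP 0 (ltac:(lra)).
have [c [c1 gc gc' cmin]] := minP 1 (ltac:(lra)).
have ab : (a <= b)%N by apply: amin; [exact: ltnW|lra].
have bc : (b <= c)%N by apply: bmin; [exact: ltnW|lra].
have below m x y : (0 < m)%N -> (m < y)%N ->
    (forall n, (0 < n)%N -> x < g n -> (y <= n)%N) -> g m <= x.
  by move=> m0 my h; rewrite leNgt; apply/negP => /(h m m0); rewrite leqNgt my.
have lu : l <= U.
  have := step b.-1; rewrite prednK ?(ltnW b1)// => h.
  have /andP[h1 h2] : l <= g b - g b.-1 <= U.
    by apply: h; [rewrite -ltnS prednK// ltnW|lra|lra].
  exact: le_trans h1 h2.
have cE : cnt (is_sol R alpha d k) 0 B = cnt (floor_gap R (fun m => m%:R `^ alpha) d k) a c.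
  have -> : cnt (is_sol R alpha d k) 0 B = cnt (is_sol R alpha d k) 0 c.
    have [Bc|/ltnW cB] := leqP B c.
      rewrite (@cnt_stable _ 0 B c)// => m Bm; apply/negP => /solB.
      by rewrite ltnNge Bm.
    apply: cnt_stable => // m cm; apply/negP => /solg[m0 /andP[_]].
    by apply/negP; rewrite -leNgt; apply: (le_trans (ltW gc)); apply: gmono => //; exact: ltnW.
  have ac := leq_trans ab bc.
  rewrite /cnt (big_cat_nat (leq0n a) ac)/= [X in (X + _)%N]big_nat.
  rewrite [X in (X + _)%N]big1; last first.
    move=> m /andP[_ ma]; apply/eqP; rewrite eqb0; apply/negP => /solg[m0 /andP[h _]].
    by have := below m _ _ m0 ma amin; rewrite leNgt h.
  rewrite add0n big_nat [RHS]big_nat; apply: eq_bigr => m /andP[am _].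
  by rewrite /is_sol (leq_trans _ am)// ltnW.
rewrite cE.
apply: (@tent_count_bounds R (fun m => m%:R `^ alpha) d k a b c) => //.
- move=> m /andP[am mc]; rewrite !gE; have m0 : (0 < m)%N by apply: leq_trans am; exact: ltnW.
  apply: step => //; first exact: (below m 1 c).
  have : g a <= g m.+1 by apply: gmono; [exact: ltnW|exact: leqW].
  lra.
- move=> m /andP[am mb]; rewrite gE; have m0 : (0 < m)%N by apply: leq_trans am; exact: ltnW.
  rewrite (below m 0 b)// andbT; apply: (le_trans (ltW ga)); apply: gmono => //; exact: ltnW.
- move=> m /andP[bm mc]; rewrite gE; have m0 : (0 < m)%N by apply: leq_trans bm; exact: ltnW.
  rewrite (below m 1 c)// andbT; apply: (le_trans (ltW gb)); apply: gmono => //; exact: ltnW.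
- by rewrite gE (ltW ga)/=; apply: jump => //; lra.
- by rewrite gE (ltW gb)/= -[leRHS]add0r; apply: jump => //; lra.
by rewrite gE (ltW gc)/=; apply: jump => //; lra.
Qed.

End main_term.

Section main_term_limit.
Variables (R : realType) (alpha : R).
Hypothesis alpha1 : 1 < alpha.
Hypothesis alpha2 : alpha < 2.
Let p := alpha - 1.
Let beta := p^-1.
Let p0 : 0 < p. Proof. by rewrite subr_gt0. Qed.
Let p1 : p < 1. Proof. by rewrite ltrBlDr. Qed.
Let beta0 : 0 < beta. Proof. by rewrite invr_gt0. Qed.
Let beta1 : 1 < beta. Proof. by rewrite invf_gt1. Qed.
Let alpha0 : 0 < alpha. Proof. exact: lt_trans alpha1. Qed.

(** Both [lo] and [up] are asymptotic to [om] d^(1 - beta), so the two inequalities of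
    [sol_cnt_bounds] squeeze the quotient to 1 / [om]. The errors 2 k disappear because k is fixed
    and beta > 1. *)
Lemma main_term_cvg (k : nat) (B : nat -> nat) : (0 < k)%N ->
  (forall d m, (0 < d)%N -> is_sol R alpha d k m -> (m < B d)%N) ->
  (cnt (is_sol R alpha d k) 0 (B d))%:R / d%:R `^ (beta - 1) @[d --> \oo]
    --> beta * alpha `^ (- beta) * k%:R `^ (- beta).
Proof.
move=> k0 solB.
have k0R : 0 < k%:R :> R by rewrite ltr0n.
have ak0 : 0 < alpha * k%:R by rewrite mulr_gt0.
have bp : beta * p = 1 by rewrite mulVf// gt_eqF.
pose n (d : nat) : R := d%:R `^ (- (beta - 1)).
have n0 : n d @[d --> \oo] --> (0 : R) by apply: cvg_natr_powRN; rewrite subr_gt0.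
(* d^beta X is the base of the power in [up] for s = -1 and in [lo] for s = 1. *)
pose X (s : R) (d : nat) : R :=
  ((1 + s * d%:R `^ (- 1)) / (alpha * k%:R)) `^ beta + s * (1 + k%:R) * d%:R `^ (- beta).
pose x0 := (1 / (alpha * k%:R)) `^ beta.
have x00 : 0 < x0 by rewrite powR_gt0// divr_gt0.
have Xcvg s : X s d @[d --> \oo] --> x0.
  have -> : x0 = ((1 + s * 0) / (alpha * k%:R)) `^ beta + s * (1 + k%:R) * 0.
    by rewrite !mulr0 !addr0.
  apply: cvgD; last by apply: cvgMr; exact: cvg_natr_powRN.
  apply: cvg_powR; first by rewrite mulr0 addr0 divr_gt0.
  apply: cvgMl; apply: cvgD; first exact: cvg_cst.
  by apply: cvgMr; exact: cvg_natr_powRN.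
pose w (s : R) d : R := alpha * p * k%:R * (X s d) `^ (p - 1).
pose om := alpha * p * k%:R * x0 `^ (p - 1).
have om0 : 0 < om by rewrite /om !mulr_gt0// powR_gt0.
have wcvg s : w s d @[d --> \oo] --> om.
  by apply: cvgMr; apply: cvg_powR.
have omE : om^-1 = beta * alpha `^ (- beta) * k%:R `^ (- beta).
  rewrite /om; have -> : x0 `^ (p - 1) = (alpha * k%:R) `^ beta / (alpha * k%:R).
    rewrite /x0 div1r -powRrM -(powR_inv1 (ltW ak0)) -powRrM.
    have -> : -1 * (beta * (p - 1)) = beta - 1.
      by transitivity (- (beta * p) + beta); [ring|rewrite bp; ring].
    by rewrite powRB ?powRr1 ?(powR_inv1 (ltW ak0)) ?(ltW ak0)// gt_eqF ?implybT.
  rewrite powRM ?(ltW alpha0) ?(ltW k0R)// !powRN.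
  have a1 : alpha `^ beta != 0 by rewrite gt_eqF// powR_gt0.
  have k1 : k%:R `^ beta != 0 :> R by rewrite gt_eqF// powR_gt0.
  have a2 : alpha != 0 by rewrite gt_eqF.
  have k2 : k%:R != 0 :> R by rewrite gt_eqF.
  have p2 : p != 0 by rewrite gt_eqF.
  rewrite -/beta; move: (alpha `^ beta) (k%:R `^ beta) a1 k1 => u v u0 v0.
  by rewrite /beta; field; rewrite u0 v0 a2 k2 p2.
rewrite -omE.
pose lower d : R := (1 - 5 * (w (-1) d * n d)) / w (-1) d - 2 * k%:R * n d.
pose upper d : R := (1 + 4 * (w (-1) d * n d)) / w 1 d + 2 * k%:R * n d.
have wn : w (-1) d * n d @[d --> \oo] --> (0 : R).
  by rewrite -[X in _ --> X](mulr0 om); apply: cvgM.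
have lcvg : lower d @[d --> \oo] --> om^-1.
  have -> : om^-1 = (1 - 5 * 0) / om - 2 * k%:R * 0 by rewrite !mulr0 !subr0 div1r.
  apply: cvgB; last by apply: cvgMr.
  apply: cvgM; last by apply: cvgV; rewrite ?gt_eqF.
  by apply: cvgB; [exact: cvg_cst|apply: cvgMr].
have ucvg : upper d @[d --> \oo] --> om^-1.
  have -> : om^-1 = (1 + 4 * 0) / om + 2 * k%:R * 0 by rewrite !mulr0 !addr0 div1r.
  apply: cvgD; last by apply: cvgMr.
  apply: cvgM; last by apply: cvgV; rewrite ?gt_eqF.
  by apply: cvgD; [exact: cvg_cst|apply: cvgMr].
apply: (squeeze_cvgr _ lcvg ucvg).
near=> d.
have d0 : (0 < d)%N by near: d; exact: nbhs_infty_gt.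
have d0R : 0 < d%:R :> R by rewrite ltr0n.
have Xm : 0 < X (-1) d by near: d; apply: (cvgr_gt _ (Xcvg (-1))).
have Xp : 0 < X 1 d by near: d; apply: (cvgr_gt _ (Xcvg 1)).
have wm : 0 < w (-1) d by rewrite /w !mulr_gt0// powR_gt0.
have wp : 0 < w 1 d by rewrite /w !mulr_gt0// powR_gt0.
have db (s : R) : 0 <= 1 + s * d%:R `^ (- 1) -> 
    ((d%:R + s) / (alpha * k%:R)) `^ beta + s * (1 + k%:R) = d%:R `^ beta * X s d.
  move=> h; rewrite /X [RHS]mulrDr -powRM ?divr_ge0 ?(ltW ak0)//.
  rewrite (powR_inv1 (ltW d0R)) powRN; congr (_ `^ _ + _).
    by field; rewrite !gt_eqF.
  by field; rewrite gt_eqF// powR_gt0.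
have d1 : 0 <= 1 + (-1) * d%:R `^ (- 1) :> R.
  by rewrite (powR_inv1 (ltW d0R)) mulN1r subr_ge0 invf_le1// ler1n.
have d2 : 0 <= 1 + 1 * d%:R `^ (- 1) :> R.
  by rewrite mul1r addr_ge0// powR_ge0.
have pwn (s : R) : 0 < X s d ->
    alpha * p * k%:R * (d%:R `^ beta * X s d) `^ (p - 1) = w s d * n d.
  move=> Xs; rewrite powRM ?powR_ge0 ?(ltW Xs)// -powRrM /w /n.
  have -> : beta * (p - 1) = - (beta - 1).
    by transitivity (beta * p - beta); [ring|rewrite bp; ring].
  by rewrite [d%:R `^ _ * _]mulrC mulrA.
have e1 := db (-1) d1; have e2 := db 1 d2.
rewrite mulN1r in e1; rewrite mul1r in e2.
have solB' m : is_sol R alpha d k m -> (m < B d)%N by exact: solB.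
have [|||h1 h2] := sol_cnt_bounds R alpha alpha1 alpha2 d k (B d) k0 d0 _ _ _ solB'.
- by rewrite e1 mulr_gt0// powR_gt0.
- rewrite -/p -/beta e1 pwn//; apply: ltW; near: d.
  exact: (cvgr_lt _ wn _ ltr01).
- rewrite lerBrDl; near: d; exact: nbhs_infty_ger.
rewrite -/p -/beta e1 e2 !pwn// in h1 h2.
have nE : (d%:R `^ (beta - 1))^-1 = n d by rewrite /n powRN.
rewrite nE; set A : R := (cnt _ _ _)%:R in h1 h2 *.
have nd0 : 0 < n d by rewrite powR_gt0.
apply/andP; split.
  rewrite /lower lerBlDr ler_pdivrMr//.
  by apply: (le_trans h1); rewrite le_eqVlt; apply/orP; left; apply/eqP; ring.
rewrite /upper -lerBlDr ler_pdivlMr//.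
by apply: le_trans h2; rewrite le_eqVlt; apply/orP; left; apply/eqP; ring.
Unshelve. all: by end_near. Qed.

End main_term_limit.

(** * Uniform bounds for large k *)

Section rep_count.
Variables (R : realType) (alpha : R).
Hypothesis alpha1 : 1 < alpha.
Hypothesis alpha2 : alpha < 2.
Let p := alpha - 1.
Let beta := p^-1.
Let p0 : 0 < p. Proof. by rewrite subr_gt0. Qed.
Let beta0 : 0 < beta. Proof. by rewrite invr_gt0. Qed.
Let alpha0 : 0 < alpha. Proof. exact: lt_trans alpha1. Qed.

(** A common cutoff for m and k, so that sums over both can be exchanged. *)
Definition solB (d : nat) : nat := (Num.truncn ((d%:R + 1) `^ beta)).+1.

Lemma sol_le_powR d k m : (0 < k)%N -> is_sol R alpha d k m ->
  m%:R + k%:R <= ((d%:R + 1) / k%:R) `^ beta.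
Proof.
move=> k0 /is_solP[m0 h]; apply: Gk_le_bound => //; first by rewrite ltr0n.
by move: h; rewrite ltr_norml => /andP[h1 h2]; lra.
Qed.

Lemma sol_lt_solB d k m : (0 < k)%N -> is_sol R alpha d k m -> (m + k < solB d)%N.
Proof.
move=> k0 h; rewrite /solB ltnS.
have k1 : 1 <= k%:R :> R by rewrite ler1n.
have := sol_le_powR d k m k0 h; rewrite -natrD => h1.
rewrite truncn_ge_nat ?powR_ge0//; apply: (le_trans h1).
apply: ler_powRl; first exact: ltW.
  by apply: divr_ge0; [rewrite addr_ge0|lra].
by rewrite ler_pdivrMr; [rewrite ler_peMr// addr_ge0|lra].
Qed.

(** A pair (m, n) corresponds to (k, m) with k = n - m; k is positive because d > 0 and
    floor(n^alpha) is monotone in n. *)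
Lemma rep_countE d : (0 < d)%N ->
  rep_count alpha d = (\sum_(1 <= k < solB d) cnt (is_sol R alpha d k) 0 (solB d))%N.
Proof.
move=> d0; set B := solB d.
pose t := [seq (k, m) | k <- index_iota 1 B, m <- index_iota 0 B].
pose s := [seq (x.2, (x.2 + x.1)%N) | x <- [seq x <- t | is_sol R alpha d x.1 x.2]].
have -> : (\sum_(1 <= k < B) cnt (is_sol R alpha d k) 0 B)%N = size s.
  rewrite size_map size_filter -sum1_count [RHS]big_mkcond /t big_allpairs_dep /=.
  by apply: eq_bigr => k _; rewrite /cnt; apply: eq_bigr => m _; case: (is_sol _ _ _ _ _).
rewrite /rep_count; apply: perm_size; apply: uniq_perm.
- exact: fset_uniq.
- rewrite map_inj_uniq; last first.
    by move=> [k m] [k' m'] /= [-> /addnI ->].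
  by rewrite filter_uniq// allpairs_uniq ?iota_uniq// => -[? ?] [? ?] _ _ [-> ->].
move=> [m n].
rewrite in_fset_set; last exact: rep_set_finite.
apply/idP/idP.
  rewrite inE /rep_set /= => -[m0 n0 dE].
  have mn : (m < n)%N.
    rewrite ltnNge; apply/negP => nm.
    have : Num.floor (n%:R `^ alpha : R) <= Num.floor (m%:R `^ alpha : R).
      by apply: le_floor; apply: ler_powRl; rewrite ?(ltW alpha0)// ler_nat.
    by rewrite -subr_le0 -dE lez_nat leqn0 eqn0Ngt d0.
  have sl : is_sol R alpha d (n - m) m.
    rewrite /is_sol m0 /floor_gap subnKC ?(ltnW mn)//=; exact/eqP.
  have nm0 : (0 < n - m)%N by rewrite subn_gt0.
  have lB := sol_lt_solB d (n - m) m nm0 sl.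
  apply/mapP; exists ((n - m)%N, m); last by rewrite /= subnKC// ltnW.
  rewrite mem_filter /= sl /=; apply/allpairsP; exists ((n - m)%N, m) => /=.
  rewrite !mem_index_iota -/B in lB *.
  by split => //; [rewrite nm0 (leq_ltn_trans _ lB)// leq_addl|rewrite (leq_ltn_trans _ lB)// leq_addr].
move=> /mapP[[k m'] + [-> ->]]; rewrite mem_filter /= => /andP[/andP[m0 /eqP fe] _].
by rewrite inE /rep_set /=; split => //; rewrite addn_gt0 m0.
Qed.

Lemma sol_cnt_le d k B : (0 < k)%N ->
  (cnt (is_sol R alpha d k) 0 B)%:R <=
    1 + 2 / (alpha * p) * ((d%:R + 1) `^ (beta - 1) * k%:R `^ (- beta)).
Proof.
move=> k0; have k0R : 0 < k%:R :> R by rewrite ltr0n.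
have D0 : 0 < d%:R + 1 :> R by rewrite ltr_wpDl.
have e : 2 / (alpha * p) * ((d%:R + 1) `^ (beta - 1) * k%:R `^ (- beta)) =
    2 * 1 / (1%:R * (alpha * p * (k%:R `^ beta * (d%:R + 1) `^ (1 - beta)))).
  rewrite mul1r mulr1 !invfM -!powRN opprB.
  by rewrite [X in _ = _ * (_ * X)]mulrC mulrA -invfM.
rewrite e; apply: (@sep_cnt_le R _ 0 B 1 (fun m => Gk R alpha k%:R m%:R) d%:R) => //.
- by do ![apply: mulr_gt0]; rewrite ?powR_gt0.
- by move=> m m' _ mm' _ _ _; rewrite addn1.
- move=> m m' _ mm' _ sm sm'.
  have [m0 _] := is_solP R alpha d k m sm; have [_ h] := is_solP R alpha d k m' sm'.
  have GE : Gk R alpha k%:R m'%:R <= d%:R + 1.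
    by move: h; rewrite ltr_norml => /andP[h1 h2]; lra.
  have m0R : 0 < m%:R :> R by rewrite ltr0n.
  have mmR : m%:R <= m'%:R :> R by rewrite ler_nat ltnW.
  apply: le_trans (ler_norm _).
  exact: (Gk_sep R alpha alpha1 alpha2 k%:R m%:R m'%:R (d%:R + 1) m0R mmR k0R GE).
by move=> m _ /is_solP[_ /ltW].
Qed.

(** For fixed m the value (m + k)^alpha grows by at least 1 with k, and solutions lie in a window of
    length 2. This allows counting m instead of pairs. *)
Lemma sol_cnt_row_le d m B : (cnt (fun k => (0 < k)%N && is_sol R alpha d k m) 0 B <= 3)%N.
Proof.
rewrite -(ler_nat R).
have e : 3%:R = 1 + 2 * 1 / (1%:R * 1) :> R by rewrite !mulr1 divr1.
rewrite e; apply: (@sep_cnt_le R _ 0 B 1 (fun k => (m%:R + k%:R) `^ alpha - m%:R `^ alpha) d%:R) => //.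
- by move=> k k' _ kk' _ _ _; rewrite addn1.
- move=> k k' _ kk' _ /andP[k0 sk] _; rewrite mul1r.
  have [m0 _] := is_solP R alpha d k m sk.
  have m0R : 1 <= m%:R :> R by rewrite ler1n.
  have kkR : k%:R <= k'%:R :> R by rewrite ler_nat ltnW.
  have k0R : 0 <= k%:R :> R by [].
  apply: le_trans (ler_norm _).
  have mk : 0 <= m%:R + k%:R :> R by lra.
  have mkk : m%:R + k%:R <= m%:R + k'%:R :> R by lra.
  have := powR_diff_ge R alpha _ _ (ltW alpha1) mk mkk.
  have e1 : m%:R + k'%:R - (m%:R + k%:R) = k'%:R - k%:R :> R by ring.
  rewrite e1 => h.
  have e2 : (m%:R + k'%:R) `^ alpha - m%:R `^ alpha - ((m%:R + k%:R) `^ alpha - m%:R `^ alpha)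
    = (m%:R + k'%:R) `^ alpha - (m%:R + k%:R) `^ alpha :> R by ring.
  rewrite e2; apply: le_trans h; rewrite ler_peMr ?subr_ge0//.
  rewrite -[leLHS](powRr0 (m%:R + k'%:R)); apply: ler_powR; last exact: ltW.
  lra.
by move=> k _ /andP[_ /is_solP[_ /ltW]].
Qed.

End rep_count.

Lemma dyadic_cnt (P : nat -> bool) I : cnt P 1 (2 ^ I) =
  (\sum_(0 <= i < I) cnt P (2 ^ i) (2 ^ i + 2 ^ i))%N.
Proof.
elim: I => [|I IH]; first by rewrite /cnt expn0 !big_geq.
rewrite big_nat_recr//= -IH /cnt addnn -mul2n -expnS.
have h1 : (1 <= 2 ^ I)%N by rewrite expn_gt0.
have h2 : (2 ^ I <= 2 ^ I.+1)%N by rewrite leq_exp2l.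
by rewrite (big_cat_nat h1 h2).
Qed.

Lemma dyadic_range (R : realType) (x s : R) : 1 <= x -> 0 < s ->
  exists I : nat, x < (2 ^ I)%:R /\ I%:R <= 1 + x `^ s / (s * ln 2).
Proof.
move=> x1 s0; have x0 : 0 <= x by lra.
have t0 : (0 < Num.truncn x)%N by rewrite truncn_gt0.
exists (trunc_log 2 (Num.truncn x)).+1; split.
  apply: (lt_le_trans (truncnS_gt x)); rewrite ler_nat.
  exact: trunc_log_ltn.
have l2 : 0 < ln 2 :> R by rewrite ln_gt0// ltr1n.
rewrite -natr1 addrC lerD2l ler_pdivlMr ?mulr_gt0//.
have h1 : (2 ^ trunc_log 2 (Num.truncn x))%:R <= x.
  apply: (@le_trans _ _ (Num.truncn x)%:R); last by rewrite truncn_le.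
  by rewrite ler_nat trunc_logP.
have h2 : (trunc_log 2 (Num.truncn x))%:R * ln 2 <= ln x.
  rewrite mulr_natl -lnXn// -natrX ler_ln ?posrE ?ltr0n ?expn_gt0//; lra.
have xs0 : 0 < x `^ s by rewrite powR_gt0//; lra.
have := ln_sublinear xs0; rewrite ln_powR => h3.
rewrite mulrCA; apply: (@le_trans _ _ (s * ln x)); last exact: ltW.
by apply: ler_wpM2l => //; exact: ltW.
Qed.

Lemma cnt_le_bound (R : realType) (x : R) B : 0 <= x ->
  (cnt (fun k => k%:R <= x) 1 B)%:R <= x.
Proof.
move=> x0; have := @sep_cnt_int_le R (fun k => k%:R <= x) 1 B 1 (fun k => k%:R) 1 0 x.
rewrite mulr0 mul0r addr0 mulr1; apply => //.
- by move=> m m' _ mm' _ _ _; rewrite addn1.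
- by move=> m m' _ mm' _ _ _; rewrite mul1r ler_norm.
- by move=> m /andP[m1 _] mx; exists m; split => //; rewrite subrr normr0.
Qed.

(** The number of blocks is logarithmic in [y], hence below a small power. The block bound is
    requested only with a point of [P] in the block, from which bounds on 2^i can be read off. *)
Lemma cnt_dyadic_le (R : realType) (P : nat -> bool) (y s X : R) B :
  1 <= y -> 0 < s -> 0 <= X -> (forall k, P k -> k%:R <= y) ->
  (forall i k, (2 ^ i <= k < 2 ^ i + 2 ^ i)%N -> P k ->
     (cnt P (2 ^ i) (2 ^ i + 2 ^ i))%:R <= X) ->
  (cnt P 1 B)%:R <= (1 + y `^ s / (s * ln 2)) * X.
Proof.
move=> y1 s0 X0 Py blk; have [I [yI HI]] := dyadic_range R y s y1 s0.
have PI m : (2 ^ I <= m)%N -> ~~ P m.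
  move=> Im; apply/negP => /Py my.
  have : (2 ^ I)%:R <= y by apply: le_trans my; rewrite ler_nat.
  by rewrite leNgt yI.
have h1 : (cnt P 1 B <= cnt P 1 (2 ^ I))%N.
  have I0 : (1 <= 2 ^ I)%N by rewrite expn_gt0.
  have [BI|/ltnW IB] := leqP B (2 ^ I); last by rewrite (cnt_stable P 1 (2 ^ I) B).
  have [B1|B1] := leqP B 1; first by rewrite /cnt big_geq.
  by rewrite /cnt (big_cat_nat (ltnW B1) BI) leq_addr.
apply: (@le_trans _ _ (I%:R * X)); last by rewrite ler_wpM2r.
apply: (@le_trans _ _ (cnt P 1 (2 ^ I))%:R); first by rewrite ler_nat.
rewrite dyadic_cnt natr_sum mulr_natl -[I in X in _ <= X]subn0 -sumr_const_nat.
apply: ler_sum => i _.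
have [->//|[m0 [m1 [Am0 /andP[m01 m1B] Pm0 _ _]]]] : _ := cnt_span P (2 ^ i) (2 ^ i + 2 ^ i) 1
  (ltac:(by move=> m m' _ mm' _ _ _; rewrite addn1)).
by apply: (blk i m0) => //; rewrite Am0 (leq_ltn_trans m01).
Qed.

Section tail.
Variables (R : realType) (alpha : R).
Hypothesis alpha1 : 1 < alpha.
Hypothesis alpha2 : alpha < 2.
Let p := alpha - 1.
Let beta := p^-1.
Hypothesis beta_gt : betas R < beta.
Let p0 : 0 < p. Proof. by rewrite subr_gt0. Qed.
Let beta0 : 0 < beta. Proof. by rewrite invr_gt0. Qed.
Let alpha0 : 0 < alpha. Proof. exact: lt_trans alpha1. Qed.
Let eta := beta - betas R.
Let eta0 : 0 < eta. Proof. by rewrite subr_gt0. Qed.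
Let tau := beta - 1 - eta / 50.
Let tau2 := beta - 1 - eta / 100.
Let tau0 : 0 < tau.
Proof. by have /andP[h1 _] := betas_bounds R; have := beta_gt; rewrite /tau /eta; lra. Qed.
Let tau2E : tau2 = tau + eta / 100. Proof. by rewrite /tau2 /tau; field. Qed.
(** By [sol_cnt_le] a value k costs at most 1 beyond its share of the zeta tail, so in this range it
    is enough to count the k that have a solution. *)
Definition middleP (d k : nat) : bool :=
  [&& d%:R `^ tau2 < k%:R, k%:R <= d%:R `^ kappa1 R &
      has (is_sol R alpha d k) (iota 0 (solB R alpha d))].

(** Here m is counted instead of k. The m up to d^tau2 are left out since they are few enough. *)
Definition largeP (d m : nat) : bool :=
  (d%:R `^ tau2 < m%:R) &&
  has (fun k => (d%:R `^ kappa1 R < k%:R) && is_sol R alpha d k m) (iota 0 (solB R alpha d)).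

(** The block of k starts above k / 2; the factor 2 is absorbed by the distance from tau to tau2. *)
Lemma dyadic_lower (D : R) (i k : nat) : 1 < D -> 2 <= D `^ (eta / 100) ->
  (k < 2 ^ i + 2 ^ i)%N -> D `^ tau2 < k%:R -> D `^ tau <= (2 ^ i)%:R.
Proof.
move=> D1 D2; rewrite -(ltr_nat R) natrD => kD Dk.
have : 2 * D `^ tau <= D `^ tau2.
  rewrite tau2E (powRDD R D D1 tau (eta / 100)) [leLHS]mulrC.
  by apply: ler_wpM2l => //; exact: powR_ge0.
lra.
Qed.

Lemma middle_cnt_le : exists C D1 : R, [/\ 0 <= C, 1 <= D1 & forall d B : nat, D1 <= d%:R ->
  (cnt (middleP d) 1 B)%:R <= C * d%:R `^ tau2].
Proof.
have e100 : 0 < eta / 100 by exact: divr_gt0 eta0 (ltr0Sn R 99).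
(* A fifth of tau2 - tau: four shares pay for the harmonic sum, one for the number of blocks, of
   order D^(kappa1 s) with kappa1 < 1. *)
have s0 : 0 < eta / 100 / 5 by exact: divr_gt0 e100 (ltr0Sn R 4).
have [C [D1 [C0 D11 H]]] := block3_asymptotic R alpha alpha1 alpha2 beta_gt _ s0.
have [D2 D21 H2] := powR_eventually_ge R 2 (eta / 100) e100.
have l2 : 0 < ln 2 :> R by rewrite ln_gt0// ltr1n.
set s := eta / 100 / 5 in s0 H *.
pose c := 1 + (s * ln 2)^-1.
have c0 : 0 <= c by rewrite addr_ge0// invr_ge0 mulr_ge0// ltW.
have /andP[k1 k2] := kappa1_bounds R.
exists (c * C), (D1 + D2); split; [exact: mulr_ge0|lra|].
move=> d B dD; set D : R := d%:R in dD *.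
have Dgt : 1 < D by lra.
have DD2 : 2 <= D `^ (eta / 100) by apply: H2; lra.
have y1 : 1 <= D `^ kappa1 R.
  by rewrite -[leLHS](powRr0 D) powR_le_exp//; lra.
have X0 : 0 <= C * D `^ (tau + 4 * s) by rewrite mulr_ge0// powR_ge0.
have hb := @cnt_dyadic_le R (middleP d) (D `^ kappa1 R) s _ B y1 s0 X0.
apply: (le_trans (hb _ _)).
- by move=> k /and3P[].
- move=> i k /andP[ik ki] /and3P[kt ku _].
  have lowi := dyadic_lower D i k Dgt DD2 ki kt.
  (* One solution m is selected for each k; as the list is [iota 0 _], the position returned by
     [find] is m itself. *)
  apply: (H D _ (2 ^ i)%N (middleP d) (fun k => find (is_sol R alpha d k) (iota 0 (solB R alpha d)))) => //.
  + lra.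
  + by rewrite expn_gt0.
  + by apply: le_trans ku; rewrite ler_nat.
  move=> k' _ /and3P[_ _ hk'].
  have := nth_find 0%N hk'; move: (hk'); rewrite has_find size_iota => fl.
  rewrite nth_iota// add0n => /is_solP[f0 fG]; split => //.
  exact: ltW.
rewrite -powRrM.
have e1 : 1 + D `^ (kappa1 R * s) / (s * ln 2) <= c * D `^ (kappa1 R * s).
  have q1 : 1 <= D `^ (kappa1 R * s).
    by rewrite -[leLHS](powRr0 D) powR_le_exp// mulr_ge0//; [lra|exact: ltW].
  by rewrite /c [leRHS]mulrDl mul1r [_^-1 * _]mulrC lerD2r.
apply: (le_trans (ler_wpM2r X0 e1)).
have -> : c * D `^ (kappa1 R * s) * (C * D `^ (tau + 4 * s)) =
  c * C * D `^ (kappa1 R * s + (tau + 4 * s)).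
  by rewrite (powRDD R D Dgt (kappa1 R * s)); ring.
apply: pmul_powR_le => //; first exact: mulr_ge0.
have ks : kappa1 R * s <= s by rewrite ler_piMl; lra.
have e5 : eta / 100 = 5 * s by rewrite /s; field.
rewrite tau2E e5; lra.
Qed.

Lemma large_cnt_le : exists C D1 : R, [/\ 0 <= C, 1 <= D1 & forall d B : nat, D1 <= d%:R ->
  (cnt (largeP d) 1 B)%:R <= C * d%:R `^ tau2].
Proof.
have /andP[k1 k2] := kappa1_bounds R.
have mu0 : 0 < mu1 R beta.
  rewrite /mu1 addr_gt0//; last by rewrite divr_gt0.
  by rewrite mulr_gt0//; lra.
have e100 : 0 < eta / 100 by exact: divr_gt0 eta0 (ltr0Sn R 99).
(* Chosen so that the number of blocks, D^(mu1 s), and the harmonic factor D^(tau s) together cost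
   exactly D^(eta / 100). *)
have s0 : 0 < eta / 100 / (tau + mu1 R beta).
  by rewrite divr_gt0// addr_gt0.
have [C [D1 [C0 D11 H]]] := block2_asymptotic R alpha alpha1 alpha2 beta_gt _ s0.
(* The 2 is for [dyadic_lower]; 2^beta arises from d + 1 <= 2 d in the upper bound for m. *)
have [D2 D21 H2] := powR_eventually_ge R (2 + 2 `^ beta) (eta / 100) e100.
have l2 : 0 < ln 2 :> R by rewrite ln_gt0// ltr1n.
set s := eta / 100 / _ in s0 H *.
pose c := 1 + (s * ln 2)^-1.
have c0 : 0 <= c by rewrite addr_ge0// invr_ge0 mulr_ge0// ltW.
exists (c * C), (D1 + D2); split; [exact: mulr_ge0|lra|].
move=> d B dD; set D : R := d%:R in dD *.
have Dgt : 1 < D by lra.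
have D0 : 0 < D by lra.
have b20 : 0 <= 2 `^ beta :> R by exact: powR_ge0.
have DD : 2 + 2 `^ beta <= D `^ (eta / 100) by apply: H2; lra.
have DD2 : 2 <= D `^ (eta / 100) by lra.
have y1 : 1 <= D `^ mu1 R beta.
  by rewrite -[leLHS](powRr0 D) powR_le_exp// ltW.
have X0 : 0 <= C * D `^ (tau + tau * s) by rewrite mulr_ge0// powR_ge0.
have upper m : largeP d m -> m%:R <= D `^ mu1 R beta.
  move=> /andP[_ /hasP[k _ /andP[kk sk]]].
  have k0R : 0 < k%:R :> R by apply: le_lt_trans kk; exact: powR_ge0.
  have k0 : (0 < k)%N by rewrite -(ltr_nat R).
  have h := sol_le_powR R alpha alpha1 d k m k0 sk.
  apply: (@le_trans _ _ (m%:R + k%:R)); first by rewrite lerDl ltW.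
  apply: (le_trans h); rewrite -/p -/beta.
  apply: (@le_trans _ _ ((2 * D `^ (1 - kappa1 R)) `^ beta)).
    apply: ler_powRl; first exact: ltW.
      by apply: divr_ge0; [rewrite addr_ge0|exact: ltW].
    rewrite (powRDD R D Dgt 1) powRr1 ?(ltW D0)// powRN mulrA.
    apply: ler_pM.
    - by rewrite addr_ge0.
    - by rewrite invr_ge0 ltW.
    - by rewrite -/D; lra.
    - by rewrite lef_pV2 ?posrE ?powR_gt0//; exact: ltW.
  rewrite powRM ?powR_ge0// -powRrM /mu1 (powRDD R D Dgt (beta * _)) mulrC [(1 - _) * _]mulrC.
  by apply: ler_wpM2l; [exact: powR_ge0|rewrite -/eta; lra].
have hb := @cnt_dyadic_le R (largeP d) (D `^ mu1 R beta) s _ B y1 s0 X0 upper.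
apply: (le_trans (hb _)).
  move=> i m /andP[im mi] lm; have /andP[mt _] := lm.
  have lowi := dyadic_lower D i m Dgt DD2 mi mt.
  apply: (H D _ (2 ^ i)%N (largeP d) (fun m => (m + find (fun k => (d%:R `^ kappa1 R < k%:R) && is_sol R alpha d k m)%R (iota 0 (solB R alpha d)))%N)) => //.
  + lra.
  + by rewrite expn_gt0.
  + by apply: (le_trans _ (upper m lm)); rewrite ler_nat.
  move=> m' _ /andP[_ hm'].
  have := nth_find 0%N hm'; move: (hm'); rewrite has_find size_iota => fl.
  rewrite nth_iota// add0n => /andP[_ /is_solP[f0 fG]].
  by rewrite natrD; exact: ltW.
rewrite -powRrM.
have e1 : 1 + D `^ (mu1 R beta * s) / (s * ln 2) <= c * D `^ (mu1 R beta * s).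
  have q1 : 1 <= D `^ (mu1 R beta * s).
    by rewrite -[leLHS](powRr0 D) powR_le_exp// mulr_ge0//; exact: ltW.
  by rewrite /c [leRHS]mulrDl mul1r [_^-1 * _]mulrC lerD2r.
apply: (le_trans (ler_wpM2r X0 e1)).
have -> : c * D `^ (mu1 R beta * s) * (C * D `^ (tau + tau * s)) =
  c * C * D `^ (mu1 R beta * s + (tau + tau * s)).
  by rewrite (powRDD R D Dgt (mu1 R beta * s)); ring.
apply: pmul_powR_le => //; first exact: mulr_ge0.
have tm : tau + mu1 R beta != 0 by rewrite gt_eqF// addr_gt0.
have e5 : eta / 100 = (tau + mu1 R beta) * s by rewrite /s [RHS]mulrC divfK.
by rewrite tau2E e5 le_eqVlt; apply/orP; left; apply/eqP; ring.
Qed.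

(** Up to D^tau2 every k may spend the summand 1 of [sol_cnt_le], up to D^kappa1 only those in
    [middleP], and beyond that solutions are counted by m, at most 3 for each. The other summand is
    kept as a sum over k > K0, which becomes the zeta tail. *)
Lemma tail_bound : exists C D1 : R, [/\ 0 <= C, 1 <= D1 & forall d K0 : nat, D1 <= d%:R ->
  (\sum_(K0.+1 <= k < solB R alpha d) cnt (is_sol R alpha d k) 0 (solB R alpha d))%N%:R <=
   C * d%:R `^ tau2 + 2 / (alpha * p) * (d%:R + 1) `^ (beta - 1) *
     \sum_(K0.+1 <= k < solB R alpha d) k%:R `^ (- beta)].
Proof.
have [C3 [D3 [C30 D31 H3]]] := middle_cnt_le.
have [C4 [D4 [C40 D41 H4]]] := large_cnt_le.
exists (1 + C3 + (3 + 3 * C4)), (D3 + D4); split; [by rewrite !addr_ge0// mulr_ge0|lra|].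
move=> d K0 dD; set B := solB R alpha d; set D : R := d%:R in dD *.
have Dgt : 1 < D by lra.
set cc := 2 / (alpha * p) * _.
have cc0 : 0 <= cc.
  by rewrite mulr_ge0 ?powR_ge0// divr_ge0// mulr_ge0// ltW.
pose big k m := (D `^ kappa1 R < k%:R) && is_sol R alpha d k m.
have each k : (0 < k < B)%N -> (cnt (is_sol R alpha d k) 0 B)%:R <=
    (k%:R <= D `^ tau2)%R%:R + (middleP d k)%:R + (cnt (big k) 0 B)%:R + cc * k%:R `^ (- beta).
  move=> /andP[k0 kB].
  have ck0 : 0 <= cc * k%:R `^ (- beta) by rewrite mulr_ge0// powR_ge0.
  have Sk : (cnt (is_sol R alpha d k) 0 B)%:R <= 1 + cc * k%:R `^ (- beta).
    have := sol_cnt_le R alpha alpha1 alpha2 d k B k0.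
    by rewrite -/p -/beta -/D mulrA.
  have m0 : 0 <= (middleP d k)%:R :> R by [].
  have b0 : 0 <= (cnt (big k) 0 B)%:R :> R by [].
  case: (leP k%:R (D `^ tau2)) => kt /=.
    apply: (le_trans Sk); lra.
  case: (leP k%:R (D `^ kappa1 R)) => kk.
    case: (boolP (has (is_sol R alpha d k) (iota 0 B))) => hs.
      have -> : middleP d k = true by rewrite /middleP kt kk.
      by apply: (le_trans Sk) => /=; lra.
    have -> : cnt (is_sol R alpha d k) 0 B = 0%N.
      rewrite /cnt big_nat big1// => m /andP[_ mB].
      apply/eqP; rewrite eqb0; apply: contra hs => sm.
      by apply/hasP; exists m => //; rewrite mem_iota add0n.
    rewrite /=; lra.
  have -> : cnt (big k) 0 B = cnt (is_sol R alpha d k) 0 B.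
    by rewrite /cnt; apply: eq_bigr => m _; rewrite /big kk.
  lra.
have sum1 : \sum_(K0.+1 <= k < B) (k%:R <= D `^ tau2)%R%:R <= D `^ tau2.
  apply: (le_trans _ (cnt_le_bound R (D `^ tau2) B (powR_ge0 _ _))).
  rewrite -natr_sum ler_nat -/(cnt _ _ _).
  have [B1|B1] := leqP B K0.+1; first by rewrite /cnt big_geq.
  by rewrite /cnt (big_cat_nat (_ : 1 <= K0.+1)%N (ltnW B1)) ?leq_addl.
have sum2 : \sum_(K0.+1 <= k < B) (middleP d k)%:R <= C3 * D `^ tau2.
  apply: (le_trans _ (H3 d B _)); last by rewrite -/D; lra.
  rewrite -natr_sum ler_nat -/(cnt _ _ _).
  have [B1|B1] := leqP B K0.+1; first by rewrite /cnt big_geq.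
  by rewrite /cnt (big_cat_nat (_ : 1 <= K0.+1)%N (ltnW B1)) ?leq_addl.
have sum3 : \sum_(K0.+1 <= k < B) (cnt (big k) 0 B)%:R <= (3 + 3 * C4) * D `^ tau2.
  rewrite -natr_sum.
  have h1 : (\sum_(K0.+1 <= k < B) cnt (big k) 0 B <=
      3 * cnt (fun m => (m%:R <= D `^ tau2)%R) 1 B + 3 * cnt (largeP d) 1 B)%N.
    rewrite /cnt exchange_big /= big_ltn//.
    rewrite [X in (X + _ <= _)%N]big1; last by move=> k _; rewrite /big /is_sol andbF.
    rewrite add0n !big_distrr -big_split /= big_nat [leqRHS]big_nat.
    apply: leq_sum => m /andP[m1 mB].
    have [all0|/negP ex] := boolP (all (fun k => ~~ big k m) (iota 0 B)).
      rewrite big_nat big1// => k /andP[_ kB]; apply/eqP; rewrite eqb0.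
      by move/allP: all0; apply; rewrite mem_iota add0n.
    have c3 : (\sum_(K0.+1 <= k < B) big k m <= 3)%N.
      apply: leq_trans (sol_cnt_row_le R alpha alpha1 d m B).
      have [B1|B1] := leqP B K0.+1; first by rewrite big_geq.
      rewrite /cnt (big_cat_nat (leq0n K0.+1) (ltnW B1))/=.
      apply: leq_trans (leq_addl _ _); rewrite big_nat [leqRHS]big_nat.
      apply: leq_sum => k /andP[k0 _]; rewrite (leq_ltn_trans _ k0)//=.
      by rewrite /big; case: (_ < _); case: (is_sol _ _ _ _ _).
    apply: (leq_trans c3).
    case: (leP m%:R (D `^ tau2)) => mt /=; first by rewrite muln1 leq_addr.
    rewrite muln0 add0n (_ : largeP d m = true)// /largeP mt /=.
    by apply/negPn/negP => nh; apply: ex; rewrite all_predC.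
  apply: (@le_trans _ _ (3 * (cnt (fun m => m%:R <= D `^ tau2) 1 B)%:R + 3 * (cnt (largeP d) 1 B)%:R)).
    by rewrite -!natrM -natrD ler_nat.
  have x1 := cnt_le_bound R (D `^ tau2) B (powR_ge0 _ _).
  have x2 : (cnt (largeP d) 1 B)%:R <= C4 * D `^ tau2 by apply: H4; rewrite -/D; lra.
  by rewrite [leRHS]mulrDl; apply: lerD; [|rewrite -mulrA]; apply: ler_wpM2l.
rewrite natr_sum.
apply: (@le_trans _ _ (\sum_(K0.+1 <= k < B) ((k%:R <= D `^ tau2)%R%:R + (middleP d k)%:R + (cnt (big k) 0 B)%:R + cc * k%:R `^ (- beta)))).
  rewrite big_nat [leRHS]big_nat; apply: ler_sum => k /andP[k0 kB].
  by apply: each; rewrite kB (leq_ltn_trans _ k0).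
rewrite !big_split /= -mulr_sumr; apply: lerD => //.
have -> : (1 + C3 + (3 + 3 * C4)) * D `^ tau2 =
  D `^ tau2 + C3 * D `^ tau2 + (3 + 3 * C4) * D `^ tau2 by ring.
by apply: lerD => //; exact: lerD.
Qed.

End tail.

(** * The zeta series and the limit *)

Section zeta.
Variable R : realType.
Implicit Type s : R.

(** Integral test. [riemannR] counts from 0, so its term [n.+1] is (n + 2)^(-s), compared with the
    increment of x^(1 - s) on [n + 1, n + 2]; the right-hand sides telescope. *)
Lemma riemannR_term_le s n : 1 < s ->
  riemannR s n.+1 <= (s - 1)^-1 * (n.+1%:R `^ (1 - s) - n.+2%:R `^ (1 - s)).
Proof.
move=> s1; have n0 : 0 < n.+1%:R :> R by rewrite ltr0n.
have nn : n.+1%:R < n.+2%:R :> R by rewrite ltr_nat.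
have [c /andP[nc cn] e] := powR_mvt R (1 - s) _ _ n0 nn.
have e1 : n.+2%:R - n.+1%:R = 1 :> R by rewrite -(@natr1 _ n.+1) addrAC subrr add0r.
have e2 : 1 - s - 1 = - s by ring.
rewrite e1 e2 mulr1 in e.
have -> : n.+1%:R `^ (1 - s) - n.+2%:R `^ (1 - s) = (s - 1) * c `^ (- s).
  by rewrite -opprB e; ring.
rewrite mulKf ?gt_eqF ?subr_gt0// /riemannR -powRN.
have sn : - s <= 0 by lra.
have c0 : 0 < c by lra.
exact: (ler_powRN R _ _ _ sn c0 (ltW cn)).
Qed.

Lemma riemannR_series_nd s : 1 < s -> nondecreasing_seq (series (riemannR s)).
Proof.
move=> s1; apply/nondecreasing_seqP => n; rewrite !seriesEnat /= big_nat_recr//=.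
by rewrite lerDl /riemannR invr_ge0 powR_ge0.
Qed.

Lemma is_cvg_riemannR s : 1 < s -> cvgn (series (riemannR s)).
Proof.
move=> s1; apply: nondecreasing_is_cvgn; first exact: riemannR_series_nd.
exists (1 + (s - 1)^-1) => _ [n _ <-].
have si : 0 < (s - 1)^-1 by rewrite invr_gt0 subr_gt0.
have h m : series (riemannR s) m.+1 <= 1 + (s - 1)^-1 * (1 - m.+1%:R `^ (1 - s)).
  elim: m => [|m IH].
    by rewrite seriesEnat /= big_nat1 /riemannR !powR1 invr1 subrr mulr0 addr0.
  rewrite seriesEnat /= big_nat_recr//= -[X in X + _]/(series (riemannR s) m.+1).
  have h2 := riemannR_term_le s m s1.
  apply: (le_trans (lerD IH h2)); rewrite -addrA lerD2l -mulrDr.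
  by rewrite (_ : 1 - _ + _ = 1 - m.+2%:R `^ (1 - s))//; ring.
apply: (@le_trans _ _ (series (riemannR s) n.+1)).
  exact: (riemannR_series_nd s s1 _ _ (leqnSn n)).
by apply: (le_trans (h n)); rewrite lerD2l ler_piMr ?(ltW si)//.
Qed.

Lemma series_riemannR_le_zeta s n : 1 < s -> series (riemannR s) n <= zeta s.
Proof.
move=> s1; apply: nondecreasing_cvgn_le; first exact: riemannR_series_nd.
exact: is_cvg_riemannR.
Qed.

Lemma sum_powRN_series s n :
  \sum_(1 <= k < n.+1) k%:R `^ (- s) = series (riemannR s) n.
Proof.
rewrite seriesEnat /= big_add1 /=.
by apply: eq_bigr => k _; rewrite /riemannR powRN.
Qed.

Lemma sum_powRN_tail_le s n B : 1 < s -> (n.+1 <= B)%N ->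
  \sum_(n.+1 <= k < B) k%:R `^ (- s) <= zeta s - series (riemannR s) n.
Proof.
move=> s1 nB; have B0 : (0 < B)%N by apply: leq_trans nB.
rewrite lerBrDl -(sum_powRN_series s n).
have n1 : (1 <= n.+1)%N by [].
rewrite -(big_cat_nat n1 nB)/= -(prednK B0) sum_powRN_series.
exact: series_riemannR_le_zeta.
Qed.

End zeta.

(** The closing estimate with its terms abstracted: [u] and [v] are the head and tail of the limit,
    [h] and [t] those of the quotient, and [w] bounds [t] up to eps / 4. *)
Lemma dist_le_from_parts (R : realType) (u v w t h eps : R) :
  v + w <= eps / 4 -> t <= eps / 4 + w -> 0 <= t -> 0 <= v -> 0 <= w ->
  `|u - h| <= eps / 4 -> - eps <= u + v - (h + t) <= eps.
Proof.
move=> vw tw t0 v0 w0; rewrite ler_norml => /andP[h1 h2].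
by apply/andP; split; lra.
Qed.

(** The sum over k is cut at an n independent of d: [main_term_cvg] treats each k <= n, and
    [tail_bound] is uniform in the cut, as in dominated convergence. *)
Theorem theorem1p1 (R : realType) (alpha beta : R)
  (halpha1 : 1 < alpha) (halpha2 : alpha < (Num.sqrt 21 + 4) / 5)
  (hbeta : beta = 1 / (alpha - 1)) :
  (rep_count alpha d)%:R / d%:R `^ (beta - 1) @[d --> \oo]
    --> beta * alpha `^ (- beta) * zeta beta.
Proof.
have /andP[s1 s2] := sqrt21_bounds R.
have alpha2 : alpha < 2 by lra.
rewrite div1r in hbeta.
have p0 : 0 < alpha - 1 by rewrite subr_gt0.
have beta_gt : betas R < beta.
  rewrite hbeta -[ltRHS]mul1r ltr_pdivlMr//.
  have s21 : Num.sqrt 21 ^+ 2 = 21 :> R by rewrite sqr_sqrtr.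
  have e : betas R * ((Num.sqrt 21 + 4) / 5 - 1) = 1.
    have g (s : R) : (1 + s) / 4 * ((s + 4) / 5 - 1) = (s ^+ 2 - 1) / 20 by field.
    by rewrite /betas g s21; field.
  rewrite -[ltRHS]e ltr_pM2l ?ltrD2r//.
  by have /andP[h _] := betas_bounds R; lra.
have beta1 : 1 < beta by have /andP[h _] := betas_bounds R; lra.
have beta0 : 0 < beta by lra.
have alpha0 : 0 < alpha by lra.
set c0 := beta * alpha `^ (- beta).
have c00 : 0 < c0 by rewrite mulr_gt0// powR_gt0.
pose S k d : R := (cnt (is_sol R alpha d k) 0 (solB R alpha d))%:R / d%:R `^ (beta - 1).
have Scvg k : (0 < k)%N -> S k d @[d --> \oo] --> c0 * k%:R `^ (- beta).
  move=> k0; rewrite /S /c0 hbeta; apply: main_term_cvg => // d m d0 sm.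
  by have := sol_lt_solB R alpha halpha1 d k m k0 sm; apply: leq_ltn_trans; exact: leq_addr.
have headcvg n : (\sum_(1 <= k < n.+1) S k d) @[d --> \oo] --> c0 * series (riemannR beta) n.
  rewrite -sum_powRN_series mulr_sumr; elim: n => [|n IH].
    by under eq_fun do rewrite big_geq//; rewrite big_geq//; exact: cvg_cst.
  under eq_fun do rewrite big_nat_recr//=; rewrite big_nat_recr//=.
  by apply: cvgD => //; exact: Scvg.
have [C [D1 [C0 D11 tailB]]] := tail_bound R alpha halpha1 alpha2 (eq_ind beta (fun b => betas R < b) beta_gt _ hbeta).
rewrite -!hbeta in tailB.
set c1 := 2 / (alpha * (alpha - 1)) in tailB.
have c10 : 0 <= c1 by rewrite divr_ge0// mulr_ge0// ltW.
pose c2 := c1 * 2 `^ (beta - 1).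
have c20 : 0 <= c2 by rewrite mulr_ge0// powR_ge0.
pose e0 := (beta - betas R) / 100.
have e00 : 0 < e0 by rewrite divr_gt0// subr_gt0.
have errcvg : C * d%:R `^ (- e0) @[d --> \oo] --> (0 : R).
  by rewrite -[X in _ --> X](mulr0 C); apply: cvgMr; exact: cvg_natr_powRN.
apply/cvgrPdist_le => eps eps0.
have M0 : 0 < 4 * (c0 + c2) by rewrite mulr_gt0// ltr_pwDl.
have eM : 0 < eps / (4 * (c0 + c2)) by rewrite divr_gt0.
(* The zeta tail enters twice, with [c0] in the limit and with [c2] in the bound for the
   quotient. *)
have [n hn] : exists n, zeta beta - series (riemannR beta) n <= eps / (4 * (c0 + c2)).
  have /cvgrPdist_le/(_ _ eM)[n _ hn] : series (riemannR beta) n @[n --> \oo] --> zeta beta.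
    exact: is_cvg_riemannR.
  by exists n; apply: (le_trans (ler_norm _)); apply: hn => /=.
set Z := series (riemannR beta) n in hn.
have Zz : 0 <= zeta beta - Z by rewrite subr_ge0; exact: series_riemannR_le_zeta.
have e4 : 0 < eps / 4 by rewrite divr_gt0.
near=> d.
have dD1 : D1 <= d%:R by near: d; exact: nbhs_infty_ger.
have d0R : 0 < d%:R :> R by lra.
have d0 : (0 < d)%N by rewrite -(ltr_nat R).
have hhead : `|c0 * Z - \sum_(1 <= k < n.+1) S k d| <= eps / 4.
  by near: d; move/cvgrPdist_le : (headcvg n); apply.
have herr : C * d%:R `^ (- e0) <= eps / 4.
  by near: d; exact: (cvgr_le _ errcvg).
(* The sum can be cut at n only if it extends beyond n, which holds since (d + 1)^beta >= d + 1. *)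
have nB : (n.+1 <= solB R alpha d)%N.
  have nd : (n <= d)%N by near: d; exact: nbhs_infty_ge.
  rewrite /solB ltnS; apply: (leq_trans nd).
  rewrite truncn_ge_nat ?powR_ge0// -hbeta.
  apply: (@le_trans _ _ (d%:R + 1)); first by rewrite lerDl.
  by apply: le1r_powR => //; [rewrite lerDr|exact: ltW].
have Nd0 : 0 < d%:R `^ (beta - 1) by exact: powR_gt0.
have headE : (rep_count alpha d)%:R / d%:R `^ (beta - 1) =
   \sum_(1 <= k < n.+1) S k d +
   (\sum_(n.+1 <= k < solB R alpha d) cnt (is_sol R alpha d k) 0 (solB R alpha d))%N%:R / d%:R `^ (beta - 1).
  rewrite (rep_countE R alpha halpha1 d d0) (big_cat_nat (_ : 1 <= n.+1)%N nB)//= natrD mulrDl.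
  by congr (_ + _); rewrite natr_sum mulr_suml.
rewrite headE.
set tl := _%:R / _.
have tl0 : 0 <= tl by rewrite divr_ge0// ltW.
have tlb : tl <= eps / 4 + c2 * (zeta beta - Z).
  rewrite /tl ler_pdivrMr//; apply: (le_trans (tailB d n dD1)); rewrite [leRHS]mulrDl.
  apply: lerD.
    have -> : C * d%:R `^ (beta - 1 - (beta - betas R) / 100) = C * d%:R `^ (- e0) * d%:R `^ (beta - 1).
      rewrite -mulrA -powRD; last by rewrite (gt_eqF d0R) implybT.
      by congr (_ * _ `^ _); rewrite /e0; ring.
    by apply: ler_wpM2r => //; exact: ltW.
  have h1 : (d%:R + 1) `^ (beta - 1) <= 2 `^ (beta - 1) * d%:R `^ (beta - 1).
    have b1 : 0 <= beta - 1 by rewrite subr_ge0 ltW.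
    have d1R : 1 <= d%:R :> R by rewrite ler1n.
    have d1 : 0 <= d%:R + 1 :> R by rewrite addr_ge0.
    have d2 : d%:R + 1 <= 2 * d%:R :> R by rewrite mulr_natl mulr2n lerD2l.
    by rewrite -powRM//; exact: (ler_powRl R _ _ _ b1 d1 d2).
  have h2 := sum_powRN_tail_le R beta n _ beta1 nB.
  have -> : c2 * (zeta beta - Z) * d%:R `^ (beta - 1) =
    c1 * (2 `^ (beta - 1) * d%:R `^ (beta - 1)) * (zeta beta - Z) by rewrite /c2; ring.
  apply: ler_pM => //.
  - by rewrite mulr_ge0// powR_ge0.
  - by apply: sumr_ge0 => k _; exact: powR_ge0.
  by apply: ler_wpM2l.
have hz : (c0 + c2) * (zeta beta - Z) <= eps / 4.
  apply: (@le_trans _ _ ((c0 + c2) * (eps / (4 * (c0 + c2))))).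
    by apply: ler_wpM2l => //; rewrite addr_ge0// ltW.
  rewrite le_eqVlt; apply/orP; left; apply/eqP; field.
  by rewrite gt_eqF// ltr_pwDl.
move: hhead; rewrite !ler_norml => /andP[q1 q2].
have z1 : 0 <= c0 * (zeta beta - Z) by rewrite mulr_ge0// ltW.
have z2 : 0 <= c2 * (zeta beta - Z) by rewrite mulr_ge0.
rewrite [leLHS]mulrDl in hz.
have -> : c0 * zeta beta = c0 * Z + c0 * (zeta beta - Z) by ring.
by apply: (dist_le_from_parts R _ _ _ _ _ _ hz tlb tl0 z1 z2); rewrite ler_norml q1.
Unshelve. all: by end_near. Qed.
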